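(* Let $V_1,V_2$ be finite-dimensional representations of $Y=Y_\hbar(\mathfrak g)$. The asymptotic expansion of $\mathcal R^{0,\uparrow}_{V_1,V_2}(s)$ (resp. $\mathcal R^{0,\downarrow}_{V_1,V_2}(s)$) as $s\to\infty$ in any halfplane $\mathrm{Re}(s/\ell\hbar)>m$ (resp. $\mathrm{Re}(s/\ell\hbar)<m$) is given by $$\mathcal R^0_{V_1,V_2}(s)=(\pi_{V_1}\otimes\pi_{V_2})(\mathcal R^0(s)).$$
   Context: Yangian. $\mathfrak g$ is a complex semisimple Lie algebra with an invariant symmetric nondegenerate bilinear form $(\cdot,\cdot)$, simple roots $\{\alpha_i\}_{i\in\mathbf I}$, Cartan matrix $a_{ij}=2(\alpha_i,\alpha_j)/(\alpha_i,\alpha_i)$; short roots have square length $2$ (in each simple factor), $d_i=(\alpha_i,\alpha_i)/2$. Fix $\hbar\in\mathbb C^\times$. $Y=Y_\hbar(\mathfrak g)$ is the unital algebra generated by $\{x^\pm_{i,r},\xi_{i,r}\}_{i\in\mathbf I,r\ge0}$ with relations: $[\xi_{i,r},\xi_{j,s}]=0$; $[\xi_{i,0},x^\pm_{j,s}]=\pm d_ia_{ij}x^\pm_{j,s}$; $[\xi_{i,r+1},x^\pm_{j,s}]-[\xi_{i,r},x^\pm_{j,s+1}]=\pm\hbar\frac{d_ia_{ij}}2(\xi_{i,r}x^\pm_{j,s}+x^\pm_{j,s}\xi_{i,r})$; $[x^\pm_{i,r+1},x^\pm_{j,s}]-[x^\pm_{i,r},x^\pm_{j,s+1}]=\pm\hbar\frac{d_ia_{ij}}2(x^\pm_{i,r}x^\pm_{j,s}+x^\pm_{j,s}x^\pm_{i,r})$;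 $[x^+_{i,r},x^-_{j,s}]=\delta_{ij}\xi_{i,r+s}$; and for $i\ne j$, $m=1-a_{ij}$: $\sum_{\pi\in\mathfrak S_m}[x^\pm_{i,r_{\pi(1)}},[\cdots,[x^\pm_{i,r_{\pi(m)}},x^\pm_{j,s}]\cdots]]=0$. Set $\xi_i(u)=1+\hbar\sum_{r\ge0}\xi_{i,r}u^{-r-1}$ and $t_i(u)=\hbar\sum_{r\ge0}t_{i,r}u^{-r-1}=\log\xi_i(u)$; $Y^0$ is the commutative subalgebra generated by the $\xi_{i,r}$. $\pi_V$ denotes the action on $V$. Suppose first $\mathfrak g$ simple. Let $\ell=\frac{(\theta,\theta)}2h^\vee$ ($\theta$ highest root, $h^\vee$ dual Coxeter number), $[n]_q=\frac{q^n-q^{-n}}{q-q^{-1}}$, and $c_{ij}(q)=\sum_{r\in\mathbb Z}c_{ij}^{(r)}q^r\in\mathbb Z_{\ge0}[q,q^{-1}]$ the entries of $[\ell]_q\cdot([d_ia_{ij}]_q)^{-1}$. Meromorphic abelian $R$-matrices. On a finite-dimensional $V$, $\xi_i(u)$ is rational in $u$ with $\xi_i(\infty)=1$; $\sigma_V(\xi_i)$ is the set of poles of $\xi_i(u)^{\pm1}$, and $t_i(u)$ extends to the holomorphic logarithm of $\xi_i(u)$ on $\mathbb C\setminus\bigcup_{a\in\sigma_V(\xi_i)}[0,a]$ with $t_i(\infty)=0$. For $|s|$ large, $$\mathcal A_{V_1,V_2}(s)=\exp\Big(-\sum_{i,j\in\mathbf I,\,r\in\mathbb Z}c_{ij}^{(r)}\oint_{C_1}\frac{dt_i(v)}{dv}\otimes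 t_j\big(v+s+\tfrac{(\ell+r)\hbar}2\big)dv\Big),$$ where $\oint$ includes $1/(2\pi\sqrt{-1})$ and $C_1$ encloses $\sigma_{V_1}(\xi_i)$, the second factor being analytic inside $C_1$. It extends to a rational function of $s$ of the form $1+O(s^{-2})$, with commuting values. $\mathcal R^{0,\uparrow}_{V_1,V_2}(s)=\prod_{n\ge0}\mathcal A_{V_1,V_2}(s+n\ell\hbar)^{-1}$ and $\mathcal R^{0,\downarrow}_{V_1,V_2}(s)=\prod_{n\ge1}\mathcal A_{V_1,V_2}(s-n\ell\hbar)$; these are the meromorphic solutions of $\mathcal R^0(s+\ell\hbar)=\mathcal A_{V_1,V_2}(s)\mathcal R^0(s)$ which are holomorphic and invertible for $\mathrm{Re}(s/\ell\hbar)\gg0$, resp. $\ll0$, with asymptotic expansion of the form $1+O(s^{-1})$ in any halfplane $\mathrm{Re}(s/\ell\hbar)>m$, resp. $<m$. The formal element. Let $g(x)\in x^{-1}\mathbb C[[x^{-1}]]$ be the unique solution of $g(x+1)=g(x)-x^{-2}$, $B_k(z)=\hbar\sum_{n\ge0}\frac{t_{k,n}}{n!}z^n$, $T_mf(s)=f(s+m\hbar)$. $\mathcal R^0(s)\in1+s^{-1}(Y^0\otimes Y^0)[[s^{-1}]]$ is defined by $$\log\mathcal R^0(s)=\frac1{\ell^2\hbar^2}\sum_{i,j\in\mathbf I,\,r\in\mathbb Z}c_{ij}^{(r)}\,T_{\frac{\ell+r}2}\,B_i(\partial_s)\otimes B_j(-\partial_s)\,g\Big(\frac s{\ell\hbar}\Big).$$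 For semisimple $\mathfrak g$, $\mathcal R^0(s)$ and $\mathcal R^{0,\uparrow/\downarrow}_{V_1,V_2}(s)$ are products of the corresponding (commuting) objects over the simple factors, and since $\ell>0$ the halfplanes are those defined by $\mathrm{Re}(s/\hbar)$. *)

(* Defs.v *)
From HB Require Import structures.
From mathcomp Require Import all_boot all_order all_algebra.
From mathcomp Require Import perm.
From mathcomp Require Import all_classical all_reals all_analysis.
From mathcomp Require Import complex mxtens.

Set Implicit Arguments.
Unset Strict Implicit.
Unset Printing Implicit Defensive.

Import Order.TTheory GRing.Theory Num.Theory.
Import numFieldNormedType.Exports.

Local Open Scope classical_set_scope.
Local Open Scope ring_scope.

(* The unital associative algebra [palg rel] generated by [G] with relations
   [rel] is a quotient of the terms [aterm].  It may be the zero ring, hence is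
   not an [algType] in general. *)

Section Presentation.
Variables (K : comPzRingType) (G : Type).

Inductive aterm : Type :=
| TGen of G
| TZero
| TOne
| TOpp of aterm
| TAdd of aterm & aterm
| TMul of aterm & aterm
| TScale of K & aterm.

Variable rel : aterm -> aterm -> Prop.

(* The least congruence containing [rel] and the axioms of unital algebras. *)
Inductive acong : aterm -> aterm -> Prop :=
| acong_rel x y : rel x y -> acong x y
| acong_refl x : acong x x
| acong_sym x y : acong x y -> acong y x
| acong_trans y x z : acong x y -> acong y z -> acong x z
| acong_opp x x' : acong x x' -> acong (TOpp x) (TOpp x')
| acong_add x x' y y' :
    acong x x' -> acong y y' -> acong (TAdd x y) (TAdd x' y')
| acong_mul x x' y y' :
    acong x x' -> acong y y' -> acong (TMul x y) (TMul x' y')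
| acong_scale c x x' : acong x x' -> acong (TScale c x) (TScale c x')
| acong_addA x y z : acong (TAdd x (TAdd y z)) (TAdd (TAdd x y) z)
| acong_addC x y : acong (TAdd x y) (TAdd y x)
| acong_add0 x : acong (TAdd TZero x) x
| acong_addN x : acong (TAdd (TOpp x) x) TZero
| acong_mulA x y z : acong (TMul x (TMul y z)) (TMul (TMul x y) z)
| acong_mul1l x : acong (TMul TOne x) x
| acong_mul1r x : acong (TMul x TOne) x
| acong_mulDl x y z : acong (TMul (TAdd x y) z) (TAdd (TMul x z) (TMul y z))
| acong_mulDr x y z : acong (TMul x (TAdd y z)) (TAdd (TMul x y) (TMul x z))
| acong_scaleA c d x : acong (TScale c (TScale d x)) (TScale (c * d) x)
| acong_scale1 x : acong (TScale 1 x) x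
| acong_scaleDr c x y :
    acong (TScale c (TAdd x y)) (TAdd (TScale c x) (TScale c y))
| acong_scaleDl c d x :
    acong (TScale (c + d) x) (TAdd (TScale c x) (TScale d x))
| acong_scaleAl c x y : acong (TScale c (TMul x y)) (TMul (TScale c x) y)
| acong_scaleAr c x y : acong (TScale c (TMul x y)) (TMul x (TScale c y)).

HB.instance Definition _ := gen_eqMixin aterm.
HB.instance Definition _ := gen_choiceMixin aterm.

Definition acongb (x y : aterm) : bool := `[< acong x y >].

Lemma acongb_refl : reflexive acongb.
Proof. by move=> x; apply/asboolP; exact: acong_refl. Qed.

Lemma acongb_sym : symmetric acongb.
Proof. by move=> x y; apply/asboolP/asboolP; exact: acong_sym. Qed.

Lemma acongb_trans : transitive acongb.
Proof.
by move=> y x z /asboolP xy /asboolP yz; apply/asboolP; exact: acong_trans xy yz.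
Qed.

Canonical acong_equiv := EquivRel acongb acongb_refl acongb_sym acongb_trans.

Definition palg : Type := {eq_quot acong_equiv}%qT.
HB.instance Definition _ := Choice.on palg.
HB.instance Definition _ := EqQuotient.on palg.

Definition apres (x : aterm) : palg := (\pi_palg x)%qT.
Definition aterm_of (x : palg) : aterm := generic_quotient.repr x.

Lemma apresP x y : apres x = apres y <-> acong x y.
Proof.
split=> [/eqquotP/asboolP //|xy].
by apply/eqquotP/asboolP.
Qed.

Lemma aterm_ofK : cancel aterm_of apres.
Proof. by move=> x; rewrite /apres /aterm_of reprK. Qed.

Lemma acong_of x : acong (aterm_of (apres x)) x.
Proof. by apply/apresP; rewrite aterm_ofK. Qed.

Definition palg_zero : palg := apres TZero.
Definition palg_one : palg := apres TOne.
Definition palg_opp (x : palg) : palg := apres (TOpp (aterm_of x)).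
Definition palg_add (x y : palg) : palg := apres (TAdd (aterm_of x) (aterm_of y)).
Definition palg_mul (x y : palg) : palg := apres (TMul (aterm_of x) (aterm_of y)).
Definition palg_scale (c : K) (x : palg) : palg := apres (TScale c (aterm_of x)).

Lemma palg_oppE x : palg_opp (apres x) = apres (TOpp x).
Proof. by apply/apresP; apply: acong_opp; exact: acong_of. Qed.

Lemma palg_addE x y : palg_add (apres x) (apres y) = apres (TAdd x y).
Proof. by apply/apresP; apply: acong_add; exact: acong_of. Qed.

Lemma palg_mulE x y : palg_mul (apres x) (apres y) = apres (TMul x y).
Proof. by apply/apresP; apply: acong_mul; exact: acong_of. Qed.

Lemma palg_scaleE c x : palg_scale c (apres x) = apres (TScale c x).
Proof. by apply/apresP; apply: acong_scale; exact: acong_of. Qed.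

Let palgE := (palg_oppE, palg_addE, palg_mulE, palg_scaleE).

Lemma palg_ind (P : palg -> Prop) : (forall t, P (apres t)) -> forall x, P x.
Proof. by move=> Pt x; rewrite -(aterm_ofK x). Qed.

Lemma palg_addA : associative palg_add.
Proof.
elim/palg_ind=> x; elim/palg_ind=> y; elim/palg_ind=> z.
by rewrite !palgE; apply/apresP; exact: acong_addA.
Qed.

Lemma palg_addC : commutative palg_add.
Proof.
elim/palg_ind=> x; elim/palg_ind=> y.
by rewrite !palgE; apply/apresP; exact: acong_addC.
Qed.

Lemma palg_add0 : left_id palg_zero palg_add.
Proof. by elim/palg_ind=> x; rewrite !palgE; apply/apresP; exact: acong_add0. Qed.

Lemma palg_addN : left_inverse palg_zero palg_opp palg_add.
Proof. by elim/palg_ind=> x; rewrite !palgE; apply/apresP; exact: acong_addN. Qed.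

HB.instance Definition _ :=
  GRing.isZmodule.Build palg palg_addA palg_addC palg_add0 palg_addN.

Lemma palg_mulA : associative palg_mul.
Proof.
elim/palg_ind=> x; elim/palg_ind=> y; elim/palg_ind=> z.
by rewrite !palgE; apply/apresP; exact: acong_mulA.
Qed.

Lemma palg_mul1l : left_id palg_one palg_mul.
Proof. by elim/palg_ind=> x; rewrite !palgE; apply/apresP; exact: acong_mul1l. Qed.

Lemma palg_mul1r : right_id palg_one palg_mul.
Proof. by elim/palg_ind=> x; rewrite !palgE; apply/apresP; exact: acong_mul1r. Qed.

Lemma palg_mulDl : left_distributive palg_mul +%R.
Proof.
elim/palg_ind=> x; elim/palg_ind=> y; elim/palg_ind=> z.
by rewrite /+%R /= !palgE; apply/apresP; exact: acong_mulDl.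
Qed.

Lemma palg_mulDr : right_distributive palg_mul +%R.
Proof.
elim/palg_ind=> x; elim/palg_ind=> y; elim/palg_ind=> z.
by rewrite /+%R /= !palgE; apply/apresP; exact: acong_mulDr.
Qed.

HB.instance Definition _ := GRing.Zmodule_isPzRing.Build palg
  palg_mulA palg_mul1l palg_mul1r palg_mulDl palg_mulDr.

Lemma palg_scaleA a b x : palg_scale a (palg_scale b x) = palg_scale (a * b) x.
Proof.
by elim/palg_ind: x => x; rewrite !palgE; apply/apresP; exact: acong_scaleA.
Qed.

Lemma palg_scale1 : left_id 1 palg_scale.
Proof. by elim/palg_ind=> x; rewrite !palgE; apply/apresP; exact: acong_scale1. Qed.

Lemma palg_scaleDr : right_distributive palg_scale +%R.
Proof.
move=> c; elim/palg_ind=> x; elim/palg_ind=> y.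
by rewrite /+%R /= !palgE; apply/apresP; exact: acong_scaleDr.
Qed.

Lemma palg_scaleDl x : {morph palg_scale^~ x : a b / a + b}.
Proof.
move=> a b; elim/palg_ind: x => x.
by rewrite [RHS]/+%R /= !palgE; apply/apresP; exact: acong_scaleDl.
Qed.

HB.instance Definition _ := GRing.Zmodule_isLmodule.Build K palg
  palg_scaleA palg_scale1 palg_scaleDr palg_scaleDl.

Lemma palg_scaleAl (a : K) (x y : palg) : a *: (x * y) = (a *: x) * y.
Proof.
elim/palg_ind: x => x; elim/palg_ind: y => y.
by rewrite /*:%R /*%R /= !palgE; apply/apresP; exact: acong_scaleAl.
Qed.

Lemma palg_scaleAr (a : K) (x y : palg) : a *: (x * y) = x * (a *: y).
Proof.
elim/palg_ind: x => x; elim/palg_ind: y => y.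
by rewrite /*:%R /*%R /= !palgE; apply/apresP; exact: acong_scaleAr.
Qed.

Definition pgen (x : G) : palg := apres (TGen x).

End Presentation.

Arguments TZero {K G}.
Arguments TOne {K G}.
Arguments TGen {K G}.
Arguments TAdd {K G}.
Arguments apres {K G} rel x.
Arguments pgen {K G rel} x.

Section UniversalProperty.
Variables (K : comPzRingType) (G : Type) (rel : aterm K G -> aterm K G -> Prop).
Variables (n : nat) (f : G -> 'M[K]_n).

Fixpoint aeval (t : aterm K G) : 'M[K]_n :=
  match t with
  | TGen x => f x
  | TZero => 0
  | TOne => 1
  | TOpp x => - aeval x
  | TAdd x y => aeval x + aeval y
  | TMul x y => aeval x * aeval y
  | TScale c x => c *: aeval x
  end.

(* Only meaningful when [f] sends related terms to equal matrices: this is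
   then the algebra morphism extending [f], by [palg_lift_apres]. *)
Definition palg_lift (x : palg rel) : 'M[K]_n := aeval (aterm_of x).

Hypothesis frel : forall x y, rel x y -> aeval x = aeval y.

Lemma aeval_cong x y : acong rel x y -> aeval x = aeval y.
Proof.
elim=> {x y} //=.
- by move=> y x z _ -> _ ->.
- by move=> x x' _ ->.
- by move=> x x' y y' _ -> _ ->.
- by move=> x x' y y' _ -> _ ->.
- by move=> c x x' _ ->.
- by move=> x y z; rewrite addrA.
- by move=> x y; rewrite addrC.
- by move=> x; rewrite add0r.
- by move=> x; rewrite addNr.
- by move=> x y z; rewrite mulrA.
- by move=> x; rewrite mul1r.
- by move=> x; rewrite mulr1.
- by move=> x y z; rewrite mulrDl.
- by move=> x y z; rewrite mulrDr.
- by move=> c d x; rewrite scalerA.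
- by move=> x; rewrite scale1r.
- by move=> c x y; rewrite scalerDr.
- by move=> c d x; rewrite scalerDl.
- by move=> c x y; exact: scalemxAl.
- by move=> c x y; exact: scalemxAr.
Qed.

Lemma palg_lift_apres t : palg_lift (apres rel t) = aeval t.
Proof. by apply: aeval_cong; exact: acong_of. Qed.

End UniversalProperty.

Declare Scope aterm_scope.
Delimit Scope aterm_scope with AT.
Notation "0" := TZero : aterm_scope.
Notation "1" := TOne : aterm_scope.
Notation "x + y" := (TAdd x y) : aterm_scope.
Notation "x - y" := (TAdd x (TOpp y)) : aterm_scope.
Notation "x * y" := (TMul x y) : aterm_scope.
Notation "c *: x" := (TScale c%R x) : aterm_scope.

Definition tcomm (K : comPzRingType) (G : Type) (x y : aterm K G) : aterm K G :=
  (x * y - y * x)%AT.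

(* The tensor product [A (x) B] is the algebra generated by commuting copies of
   [A] and [B]. *)

Section Tensor.
Variables (K : comPzRingType) (A B : algType K).

Local Notation inA a := (TGen (inl a) : aterm K (A + B)).
Local Notation inB b := (TGen (inr b) : aterm K (A + B)).

Inductive tens_rel : aterm K (A + B) -> aterm K (A + B) -> Prop :=
| tens_addl a a' : tens_rel (inA (a + a')) (inA a + inA a')%AT
| tens_scalel c a : tens_rel (inA (c *: a)) (c *: inA a)%AT
| tens_mull a a' : tens_rel (inA (a * a')) (inA a * inA a')%AT
| tens_onel : tens_rel (inA 1) 1%AT
| tens_addr b b' : tens_rel (inB (b + b')) (inB b + inB b')%AT
| tens_scaler c b : tens_rel (inB (c *: b)) (c *: inB b)%AT
| tens_mulr b b' : tens_rel (inB (b * b')) (inB b * inB b')%AT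
| tens_oner : tens_rel (inB 1) 1%AT
| tens_comm a b : tens_rel (inA a * inB b)%AT (inB b * inA a)%AT.

Definition tensalg := palg tens_rel.
HB.instance Definition _ := GRing.PzRing.on tensalg.
HB.instance Definition _ := GRing.Lmodule.on tensalg.

Definition tens (a : A) (b : B) : tensalg := pgen (inl a) * pgen (inr b).

Section Map.
Variables (n1 n2 : nat).
Variables (f : {lrmorphism A -> 'M[K]_n1}) (g : {lrmorphism B -> 'M[K]_n2}).

Definition tens_gen_map (x : A + B) : 'M[K]_(n1 * n2) :=
  match x with inl a => f a *t 1%:M | inr b => 1%:M *t g b end.

(* The morphism [f (x) g], with values in the Kronecker products. *)
Definition tens_map (x : tensalg) : 'M[K]_(n1 * n2) :=
  palg_lift tens_gen_map x.

Lemma tens_gen_map_rel x y :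
  tens_rel x y -> aeval tens_gen_map x = aeval tens_gen_map y.
Proof.
have tD1 m n (a b : 'M[K]_m) (c : 'M[K]_n) : (a + b) *t c = a *t c + b *t c.
  by apply/matrixP=> i j; rewrite !mxE mulrDl.
have tD2 m n (a b : 'M[K]_m) (c : 'M[K]_n) : c *t (a + b) = c *t a + c *t b.
  by apply/matrixP=> i j; rewrite !mxE mulrDr.
have tZ1 m n k (a : 'M[K]_m) (c : 'M[K]_n) : (k *: a) *t c = k *: (a *t c).
  by apply/matrixP=> i j; rewrite !mxE mulrA.
have tZ2 m n k (a : 'M[K]_m) (c : 'M[K]_n) : c *t (k *: a) = k *: (c *t a).
  by apply/matrixP=> i j; rewrite !mxE mulrCA.
have t11 m n : (1%:M : 'M[K]_m) *t (1%:M : 'M[K]_n) = 1.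
  apply/matrixP=> i j; case: (mxtens_indexP i)=> i1 i2.
  case: (mxtens_indexP j)=> j1 j2; rewrite tensmxE !mxE.
  rewrite (can_eq (@mxtens_indexK _ _)) xpair_eqE.
  by case: eqP; case: eqP; rewrite /= ?mulr1 ?mulr0 ?mul0r.
case=> /=.
- by move=> a a'; rewrite raddfD tD1.
- by move=> c a; rewrite linearZ tZ1.
- by move=> a a'; rewrite rmorphM /= -[RHS]/(_ *m _) tensmx_mul mulmx1.
- by rewrite rmorph1; exact: t11.
- by move=> a a'; rewrite raddfD tD2.
- by move=> c a; rewrite linearZ tZ2.
- by move=> a a'; rewrite rmorphM /= -[RHS]/(_ *m _) tensmx_mul mulmx1.
- by rewrite (rmorph1 g); exact: t11.
- by move=> a b; rewrite -[LHS]/(_ *m _) -[RHS]/(_ *m _) !tensmx_mul !mulmx1 !mul1mx.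
Qed.

Lemma tens_mapE a b : tens_map (tens a b) = f a *t g b.
Proof.
have -> : tens a b = apres _ (TMul (TGen (inl a)) (TGen (inr b))).
  by rewrite /tens /pgen -palg_mulE.
rewrite /tens_map palg_lift_apres /=; last exact: tens_gen_map_rel.
by rewrite -[LHS]/(_ *m _) tensmx_mul mulmx1 mul1mx.
Qed.

End Map.
End Tensor.

Definition dynkin_edge (n : nat) (a : 'M[int]_n) : rel 'I_n :=
  fun i j => a i j != 0.

(* A complex semisimple Lie algebra with its invariant form is encoded by its
   Cartan matrix [a_ij] and the numbers [d_i = (alpha_i, alpha_i) / 2], so that
   [(alpha_i, alpha_j) = d_i a_ij]; [x : 'rV[int]_n] stands for the element
   [\sum_i x_i alpha_i] of the root lattice.  The last field says that in each
   simple factor the short roots have square length 2. *)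
Record semisimple (n : nat) := Semisimple {
  cartan :> 'M[int]_n;
  dsym : 'I_n -> nat;
  cartan_diag : forall i, cartan i i = 2;
  cartan_offdiag : forall i j, i != j -> cartan i j <= 0;
  cartan_sym : forall i j,
    (dsym i)%:Z * cartan i j = (dsym j)%:Z * cartan j i;
  cartan_posdef : forall x : 'rV[int]_n, x != 0 ->
    0 < \sum_i \sum_j x 0 i * x 0 j * ((dsym i)%:Z * cartan i j);
  dsym_gt0 : forall i, (0 < dsym i)%N;
  dsym_short : forall i,
    exists2 k, connect (dynkin_edge cartan) i k & dsym k = 1%N
}.

Section RootData.
Variables (n : nat) (g : semisimple n).

(* Connected components of the Dynkin diagram, as sets of vertices. *)
Definition simple_factors : {set {set 'I_n}} :=
  equivalence_partition (connect (dynkin_edge g)) [set: 'I_n]%SET.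

Definition ipsimple (i j : 'I_n) : int := (dsym g i)%:Z * g i j.

Definition iproot (x y : 'rV[int]_n) : int :=
  \sum_i \sum_j x 0 i * y 0 j * ipsimple i j.

Definition simple_root (i : 'I_n) : 'rV[int]_n := delta_mx 0 i.

(* [s_i x = x - <x, alpha_i^vee> alpha_i]. *)
Definition simple_reflection (i : 'I_n) (x : 'rV[int]_n) : 'rV[int]_n :=
  x - (\sum_j x 0 j * g i j) *: simple_root i.

Inductive is_root : 'rV[int]_n -> Prop :=
| root_simple i : is_root (simple_root i)
| root_reflection i x : is_root x -> is_root (simple_reflection i x).

Section Factor.
Variable S : {set 'I_n}.

Definition is_factor_root (x : 'rV[int]_n) : Prop :=
  is_root x /\ forall i, i \notin S -> x 0 i = 0.

Definition highest_root : 'rV[int]_n :=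
  xget 0 [set x | is_factor_root x /\
            forall y, is_factor_root y -> forall i, y 0 i <= x 0 i].

(* [(theta, theta) / 2]; the division is exact. *)
Definition half_theta2 : int := divz (iproot highest_root highest_root) 2.

(* [h^vee = 1 + <rho, theta^vee>] is one plus the sum of the coefficients
   [theta_i d_i / ((theta, theta) / 2)] of the coroot [theta^vee] on the simple
   coroots; these divisions are exact. *)
Definition dual_coxeter : int :=
  1 + \sum_(i in S) divz (highest_root 0 i * (dsym g i)%:Z) half_theta2.

Definition ell : int := half_theta2 * dual_coxeter.

Definition qvar : {fraction {poly rat}} := FracField.tofrac 'X.

Definition qint (m : int) : {fraction {poly rat}} :=
  (qvar ^ m - qvar ^ (- m)) / (qvar - qvar^-1).

(* As [([d_i a_ij]_q)] is block diagonal, the entries of its inverse which are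
   indexed by [S] are those of the inverse of the block of the factor [S]. *)
Definition qcartan_inv : 'M[{fraction {poly rat}}]_n :=
  qint ell *: invmx (\matrix_(i, j) qint (ipsimple i j)).

(* The coefficients [c_ij^(r)]. *)
Definition qcoef (i j : 'I_n) : int -> nat :=
  xget (fun=> 0%N)
    [set c : int -> nat | finite_set [set r | c r != 0%N] /\
       \sum_(r \in [set: int]) (c r)%:R * qvar ^ r = qcartan_inv i j].

End Factor.
End RootData.

(* [R[i]] packaged as a field, so that it inherits the topology and the norm of
   number fields. *)
Definition Cplx (R : realType) : numClosedFieldType := R[i].

Inductive ygenerator (n : nat) :=
| YX of bool & 'I_n & nat
| YXi of 'I_n & nat.

Section Yangian.
Variables (R : realType) (n : nat) (g : semisimple n) (hbar : Cplx R).

Local Notation C := (Cplx R).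
Local Notation term := (aterm C (ygenerator n)).

(* The generators [x^+], [x^-] are [xterm true] and [xterm false]. *)
Definition xterm (b : bool) (i : 'I_n) (r : nat) : term := TGen (YX b i r).
Definition xiterm (i : 'I_n) (r : nat) : term := TGen (YXi i r).
Definition signC (b : bool) : C := if b then 1 else -1.
Definition ipC (i j : 'I_n) : C := (ipsimple g i j)%:~R.

Inductive yangian_rel : term -> term -> Prop :=
| yrel_xi_xi i j r s : yangian_rel (tcomm (xiterm i r) (xiterm j s)) 0%AT
| yrel_xi0_x b i j s :
    yangian_rel (tcomm (xiterm i 0) (xterm b j s))
      ((signC b * ipC i j) *: xterm b j s)%AT
| yrel_xi_x b i j r s :
    yangian_rel
      (tcomm (xiterm i r.+1) (xterm b j s)
         - tcomm (xiterm i r) (xterm b j s.+1))%AT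
      ((signC b * hbar * (ipC i j / 2)) *:
         (xiterm i r * xterm b j s + xterm b j s * xiterm i r))%AT
| yrel_x_x b i j r s :
    yangian_rel
      (tcomm (xterm b i r.+1) (xterm b j s)
         - tcomm (xterm b i r) (xterm b j s.+1))%AT
      ((signC b * hbar * (ipC i j / 2)) *:
         (xterm b i r * xterm b j s + xterm b j s * xterm b i r))%AT
| yrel_xp_xm i j r s :
    yangian_rel (tcomm (xterm true i r) (xterm false j s))
      (if i == j then xiterm i (r + s) else TZero)
| yrel_serre b i j (m : nat) (r : 'I_m -> nat) s :
    i != j -> m%:Z = 1 - g i j ->
    yangian_rel
      (\big[TAdd/TZero]_(p : 'S_m)
         foldr (fun k => tcomm (xterm b i (r (p k)))) (xterm b j s)
           (enum 'I_m))
      0%AT.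

Definition yangian : Type := palg yangian_rel.

HB.instance Definition _ := GRing.PzRing.on yangian.
HB.instance Definition _ := GRing.Lmodule.on yangian.

Lemma yangian_oner_neq0 : (1 : yangian) != 0.
Proof.
pose f (_ : ygenerator n) : 'M[C]_1 := 0.
apply/eqP => /apresP /(@aeval_cong _ _ _ _ f) /= /(_ _)/eqP.
have h : forall x y, yangian_rel x y -> aeval f x = aeval f y.
  move=> x y [] /=; rewrite /f.
  - by move=> *; rewrite mulr0 subr0.
  - by move=> *; rewrite !mulr0 subr0 scaler0.
  - by move=> *; rewrite !mulr0 !subr0 addr0 scaler0.
  - by move=> *; rewrite !mulr0 !subr0 addr0 scaler0.
  - by move=> i j r s; rewrite mulr0 subr0; case: eqP.
  - move=> b i j m r s _ _.
    apply: (big_ind (fun t => aeval f t = 0)) => //= [t u -> ->|p _].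
      by rewrite addr0.
    by elim: (enum _) => //= k l ->; rewrite !mulr0 subr0.
by move=> /(_ h); rewrite oner_eq0.
Qed.

HB.instance Definition _ :=
  GRing.PzSemiRing_isNonZero.Build yangian yangian_oner_neq0.
HB.instance Definition _ :=
  GRing.Lmodule_isLalgebra.Build C yangian (@palg_scaleAl _ _ yangian_rel).
HB.instance Definition _ :=
  GRing.Lalgebra_isAlgebra.Build C yangian (@palg_scaleAr _ _ yangian_rel).

Definition yx (b : bool) (i : 'I_n) (r : nat) : yangian := pgen (YX b i r).
Definition yxi (i : 'I_n) (r : nat) : yangian := pgen (YXi i r).

End Yangian.

(* [f : fps A] stands for the formal series [\sum_k f k * u^-k]. *)

Definition fps (A : Type) := nat -> A.

Section Fps.
Variables (K : fieldType) (A : pzRingType).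

Definition fps_one : fps A := fun k => (k == 0%N)%:R.

Definition fps_mul (f h : fps A) : fps A :=
  fun k => \sum_(j < k.+1) f j * h (k - j)%N.

Definition fps_pow (f : fps A) (m : nat) : fps A := iter m (fps_mul f) fps_one.

(* [f (u + a)], from
   [(u + a)^-j = \sum_l (-1)^l * 'C(j + l - 1, l) * a^l * u^-(j + l)]. *)
Definition fps_shift (a : K) (f : fps K) : fps K :=
  fun k => \sum_(j < k.+1)
             (-1) ^+ (k - j) * 'C(k.-1, k - j)%:R * a ^+ (k - j) * f j.

Definition fps_deriv (f : fps K) : fps K := fun k => - (k.-1)%:R * f k.-1.

(* The series [g] such that [g (x + 1) = g x - x^-2]. *)
Definition gser : fps K :=
  xget (fun=> 0)
    [set f : fps K | f 0%N = 0 /\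
       forall k, fps_shift 1 f k = f k - (k == 2%N)%:R].

End Fps.

(* [log (1 + f)] and [exp f] for a series [f] without constant term; only the
   powers of [f] of exponent at most [k] contribute to the coefficient [k]. *)
Definition fps_log1p (K : fieldType) (A : algType K) (f : fps A) : fps A :=
  fun k => \sum_(1 <= m < k.+1) ((-1) ^+ m.-1 / m%:R) *: fps_pow f m k.

Definition fps_expt (K : fieldType) (A B : algType K) (f : fps (tensalg A B)) :
    fps (tensalg A B) :=
  fun k => \sum_(0 <= m < k.+1) (m`!%:R)^-1 *: fps_pow f m k.

Section FormalR.
Variables (R : realType) (n : nat) (g : semisimple n) (hbar : Cplx R).

Local Notation C := (Cplx R).
Local Notation Y := (yangian g hbar).

(* [hbar * \sum_r t_{i,r} u^(-r-1) = log (1 + hbar * \sum_r xi_{i,r} u^(-r-1))] *)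
Definition yt (i : 'I_n) (r : nat) : Y :=
  hbar^-1 *:
    fps_log1p (fun k => if k is l.+1 then hbar *: yxi g hbar i l else 0) r.+1.

(* [B_i (d/ds) (x) B_j (- d/ds)] applied to a scalar series [f] without constant
   term; the coefficient [k] of [f^(l+m)] vanishes unless [l + m < k]. *)
Definition BB (i j : 'I_n) (f : fps C) : fps (tensalg Y Y) :=
  fun k => \sum_(l < k) \sum_(m < k)
    (hbar ^+ 2 * ((-1) ^+ m / (l`! * m`!)%:R) * iter (l + m) (@fps_deriv C) f k)
      *: tens (yt i l) (yt j m).

Section Factor.
Variable S : {set 'I_n}.

Definition ellC : C := (ell g S)%:~R.

Definition logR0 : fps (tensalg Y Y) :=
  fun k => ((ellC * hbar) ^+ 2)^-1 *:
    \sum_(i in S) \sum_(j in S) \sum_(r \in [set: int])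
      (qcoef g S i j r)%:R *:
        BB i j (fps_shift ((ellC + r%:~R) / 2 * hbar)
                  (fun p => gser C p * (ellC * hbar) ^+ p)) k.

End Factor.

Definition formalR0 : fps (tensalg Y Y) :=
  \big[@fps_mul _/@fps_one _]_(S in simple_factors g) fps_expt (logR0 S).

End FormalR.

Section Analysis.
Variable R : realType.
Local Notation C := (Cplx R).

Definition real_to_C (x : R) : C := (x%:C)%C.

Definition for_large (P : C -> Prop) : Prop :=
  exists M : R, forall u : C, real_to_C M < `|u| -> P u.

Section Matrix.
Variable k : nat.
Implicit Types F G : C -> 'M[C]_k.

Definition frac_eval (P : 'M[{poly C}]_k) (Q : {poly C}) (u : C) : 'M[C]_k :=
  Q.[u]^-1 *: map_mx (fun p : {poly C} => p.[u]) P.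

(* A rational function is determined by its germ at infinity. *)
Definition represents (P : 'M[{poly C}]_k) (Q : {poly C}) F : Prop :=
  Q != 0 /\ for_large (fun u => F u = frac_eval P Q u).

Definition rational_germ F : Prop := exists P Q, represents P Q F.

Definition is_pole F (a : C) : Prop :=
  ~ exists P Q, represents P Q F /\ Q.[a] != 0.

(* [F] is a germ at infinity of a rational function, [rat_ext F] is that rational
   function, with the value [0] at its poles. *)
Definition rat_ext F (u : C) : 'M[C]_k :=
  xget 0 [set X | exists P Q,
            [/\ represents P Q F, Q.[u] != 0 & X = frac_eval P Q u]].

Definition mexp (X : 'M[C]_k) : 'M[C]_k :=
  limn (fun N => \sum_(0 <= m < N) (m`!%:R)^-1 *: X ^+ m).

(* [t] is the holomorphic logarithm of [F], with [t = 0] at infinity, on the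
   complement of the segments [[0, a]] for [a] in [sigma]. *)
Definition is_holomorphic_log (sigma : set C) F (t : C -> 'M[C]_k) : Prop :=
  let D := ~` \bigcup_(a in sigma)
                [set real_to_C x * a | x in [set x : R | 0 <= x <= 1]] in
  [/\ forall u, D u -> derivable t u 1,
      forall u, D u -> mexp (t u) = F u &
      forall e : R, 0 < e -> for_large (fun u => `|t u| < real_to_C e)].

Definition Cintegral (a b : R) (f : R -> C) : C :=
  ((\int[lebesgue_measure]_(x in `[a, b]) complex.Re (f x)) +i*
   (\int[lebesgue_measure]_(x in `[a, b]) complex.Im (f x)))%C.

(* [(2 pi sqrt(-1))^-1] times the integral over the circle [v = rho * e^(i x)],
   where [dv = sqrt(-1) * v * dx]. *)
Definition circle_integral (rho : R) F : 'M[C]_k :=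
  \matrix_(a, b) (real_to_C (2 * pi)^-1 *
    Cintegral 0 (2 * pi)
      (fun x => let v := (rho * cos x +i* (rho * sin x))%C in F v a b * v)).

Definition halfplane_gt (hbar : C) (m : R) : set C :=
  [set s : C | m < complex.Re (s / hbar : C)].
Definition halfplane_lt (hbar : C) (m : R) : set C :=
  [set s : C | complex.Re (s / hbar : C) < m].

(* [\sum_j a j * s^-j] is the asymptotic expansion of [F s] as [s] tends to
   infinity in [H]. *)
Definition asymptotic_expansion (H : set C) F (a : fps 'M[C]_k) : Prop :=
  forall N : nat, exists K M : R, forall s : C,
    H s -> real_to_C M < `|s| ->
    `|F s - \sum_(j < N) s ^- j *: a j| <= real_to_C K * `|s| ^- N.

End Matrix.
End Analysis.

Section MeromorphicR.
Variables (R : realType) (n : nat) (g : semisimple n) (hbar : Cplx R).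
Local Notation C := (Cplx R).
Local Notation Y := (yangian g hbar).

Section OneRepresentation.
Variables (k : nat) (V : {lrmorphism Y -> 'M[C]_k}).

(* The series converges for [u] large, as its sum is rational. *)
Definition xi_germ (i : 'I_n) (u : C) : 'M[C]_k :=
  1 + hbar *: limn (fun N => \sum_(0 <= r < N) u ^- r.+1 *: V (yxi g hbar i r)).

Definition xi_fun (i : 'I_n) : C -> 'M[C]_k := rat_ext (xi_germ i).

Definition sigma (i : 'I_n) : set C :=
  [set a | is_pole (xi_germ i) a \/ is_pole (fun u => invmx (xi_germ i u)) a].

Definition is_tfun (t : 'I_n -> C -> 'M[C]_k) : Prop :=
  forall i, is_holomorphic_log (sigma i) (xi_fun i) (t i).

End OneRepresentation.

Section TwoRepresentations.
Variables (k1 k2 : nat).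
Variables (V1 : {lrmorphism Y -> 'M[C]_k1}) (V2 : {lrmorphism Y -> 'M[C]_k2}).

(* The right-hand side of the definition of [A_{V1,V2}(s)] for the simple factor
   [S], the contour [C_1] being the circle of radius [rho] centred at [0]. *)
Definition abelian_A_germ (t1 : 'I_n -> C -> 'M[C]_k1)
    (t2 : 'I_n -> C -> 'M[C]_k2) (S : {set 'I_n}) (rho : R) (s : C) :
    'M[C]_(k1 * k2) :=
  mexp (- \sum_(i in S) \sum_(j in S) \sum_(r \in [set: int])
    (qcoef g S i j r)%:R *:
      circle_integral rho (fun v =>
        derive1 (t1 i) v *t t2 j (v + s + (ellC R g S + r%:~R) * hbar / 2))).

(* [A] is the rational function [A_{V1,V2}] of the simple factor [S].  Circles
   centred at [0] which enclose [sigma] also enclose the cuts of [t1]. *)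
Definition is_abelian_A (S : {set 'I_n}) (A : C -> 'M[C]_(k1 * k2)) : Prop :=
  exists t1 t2, [/\ is_tfun V1 t1, is_tfun V2 t2 &
    forall rho : R, 0 < rho ->
      (forall i a, i \in S -> sigma V1 i a -> `|a| < real_to_C rho) ->
      rational_germ (abelian_A_germ t1 t2 S rho) /\
      A = rat_ext (abelian_A_germ t1 t2 S rho)].

Definition R0_up (A : {set 'I_n} -> C -> 'M[C]_(k1 * k2)) (s : C) :
    'M[C]_(k1 * k2) :=
  \prod_(S in simple_factors g)
    limn (fun N => \prod_(0 <= p < N) invmx (A S (s + p%:R * ellC R g S * hbar))).

Definition R0_down (A : {set 'I_n} -> C -> 'M[C]_(k1 * k2)) (s : C) :
    'M[C]_(k1 * k2) :=
  \prod_(S in simple_factors g)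
    limn (fun N => \prod_(1 <= p < N.+1) A S (s - p%:R * ellC R g S * hbar)).

(* [(V1 (x) V2)] applied to the formal series [R^0(s)]. *)
Definition R0_formal : fps 'M[C]_(k1 * k2) :=
  fun p => tens_map V1 V2 (formalR0 g hbar p).

End TwoRepresentations.
End MeromorphicR.

(* Main.v *)
Require Import Defs.
From HB Require Import structures.
From mathcomp Require Import all_boot all_order all_algebra.
From mathcomp Require Import all_classical all_reals all_analysis.
From mathcomp Require Import complex mxtens ring lra zify.

Set Implicit Arguments.
Unset Strict Implicit.
Unset Printing Implicit Defensive.

Import Order.TTheory GRing.Theory Num.Theory.
Import numFieldNormedType.Exports.

Local Open Scope classical_set_scope.
Local Open Scope ring_scope.

(** Write [tau = ell hbar].  For one simple factor, [R^{0,up}] is the exponential of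
[f (s) = - \sum_(p >= 0) L (s + p tau)], where [L = log A] is the sum of contour
integrals in the definition of [A].  Let [phi] be the image of the formal series
[log R^0] under the two representations ([log_formal]).  That [f] has the
asymptotic expansion [phi] follows from two facts.

On the formal side, [phi (s + tau) - phi (s) = L (s)] coefficientwise
([log_formal_difference]).  The scaled series [G (s) = g (s / tau)] satisfies
[G (s + tau) = G (s) - tau^2 s^-2], and the operators which are applied to it are
power series in [d/ds], so that they commute with translations.  It remains to see
that the double sum over the derivatives of [s^-2] has the coefficients of the
residue [\oint t_i'(v) (x) t_j (v + s) dv], a comparison of binomial
coefficients ([contract_delta2]).

On the analytic side, a formal solution of this difference equation without
constant term is the asymptotic expansion of [f] in the half planes
[Re (s / tau) > m] ([shifted_sum_asymp]).  A truncation of [phi] solves the equation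
up to an error [O (s ^- (N + 2))], and [|s + p tau| >= (|s| + p |tau|) / 2] far out
in the half plane, so that these errors sum to [O (s ^- (N + 1))] along the
sequence [s + p tau].  The product [R^{0,down}] leads to the equation with
[- tau] and [- L (s - tau)], of which [phi] is a formal solution as well.

Both facts use that [L] has a convergent expansion at infinity whose coefficients
come from those of the [t_i] by the formal rules.  The predicate [geom] describes
such expansions by explicit geometric bounds, which makes it stable under
translation, differentiation and contour integration.  For [xi_i (u)] these bounds
come from the Yangian: the commutator with [xi_(i,1) - (hbar / 2) xi_(i,0)^2]
raises the index of [x^+_(i,r)], so that on a finite-dimensional space the
[xi_(i,r)] grow geometrically and satisfy a linear recurrence, and [xi_i (u)] is
rational.  The holomorphic logarithm [t_i (u)] is small at infinity, where the
exponential is injective; therefore it has the expansion given by the formal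
logarithm ([geom_log], [tfun_geom]).

Finally, the values of [L] commute, the exponential turns sums into products, and
asymptotic expansions are compatible with products and exponentials ([asympM],
[asymp_mexp]), which gives the statement for each simple factor and for their
product.  The integer [ell] is nonnegative ([ell_ge0]).  If it is positive, the half
planes of [s / hbar] are those of [s / tau]; if it vanishes, so do all the
[c_ij^(r)], and both sides are [1]. *)

(** * Real-valued norms on complex matrices *)

Section Modulus.
Variable R : realType.
Local Notation C := (Cplx R).
Implicit Types z w : C.

Definition cmod (z : C) : R := complex.Re (`|z| : C).

Lemma cmodE z : `|z| = real_to_C (cmod z).
Proof.
rewrite /cmod /real_to_C; have : (0 : C) <= `|z| by [].
case: (`|z|) => a b /=; rewrite lecE /= => /andP[/eqP h _].
by apply/eqP; rewrite eq_complex /= eqxx -h /=.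
Qed.

Lemma lecR_real (a b : R) : (real_to_C a <= real_to_C b) = (a <= b).
Proof. by rewrite /real_to_C lecR. Qed.

Lemma ltcR_real (a b : R) : (real_to_C a < real_to_C b) = (a < b).
Proof. by rewrite /real_to_C ltcR. Qed.

Lemma real_to_CD (a b : R) : real_to_C (a + b) = real_to_C a + real_to_C b.
Proof. exact: (rmorphD (real_complex R)). Qed.

Lemma real_to_CM (a b : R) : real_to_C (a * b) = real_to_C a * real_to_C b.
Proof. exact: (rmorphM (real_complex R)). Qed.

Lemma real_to_CX (a : R) n : real_to_C (a ^+ n) = real_to_C a ^+ n.
Proof. exact: (rmorphXn (real_complex R)). Qed.

Lemma real_to_CV (a : R) : real_to_C a^-1 = (real_to_C a)^-1.
Proof. exact: (fmorphV (real_complex R)). Qed.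

Lemma real_to_C0 : real_to_C (0 : R) = 0. Proof. by []. Qed.
Lemma real_to_CMn (a : R) n : real_to_C (a *+ n) = real_to_C a *+ n.
Proof. exact: (rmorphMn (real_complex R)). Qed.

Lemma real_to_C_inj : injective (@real_to_C R).
Proof. exact: complexI. Qed.

Lemma cmod_ge0 z : 0 <= cmod z.
Proof. by rewrite -lecR_real -cmodE real_to_C0. Qed.

Lemma cmod0 : cmod 0 = 0.
Proof. by apply: real_to_C_inj; rewrite -cmodE normr0. Qed.

Lemma cmod1 : cmod 1 = 1.
Proof. by apply: real_to_C_inj; rewrite -cmodE normr1. Qed.

Lemma cmodN z : cmod (- z) = cmod z.
Proof. by apply: real_to_C_inj; rewrite -!cmodE normrN. Qed.

Lemma cmodM z w : cmod (z * w) = cmod z * cmod w.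
Proof. by apply: real_to_C_inj; rewrite real_to_CM -!cmodE normrM. Qed.

Lemma cmodV z : cmod z^-1 = (cmod z)^-1.
Proof. by apply: real_to_C_inj; rewrite real_to_CV -!cmodE normfV. Qed.

Lemma cmodX z n : cmod (z ^+ n) = cmod z ^+ n.
Proof. by apply: real_to_C_inj; rewrite real_to_CX -!cmodE normrX. Qed.

Lemma cmodXV z n : cmod (z ^- n) = (cmod z ^+ n)^-1.
Proof. by rewrite cmodV cmodX. Qed.

Lemma cmodD z w : cmod (z + w) <= cmod z + cmod w.
Proof. by rewrite -lecR_real real_to_CD -!cmodE ler_normD. Qed.

Lemma cmodB z w : cmod (z - w) <= cmod z + cmod w.
Proof. by rewrite (le_trans (cmodD _ _))// cmodN. Qed.

Lemma cmod_subl z w : cmod z - cmod w <= cmod (z + w).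
Proof. by rewrite lerBlDr -{1}(addrK w z) cmodB. Qed.

Lemma cmod_eq0 z : (cmod z == 0) = (z == 0).
Proof.
by rewrite -[RHS]normr_eq0 cmodE -real_to_C0 (inj_eq real_to_C_inj).
Qed.

Lemma cmod_gt0 z : (0 < cmod z) = (z != 0).
Proof. by rewrite lt_def cmod_ge0 andbT cmod_eq0. Qed.

Lemma cmod_nat n : cmod n%:R = n%:R.
Proof. by apply: real_to_C_inj; rewrite -cmodE normr_nat real_to_CMn. Qed.

Lemma cmod_real (x : R) : cmod (real_to_C x) = `|x|.
Proof.
apply: real_to_C_inj; rewrite -cmodE /real_to_C normc_def /=.
by rewrite expr0n /= addr0 sqrtr_sqr.
Qed.

Lemma cmod_sum I (r : seq I) (P : pred I) (F : I -> C) :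
  cmod (\sum_(i <- r | P i) F i) <= \sum_(i <- r | P i) cmod (F i).
Proof.
elim/big_ind2: _ => //; first by rewrite cmod0.
by move=> x1 x2 y1 y2 h1 h2; rewrite (le_trans (cmodD _ _))// lerD.
Qed.

Lemma cmod_sqr z : cmod z ^+ 2 = complex.Re z ^+ 2 + complex.Im z ^+ 2.
Proof.
apply: real_to_C_inj; rewrite real_to_CX -cmodE.
rewrite sqr_normc; case: z => a b; apply/eqP; rewrite eq_complex /=.
by apply/andP; split; apply/eqP; ring.
Qed.

Lemma Re_le_cmod z : `|complex.Re z| <= cmod z.
Proof.
rewrite -(@ler_pXn2r _ 2) ?nnegrE ?cmod_ge0// cmod_sqr -normrX ger0_norm ?sqr_ge0//.
by rewrite lerDl sqr_ge0.
Qed.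

Lemma Im_le_cmod z : `|complex.Im z| <= cmod z.
Proof.
rewrite -(@ler_pXn2r _ 2) ?nnegrE ?cmod_ge0// cmod_sqr -normrX ger0_norm ?sqr_ge0//.
by rewrite lerDr sqr_ge0.
Qed.

Lemma cmod_le_ReIm z : cmod z <= `|complex.Re z| + `|complex.Im z|.
Proof.
rewrite -(@ler_pXn2r _ 2) ?nnegrE ?cmod_ge0 ?addr_ge0// cmod_sqr.
rewrite -(real_normK (num_real (complex.Re z))).
rewrite -(real_normK (num_real (complex.Im z))) sqrrD addrAC lerDl.
by rewrite mulrn_wge0// mulr_ge0.
Qed.

End Modulus.

Section MatrixNorm.
Variable R : realType.
Local Notation C := (Cplx R).

(** The sum of the moduli of the entries is submultiplicative, unlike the
largest one, and takes values in the ordered field [R] rather than in [C]. *)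
Definition nm m n (X : 'M[C]_(m, n)) : R := \sum_i \sum_j cmod (X i j).

Section Basic.
Variables (m n : nat).
Implicit Types X Y : 'M[C]_(m, n).

Lemma nm_ge0 X : 0 <= nm X.
Proof. by apply: sumr_ge0 => i _; apply: sumr_ge0 => j _; exact: cmod_ge0. Qed.

Lemma nm0 : nm (0 : 'M[C]_(m, n)) = 0.
Proof. by rewrite /nm big1// => i _; rewrite big1// => j _; rewrite mxE cmod0. Qed.

Lemma nmN X : nm (- X) = nm X.
Proof.
by apply: eq_bigr => i _; apply: eq_bigr => j _; rewrite mxE cmodN.
Qed.

Lemma nmD X Y : nm (X + Y) <= nm X + nm Y.
Proof.
rewrite /nm -big_split /=; apply: ler_sum => i _.
rewrite -big_split /=; apply: ler_sum => j _.
by rewrite mxE cmodD.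
Qed.

Lemma nmB X Y : nm (X - Y) <= nm X + nm Y.
Proof. by rewrite (le_trans (nmD _ _))// nmN. Qed.

Lemma nm_distC X Y : nm (X - Y) = nm (Y - X).
Proof. by rewrite -nmN opprB. Qed.

Lemma nm_dist_trans Y X Z : nm (X - Z) <= nm (X - Y) + nm (Y - Z).
Proof. by rewrite -[X - Z](subrKA Y) nmD. Qed.

Lemma nm_le_sub X Y : nm X <= nm Y + nm (X - Y).
Proof. by rewrite -{1}[X](subrK Y) addrC nmD. Qed.

Lemma nmZ (c : C) X : nm (c *: X) = cmod c * nm X.
Proof.
rewrite /nm mulr_sumr; apply: eq_bigr => i _.
by rewrite mulr_sumr; apply: eq_bigr => j _; rewrite mxE cmodM.
Qed.

Lemma nm_sum I (r : seq I) (P : pred I) (F : I -> 'M[C]_(m, n)) :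
  nm (\sum_(i <- r | P i) F i) <= \sum_(i <- r | P i) nm (F i).
Proof.
elim/big_ind2: _ => //; first by rewrite nm0.
by move=> x1 x2 y1 y2 h1 h2; rewrite (le_trans (nmD _ _))// lerD.
Qed.

Lemma cmod_le_nm X i j : cmod (X i j) <= nm X.
Proof.
rewrite /nm (bigD1 i)//= (bigD1 j)//= -addrA lerDl addr_ge0//.
  by apply: sumr_ge0 => ? _; exact: cmod_ge0.
by apply: sumr_ge0 => ? _; apply: sumr_ge0 => ? _; exact: cmod_ge0.
Qed.

Lemma nm_eq0 X : (nm X == 0) = (X == 0).
Proof.
apply/eqP/eqP => [h|->]; last exact: nm0.
apply/matrixP => i j; rewrite mxE; apply/eqP.
by rewrite -cmod_eq0 eq_le cmod_ge0 andbT -h cmod_le_nm.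
Qed.

Lemma nm_entrywise X (e : R) : (forall i j, cmod (X i j) <= e) ->
  nm X <= (m * n)%:R * e.
Proof.
move=> Xe; rewrite /nm.
apply: (@le_trans _ _ (\sum_(i < m) \sum_(j < n) e)).
  by apply: ler_sum => i _; apply: ler_sum => j _.
by rewrite !sumr_const !card_ord -mulrnA mulr_natl mulnC.
Qed.

Lemma normr_le_nm X : `|X| <= real_to_C (nm X).
Proof.
change (mx_norm X <= real_to_C (nm X)).
have [->|] := eqVneq (mx_norm X) 0.
  by rewrite -real_to_C0 lecR_real nm_ge0.
by move=> /mx_norm_neq0[[i j] /= ->]; rewrite cmodE lecR_real cmod_le_nm.
Qed.

Lemma cmod_le_normr X i j : real_to_C (cmod (X i j)) <= `|X|.
Proof.
rewrite -cmodE; change (`|X i j| <= mx_norm X); rewrite /mx_norm.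
rewrite -[leLHS]nngE num_le.
exact: (le_bigmax _ (fun ij : 'I_m * 'I_n => `|X ij.1 ij.2|%:nng) (i, j)).
Qed.

Lemma nm_le_normr X (e : R) : `|X| <= real_to_C e -> nm X <= (m * n)%:R * e.
Proof.
move=> Xe; apply: nm_entrywise => i j.
by rewrite -lecR_real (le_trans (cmod_le_normr X i j)).
Qed.

End Basic.

Lemma nmM m n p (X : 'M[C]_(m, n)) (Y : 'M[C]_(n, p)) :
  nm (X *m Y) <= nm X * nm Y.
Proof.
apply: (@le_trans _ _ (\sum_i \sum_j \sum_k cmod (X i k) * cmod (Y k j))).
  apply: ler_sum => i _; apply: ler_sum => j _.
  rewrite mxE (le_trans (cmod_sum _ _ _))// ler_sum// => k _.
  by rewrite cmodM.
rewrite /nm mulr_suml; apply: ler_sum => i _.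
rewrite exchange_big mulr_suml; apply: ler_sum => k _ /=.
rewrite -mulr_sumr; apply: ler_wpM2l; first exact: cmod_ge0.
rewrite (bigD1 k)//= lerDl.
by apply: sumr_ge0 => ? _; apply: sumr_ge0 => ? _; exact: cmod_ge0.
Qed.

Lemma nm_tens m n p q (X : 'M[C]_(m, n)) (Y : 'M[C]_(p, q)) :
  nm (X *t Y) = nm X * nm Y.
Proof.
rewrite /nm.
rewrite (reindex (fun x : 'I_m * 'I_p => mxtens_index x)) /=; last first.
  by exists (@mxtens_unindex m p) => x _; rewrite ?mxtens_indexK ?mxtens_unindexK.
transitivity (\sum_(x : 'I_m * 'I_p) \sum_(y : 'I_n * 'I_q)
    cmod (X x.1 y.1) * cmod (Y x.2 y.2)).
  apply: eq_bigr => -[i j] _.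
  rewrite (reindex (fun x : 'I_n * 'I_q => mxtens_index x)) /=; last first.
    by exists (@mxtens_unindex n q) => x _; rewrite ?mxtens_indexK ?mxtens_unindexK.
  by apply: eq_bigr => -[k l] _; rewrite tensmxE cmodM.
rewrite -(pair_bigA _ (fun i j => \sum_(y : 'I_n * 'I_q)
    cmod (X i y.1) * cmod (Y j y.2))) /=.
rewrite mulr_suml; apply: eq_bigr => i _; rewrite mulr_sumr.
apply: eq_bigr => j _.
rewrite -(pair_bigA _ (fun k l => cmod (X i k) * cmod (Y j l))) /=.
by rewrite mulr_suml; apply: eq_bigr => k _; rewrite mulr_sumr.
Qed.

Lemma nm1 k : nm (1 : 'M[C]_k) = k%:R.
Proof.
rewrite /nm -[in RHS](card_ord k) -sum1_card natr_sum; apply: eq_bigr => i _.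
rewrite (bigD1 i)//= mxE eqxx cmod1 big1 ?addr0// => j ji.
by rewrite mxE eq_sym (negbTE ji) cmod0.
Qed.

Lemma nmXn k (X : 'M[C]_k) m : nm (X ^+ m.+1) <= nm X ^+ m.+1.
Proof.
elim: m => [|m IH]; first by rewrite !expr1.
rewrite exprS [leRHS]exprS (le_trans (nmM _ _))// ler_wpM2l// nm_ge0//.
Qed.

(** The constant only serves for [m = 0], as the norm of [1] is the dimension. *)
Lemma nmX k (X : 'M[C]_k) m : nm (X ^+ m) <= k.+1%:R * nm X ^+ m.
Proof.
case: m => [|m]; first by rewrite !expr0 nm1 mulr1 ler_nat.
rewrite (le_trans (nmXn _ _))// ler_peMl ?exprn_ge0 ?nm_ge0//.
by rewrite ler1n.
Qed.

Lemma nmMXn k (X Y : 'M[C]_k) m : nm (X ^+ m * Y) <= nm X ^+ m * nm Y.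
Proof.
elim: m => [|m IH]; first by rewrite !expr0 !mul1r.
by rewrite !exprS -!mulrA (le_trans (nmM _ _))// ler_wpM2l ?nm_ge0.
Qed.

End MatrixNorm.

(** * Limits of sequences of matrices *)

Section MatrixLimits.
Variable R : realType.
Local Notation C := (Cplx R).

(** Convergence with errors measured in [R]; by [mcvgP] it implies convergence in
the topology of matrices, hence determines the values of [limn]. *)
Definition mcvg m n (u : nat -> 'M[C]_(m, n)) (l : 'M[C]_(m, n)) : Prop :=
  forall e : R, 0 < e -> exists N, forall p, (N <= p)%N -> nm (u p - l) <= e.

Lemma pos_complex (e : C) : 0 < e -> exists2 r : R, 0 < r & e = real_to_C r.
Proof.
move=> e0; exists (cmod e); last by rewrite -cmodE gtr0_norm.
by rewrite cmod_gt0 gt_eqF.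
Qed.

Section Rectangular.
Variables (m n : nat).
Implicit Types (u v : nat -> 'M[C]_(m, n)) (l : 'M[C]_(m, n)).

Lemma mcvgP u l : mcvg u l -> u @ \oo --> l.
Proof.
move=> ul; apply/cvgrPdist_le => e /pos_complex[r r0 ->].
have [N hN] := ul _ r0; exists N => // p /= Np.
rewrite distrC (le_trans (normr_le_nm _))// lecR_real; exact: hN.
Qed.

Lemma mcvg_limn u l : mcvg u l -> limn u = l.
Proof. by move=> /mcvgP /cvg_lim; apply; exact: norm_hausdorff. Qed.

Lemma mcvg_le u l l' (e : R) : mcvg u l ->
  (exists N, forall p, (N <= p)%N -> nm (u p - l') <= e) -> nm (l - l') <= e.
Proof.
move=> ul [N hN]; apply/ler_addgt0Pr => d d0.
have [N' hN'] := ul _ d0.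
rewrite (le_trans (nm_dist_trans (u (maxn N N')) _ _))// addrC lerD//.
  by rewrite hN// leq_maxl.
by rewrite nm_distC hN'// leq_maxr.
Qed.

Lemma mcvg_unique u l l' : mcvg u l -> mcvg u l' -> l = l'.
Proof. by move=> /mcvg_limn <- /mcvg_limn. Qed.

Lemma mcvg_ext u v l : (forall p, u p = v p) -> mcvg u l -> mcvg v l.
Proof. by move=> uv ul e /ul[N hN]; exists N => p /hN; rewrite uv. Qed.

Lemma mcvg_eventually u v l N0 : (forall p, (N0 <= p)%N -> u p = v p) ->
  mcvg u l -> mcvg v l.
Proof.
move=> uv ul e /ul[N hN]; exists (maxn N N0) => p; rewrite geq_max => /andP[Np N0p].
by rewrite -uv// hN.
Qed.

Lemma mcvg_cst l : mcvg (fun=> l) l.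
Proof. by move=> e e0; exists 0%N => p _; rewrite subrr nm0 ltW. Qed.

Lemma mcvgD u v l l' : mcvg u l -> mcvg v l' ->
  mcvg (fun p => u p + v p) (l + l').
Proof.
move=> ul vl e e0; have e20 : 0 < e / 2 by rewrite divr_gt0.
have [N hN] := ul _ e20; have [N' hN'] := vl _ e20.
exists (maxn N N') => p; rewrite geq_max => /andP[Np N'p].
by rewrite opprD addrACA (le_trans (nmD _ _))// (splitr e) lerD ?hN ?hN'.
Qed.

Lemma mcvgN u l : mcvg u l -> mcvg (fun p => - u p) (- l).
Proof.
by move=> ul e /ul[N hN]; exists N => p /hN; rewrite -opprD nmN.
Qed.

Lemma mcvgB u v l l' : mcvg u l -> mcvg v l' ->
  mcvg (fun p => u p - v p) (l - l').
Proof. by move=> ul /mcvgN; exact: mcvgD. Qed.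

Lemma mcvgZ (c : C) u l : mcvg u l -> mcvg (fun p => c *: u p) (c *: l).
Proof.
move=> ul e e0; have K1 : 0 < cmod c + 1 by rewrite ltr_wpDl ?cmod_ge0.
have [|N hN] := ul (e / (cmod c + 1)); first by rewrite divr_gt0.
exists N => p /hN h; rewrite -scalerBr nmZ.
rewrite -[leRHS](divfK (lt0r_neq0 K1)) mulrC ler_pM ?nm_ge0 ?cmod_ge0//.
by rewrite lerDl.
Qed.

Lemma mcvg_sum I (r : seq I) (P : pred I) (F : I -> nat -> 'M[C]_(m, n)) L :
  (forall i, P i -> mcvg (F i) (L i)) ->
  mcvg (fun p => \sum_(i <- r | P i) F i p) (\sum_(i <- r | P i) L i).
Proof.
move=> h; elim: r => [|i r IH].
  by rewrite big_nil; apply: (mcvg_ext _ (mcvg_cst 0)) => p; rewrite big_nil.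
rewrite big_cons; case: ifPn => Pi.
  by apply: (mcvg_ext _ (mcvgD (h _ Pi) IH)) => p; rewrite big_cons Pi.
by apply: (mcvg_ext _ IH) => p; rewrite big_cons (negbTE Pi).
Qed.

Lemma mcvg_shift u l k : mcvg u l -> mcvg (fun p => u (p + k)%N) l.
Proof.
by move=> ul e /ul[N hN]; exists N => p Np; apply: hN; rewrite (leq_trans Np)// leq_addr.
Qed.

(** [C] inherits its completeness from [R], entry by entry and separately for
real and imaginary parts. *)
Lemma mcvg_cauchy u :
  (forall e : R, 0 < e -> exists N, forall p q, (N <= p)%N -> (p <= q)%N ->
     nm (u q - u p) <= e) ->
  exists l, mcvg u l.
Proof.
move=> uc.
have cauR (x : nat -> R) : (forall p q, `|x q - x p| <= nm (u q - u p)) ->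
    exists y : R, x @ \oo --> y.
  move=> xu; have : cvg (x @ \oo); last by move=> h; exists (lim (x @ \oo)).
  apply/cauchy_cvgP/cauchy_exP => e e0; have e20 : 0 < e / 2 by rewrite divr_gt0.
  have [N hN] := uc _ e20; exists (x N); exists N => // q /= Nq.
  rewrite /ball /= distrC (le_lt_trans (xu _ _))// (le_lt_trans (hN _ _ _ Nq))//.
  by rewrite ltr_pdivrMr// ltr_pMr// ltr1n.
have hRe i j : exists y : R, (fun p => complex.Re (u p i j)) @ \oo --> y.
  apply: cauR => p q; rewrite (le_trans _ (cmod_le_nm (u q - u p) i j))//.
  by rewrite (le_trans _ (Re_le_cmod _))// !mxE; case: (u q i j) (u p i j) => ? ? [? ?].
have hIm i j : exists y : R, (fun p => complex.Im (u p i j)) @ \oo --> y.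
  apply: cauR => p q; rewrite (le_trans _ (cmod_le_nm (u q - u p) i j))//.
  by rewrite (le_trans _ (Im_le_cmod _))// !mxE; case: (u q i j) (u p i j) => ? ? [? ?].
pose a i j := proj1_sig (cid (hRe i j)); pose b i j := proj1_sig (cid (hIm i j)).
have ha i j : (fun p => complex.Re (u p i j)) @ \oo --> a i j by rewrite /a; case: cid.
have hb i j : (fun p => complex.Im (u p i j)) @ \oo --> b i j by rewrite /b; case: cid.
exists (\matrix_(i, j) (a i j +i* b i j)%C) => e e0.
pose d := e / 2 / (m * n).+1%:R.
have d0 : 0 < d by rewrite !divr_gt0// ltr0n.
have [N hN] : exists N, forall p, (N <= p)%N -> forall ij : 'I_m * 'I_n,
    `|complex.Re (u p ij.1 ij.2) - a ij.1 ij.2| <= d /\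
    `|complex.Im (u p ij.1 ij.2) - b ij.1 ij.2| <= d.
  have [N _ hN] : \forall p \near \oo, forall ij : 'I_m * 'I_n,
    `|complex.Re (u p ij.1 ij.2) - a ij.1 ij.2| <= d /\
    `|complex.Im (u p ij.1 ij.2) - b ij.1 ij.2| <= d.
    apply: filter_forall => -[i j] /=.
    have /cvgrPdist_le/(_ d d0) h1 := ha i j.
    have /cvgrPdist_le/(_ d d0) h2 := hb i j.
    by apply: filterS2 h1 h2 => p h1 h2; split; rewrite distrC.
  by exists N => p Np; exact: hN.
exists N => p /hN hp.
rewrite (le_trans (nm_entrywise (e := d + d) _))//.
  move=> i j; rewrite (le_trans (cmod_le_ReIm _))// !mxE.
  have [/= h1 h2] := hp (i, j).
  by move: h1 h2; case: (u p i j) => x y /= h1 h2; rewrite lerD.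
rewrite /d -mulrDl -splitr mulrCA ger_pMr// ler_pdivrMr ?ltr0n// mul1r ler_nat.
by rewrite leqnSn.
Qed.

End Rectangular.

Lemma mcvgM m n p (u : nat -> 'M[C]_(m, n)) (v : nat -> 'M[C]_(n, p)) l l' :
  mcvg u l -> mcvg v l' -> mcvg (fun q => u q *m v q) (l *m l').
Proof.
move=> ul vl e e0.
pose K := nm l + nm l' + 1.
have K0 : 0 < K by rewrite ltr_wpDl// addr_ge0 ?nm_ge0.
pose d := Num.min 1 (e / 2 / K).
have d0 : 0 < d by rewrite lt_min ltr01 !divr_gt0.
have [N hN] := ul _ d0; have [N' hN'] := vl _ d0.
exists (maxn N N') => q; rewrite geq_max => /andP[/hN h1 /hN' h2].
have -> : u q *m v q - l *m l' = (u q - l) *m v q + l *m (v q - l').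
  by rewrite mulmxBl mulmxBr subrKA.
have h3 : nm (v q) <= K.
  rewrite (le_trans (nm_le_sub _ l'))// /K lerD//.
    by rewrite lerDr nm_ge0.
  by rewrite (le_trans h2)// ge_min lexx.
have h4 : nm l <= K by rewrite /K -addrA lerDl addr_ge0 ?nm_ge0.
have dK : d * K <= e / 2 by rewrite -ler_pdivlMr// ge_min lexx orbT.
rewrite (le_trans (nmD _ _))// (splitr e) lerD//.
  by rewrite (le_trans (nmM _ _))// (le_trans _ dK)// ler_pM ?nm_ge0.
by rewrite (le_trans (nmM _ _))// (le_trans _ dK)// mulrC ler_pM ?nm_ge0.
Qed.

End MatrixLimits.

(** * The exponential of matrices *)

Section RealSums.
Variable R : realType.

Lemma geom_sum_le (x : R) p q : 0 <= x -> x <= 1 / 2 ->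
  \sum_(p <= m < q) x ^+ m <= 2 * x ^+ p.
Proof.
move=> x0 x2; have [qp|pq] := leqP q p.
  by rewrite big_geq// mulr_ge0 ?exprn_ge0.
suff : \sum_(p <= m < q) x ^+ m <= 2 * x ^+ p - 2 * x ^+ q.
  by move=> /le_trans; apply; rewrite gerBl mulr_ge0// exprn_ge0.
rewrite -(subnKC (ltnW pq)); elim: (q - p)%N => [|k IH].
  by rewrite addn0 big_geq// subrr.
rewrite addnS big_nat_recr ?leq_addr//= (le_trans (lerD IH (lexx _)))//.
by have := exprn_ge0 (p + k) x0; rewrite exprSr; nra.
Qed.

Definition expsum (x : R) N : R := \sum_(0 <= m < N) (m`!%:R)^-1 * x ^+ m.

Lemma expsum_bounded (x : R) : exists K, forall N, expsum x N <= K.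
Proof.
have [_ [/= K [Kr hK]]] : bounded_fun (expsum x) /\ bounded_fun (expsum x).
  suff h : bounded_fun (expsum x) by split.
  apply: cvg_seq_bounded.
  have -> : expsum x = series (exp_coeff x).
    by apply/funext => N; apply: eq_bigr => i _; rewrite /exp_coeff /= mulrC.
  exact: is_cvg_series_exp_coeff.
exists (K + 1) => N; rewrite (le_trans (ler_norm _))//.
by apply: (hK (K + 1)) => //; rewrite ltrDl.
Qed.

Lemma expsum_tail (x : R) (e : R) : 0 < e -> exists N, forall p q,
  (N <= p)%N -> (p <= q)%N -> \sum_(p <= m < q) (m`!%:R)^-1 * x ^+ m <= e.
Proof.
move=> e0; have : cvgn (series (exp_coeff x)) by exact: is_cvg_series_exp_coeff.
move=> /cauchy_cvgP/cauchy_seriesP/(_ e e0)[[A B] /= [[N1 _ h1] [N2 _ h2]] h].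
exists (maxn N1 N2) => p q; rewrite geq_max => /andP[Np1 Np2] pq.
have := h (p, q); rewrite /= => /(_ _)/ltW.
rewrite (eq_bigr (fun m => (m`!%:R)^-1 * x ^+ m)); last first.
  by move=> i _; rewrite /exp_coeff /= mulrC.
move=> h3; rewrite (le_trans (ler_norm _))// h3//; split; first exact: h1.
by apply: h2; rewrite /= (leq_trans Np2).
Qed.

Lemma invfact_ge0 m : 0 <= (m`!%:R)^-1 :> R.
Proof. by rewrite invr_ge0 ler0n. Qed.

Lemma invfact_le1 m : (m`!%:R)^-1 <= 1 :> R.
Proof. by rewrite invf_le1 ?ltr0n ?fact_gt0// ler1n fact_gt0. Qed.

End RealSums.

Lemma exprSB (A : pzRingType) (x y : A) m :
  x ^+ m.+2 - y ^+ m.+2 = x ^+ m.+1 * (x - y) + (x ^+ m.+1 - y ^+ m.+1) * y.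
Proof. by rewrite mulrBr mulrBl -!exprSr addrA subrK. Qed.

Section MatrixExponential.
Variables (R : realType) (k : nat).
Local Notation C := (Cplx R).
Implicit Types X Y : 'M[C]_k.

Definition expp X N : 'M[C]_k := \sum_(0 <= m < N) (m`!%:R)^-1 *: X ^+ m.

Lemma cmod_invfact m : cmod ((m`!%:R)^-1 : C) = (m`!%:R)^-1.
Proof. by rewrite cmodV cmod_nat. Qed.

Lemma nm_exp_term X m :
  nm ((m`!%:R : C)^-1 *: X ^+ m) <= k.+1%:R * ((m`!%:R)^-1 * nm X ^+ m).
Proof.
by rewrite nmZ cmod_invfact mulrCA ler_wpM2l ?invfact_ge0// nmX.
Qed.

Lemma expp_sub X p q : (p <= q)%N ->
  expp X q - expp X p = \sum_(p <= m < q) (m`!%:R)^-1 *: X ^+ m.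
Proof.
by move=> pq; rewrite /expp (@big_cat_nat _ _ _ p)//= addrAC subrr add0r.
Qed.

Lemma nm_expp_sub X p q : (p <= q)%N ->
  nm (expp X q - expp X p) <=
  k.+1%:R * \sum_(p <= m < q) (m`!%:R)^-1 * nm X ^+ m.
Proof.
move=> pq; rewrite expp_sub// (le_trans (nm_sum _ _ _))// mulr_sumr.
by apply: ler_sum => m _; exact: nm_exp_term.
Qed.

Lemma mexp_cvg X : mcvg (expp X) (mexp X).
Proof.
have [l hl] : exists l, mcvg (expp X) l.
  apply: mcvg_cauchy => e e0.
  have [|N hN] := expsum_tail (nm X) (e := e / k.+1%:R).
    by rewrite divr_gt0// ltr0n.
  exists N => p q Np pq; rewrite (le_trans (nm_expp_sub _ pq))//.
  by rewrite mulrC -ler_pdivlMr ?ltr0n// hN.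
by rewrite /mexp (mcvg_limn hl).
Qed.

Lemma mexp_tail X N : nm X <= 1 / 2 ->
  nm (mexp X - expp X N) <= 2 * k.+1%:R * nm X ^+ N.
Proof.
move=> X2; apply: (mcvg_le (mexp_cvg X)); exists N => p Np.
rewrite (le_trans (nm_expp_sub _ Np))// -mulrA mulrCA ler_wpM2l//.
rewrite (le_trans _ (geom_sum_le N p (nm_ge0 X) X2))//.
by apply: ler_sum => m _; rewrite ler_piMl ?exprn_ge0 ?nm_ge0// invfact_le1.
Qed.

Lemma expp0 N : expp 0 N.+1 = 1.
Proof.
rewrite /expp big_nat_recl//= big1 ?addr0 ?expr0 ?invr1 ?scale1r//.
by move=> i _; rewrite expr0n /= scaler0.
Qed.

Lemma mexp0 : mexp (0 : 'M[C]_k) = 1.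
Proof.
apply: (mcvg_unique (mexp_cvg 0)).
apply: (@mcvg_eventually _ _ _ (fun=> 1) _ _ 1); last exact: mcvg_cst.
by move=> [|p]// _; rewrite expp0.
Qed.

Lemma mexp_small X : nm X <= 1 / 2 -> nm (mexp X - 1) <= 2 * k.+1%:R * nm X.
Proof.
move=> X2; have := mexp_tail 1 X2.
by rewrite /expp big_nat1 invr1 scale1r expr0 expr1.
Qed.

Lemma expp_add X Y N : X * Y = Y * X ->
  expp (X + Y) N = \sum_(0 <= i < N) \sum_(0 <= j < N - i)
    ((i`!%:R)^-1 * (j`!%:R)^-1) *: (X ^+ i * Y ^+ j).
Proof.
move=> XY; elim: N => [|N IH]; first by rewrite /expp !big_geq.
rewrite /expp big_nat_recr//= -/(expp _ _) {}IH.
rewrite [RHS](eq_big_nat _ _ (F2 := fun i => \sum_(0 <= j < N - i)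
    ((i`!%:R)^-1 * (j`!%:R)^-1) *: (X ^+ i * Y ^+ j) +
    ((i`!%:R)^-1 * ((N - i)`!%:R)^-1) *: (X ^+ i * Y ^+ (N - i)))); last first.
  by move=> i /andP[_ iN]; rewrite subSn// big_nat_recr.
rewrite big_split /= [in RHS]big_nat_recr//= subnn [X in _ + X + _]big_geq// addr0.
congr (_ + _); rewrite [X + Y]addrC exprDn_comm; last by rewrite /GRing.comm XY.
rewrite scaler_sumr big_mkord; apply: eq_bigr => -[i /= iN] _.
rewrite ltnS in iN.
have -> : Y ^+ (N - i) * X ^+ i = X ^+ i * Y ^+ (N - i).
  by apply: commrX; apply: commr_sym; apply: commrX.
rewrite -[X in _ *: X]scaler_nat scalerA; congr (_ *: _).
rewrite -(bin_fact iN) natrM natrM.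
have h1 : (i`!%:R : C) != 0 by rewrite pnatr_eq0 -lt0n fact_gt0.
have h2 : ((N - i)`!%:R : C) != 0 by rewrite pnatr_eq0 -lt0n fact_gt0.
have h3 : ('C(N, i)%:R : C) != 0 by rewrite pnatr_eq0 -lt0n bin_gt0.
by field; rewrite h1 h2 h3.
Qed.

Lemma expp_mul X Y N : expp X N * expp Y N =
  \sum_(0 <= i < N) \sum_(0 <= j < N)
    ((i`!%:R)^-1 * (j`!%:R)^-1) *: (X ^+ i * Y ^+ j).
Proof.
rewrite /expp mulr_suml; apply: eq_bigr => i _.
rewrite mulr_sumr; apply: eq_bigr => j _.
by rewrite -[LHS]scalemxAl -[X in _ *: X]scalemxAr scalerA.
Qed.

(** The products [X ^+ i * Y ^+ j / (i! j!)] with [N <= i + j] are outweighed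
by [2 ^ (i + j - N)], so that they sum to [O(2 ^ -N)]. *)
Lemma expp_mul_sub X Y N : X * Y = Y * X ->
  nm (expp X N * expp Y N - expp (X + Y) N) <=
  k.+1%:R ^+ 2 * (expsum (2 * nm X) N * expsum (2 * nm Y) N) / 2 ^+ N.
Proof.
move=> XY; rewrite expp_mul expp_add// -sumrB /expsum mulr_suml mulr_sumr mulr_suml.
rewrite (le_trans (nm_sum _ _ _))// ler_sum_nat// => i /andP[_ iN].
rewrite mulr_sumr mulr_sumr mulr_suml (@big_cat_nat _ _ _ (N - i))//= ?leq_subr//.
rewrite addrAC subrr add0r (le_trans (nm_sum _ _ _))//.
rewrite [leRHS](@big_cat_nat _ _ _ (N - i))//= ?leq_subr//.
have ge0 j : 0 <= k.+1%:R ^+ 2 * ((i`!%:R)^-1 * (2 * nm X) ^+ i *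
      ((j`!%:R)^-1 * (2 * nm Y) ^+ j)) / 2 ^+ N.
  rewrite divr_ge0 ?exprn_ge0// mulr_ge0 ?exprn_ge0// !mulr_ge0 ?invfact_ge0//;
    by rewrite exprn_ge0// mulr_ge0// nm_ge0.
rewrite ler_wpDl ?sumr_ge0// ler_sum_nat// => j /andP[ij _].
rewrite nmZ cmodM !cmod_invfact.
have h : nm (X ^+ i * Y ^+ j) <= k.+1%:R ^+ 2 * (nm X ^+ i * nm Y ^+ j).
  rewrite (le_trans (nmMXn _ _ _))// mulrCA ler_wpM2l ?exprn_ge0 ?nm_ge0//.
  rewrite (le_trans (nmX _ _))// ler_wpM2r ?exprn_ge0 ?nm_ge0//.
  by rewrite expr2 ler_peMl// ler1n.
have h2 : (2 ^+ N : R) <= 2 ^+ i * 2 ^+ j.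
  by rewrite -exprD ler_weXn2l ?ler1n// -leq_subLR.
rewrite ler_pdivlMr ?exprn_gt0// !exprMn.
set x := (i`!%:R)^-1; set y := (j`!%:R)^-1.
have x0 : 0 <= x * y by rewrite mulr_ge0// invfact_ge0.
have -> : k.+1%:R ^+ 2 * (x * (2 ^+ i * nm X ^+ i) * (y * (2 ^+ j * nm Y ^+ j))) =
  x * y * ((k.+1%:R ^+ 2 * (nm X ^+ i * nm Y ^+ j)) * (2 ^+ i * 2 ^+ j)) by ring.
by rewrite -[leLHS]mulrA ler_wpM2l// ler_pM ?nm_ge0 ?exprn_ge0.
Qed.

Lemma mexpD X Y : X * Y = Y * X -> mexp (X + Y) = mexp X * mexp Y.
Proof.
move=> XY; apply/esym; apply: (mcvg_unique (mcvgM (mexp_cvg X) (mexp_cvg Y))).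
have [K hK] := expsum_bounded (2 * nm X).
have [L hL] := expsum_bounded (2 * nm Y).
have es0 (x : R) N : 0 <= x -> 0 <= expsum x N.
  by move=> x0; apply: sumr_ge0 => i _; rewrite mulr_ge0 ?invfact_ge0 ?exprn_ge0.
suff h : mcvg (fun q => expp X q *m expp Y q - expp (X + Y) q) 0.
  rewrite -[mexp (X + Y)]add0r.
  by apply: (mcvg_ext _ (mcvgD h (mexp_cvg (X + Y)))) => p; rewrite subrK.
move=> e e0; pose D := k.+1%:R ^+ 2 * (K * L) + 1 : R.
have K0 : 0 <= K by rewrite (le_trans _ (hK 0%N))// es0 ?mulr_ge0 ?nm_ge0.
have L0 : 0 <= L by rewrite (le_trans _ (hL 0%N))// es0 ?mulr_ge0 ?nm_ge0.
have D0 : 0 < D by rewrite ltr_wpDl// !mulr_ge0// exprn_ge0.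
have [N hN] : exists N, forall p, (N <= p)%N -> D <= e * 2 ^+ p.
  exists (Num.truncn (D / e)).+1 => p Np; rewrite mulrC -ler_pdivrMr//.
  rewrite (le_trans (ltW (truncnS_gt _)))// (@le_trans _ _ p%:R) ?ler_nat//.
  by rewrite -natrX ler_nat ltnW// ltn_expl.
exists N => p Np; rewrite subr0 (le_trans (expp_mul_sub _ XY))//.
rewrite ler_pdivrMr ?exprn_gt0// (le_trans _ (hN _ Np))// /D ler_wpDr//.
by rewrite ler_wpM2l ?exprn_ge0// ler_pM ?es0 ?mulr_ge0 ?nm_ge0.
Qed.

Lemma mexpNl X : mexp (- X) * mexp X = 1.
Proof. have C : - X * X = X * - X by rewrite mulrN mulNr.
by rewrite -(mexpD C) addNr mexp0. Qed.

Lemma invmx_mexp X : invmx (mexp X) = mexp (- X).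
Proof.
have h1 : mexp (- X) *m mexp X = 1%:M by exact: mexpNl.
have [_ h2] := mulmx1_unit h1.
move: h1 h2; move: (mexp X) (mexp (- X)) => A B h1 h2.
by rewrite -[RHS]mulmx1 -(mulmxV h2) mulmxA h1 mul1mx.
Qed.

Lemma mexp_sum (F : nat -> 'M[C]_k) p q :
  (forall i j, F i * F j = F j * F i) ->
  \prod_(p <= i < q) mexp (F i) = mexp (\sum_(p <= i < q) F i).
Proof.
move=> FC; have [qp|pq] := leqP q p; first by rewrite !big_geq// mexp0.
rewrite -(subnKC (ltnW pq)); elim: (q - p)%N => [|r IH].
  by rewrite addn0 !big_geq// mexp0.
have C : (\sum_(p <= i < p + r) F i) * F (p + r)%N =
    F (p + r)%N * \sum_(p <= i < p + r) F i.
  by rewrite mulr_suml mulr_sumr; apply: eq_bigr => i _; exact: FC.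
have pr : (p <= p + r)%N by rewrite leq_addr.
by rewrite addnS (big_nat_recr _ _ _ pr) (big_nat_recr _ _ _ pr) /= IH (mexpD C).
Qed.

(** The functional equation reduces continuity at [l] to continuity at [0], which
is why the sequence has to commute with its limit. *)
Lemma mexp_continuous (u : nat -> 'M[C]_k) l :
  (forall p, u p * l = l * u p) -> mcvg u l ->
  mcvg (fun p => mexp (u p)) (mexp l).
Proof.
move=> ulC ul.
have h : mcvg (fun p => mexp (u p - l)) 1.
  move=> e e0; pose d : R := Num.min (1 / 2) (e / (2 * k.+1%:R)).
  have d0 : 0 < d by rewrite lt_min !divr_gt0// mulr_gt0// ltr0n.
  have [N hN] := ul _ d0; exists N => p /hN h.
  rewrite (le_trans (mexp_small (le_trans h _))) ?ge_min ?lexx//.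
  by rewrite mulrC -ler_pdivlMr ?mulr_gt0 ?ltr0n// (le_trans h)// ge_min lexx orbT.
have := mcvgM h (mcvg_cst (mexp l)); rewrite mul1mx; apply: mcvg_ext => p.
have C1 : (u p - l) * l = l * (u p - l) by rewrite mulrBl mulrBr ulC.
by rewrite -[LHS]/(_ * _) -(mexpD C1) subrK.
Qed.

Lemma nm_exprB X Y (r : R) m : nm X <= r -> nm Y <= r ->
  nm (X ^+ m.+1 - Y ^+ m.+1) <= m.+1%:R * r ^+ m * nm (X - Y).
Proof.
move=> Xr Yr; have r0 : 0 <= r by rewrite (le_trans (nm_ge0 X)).
elim: m => [|m IH]; first by rewrite !expr1 expr0 !mul1r.
have -> : X ^+ m.+2 - Y ^+ m.+2 = X ^+ m.+1 * (X - Y) + (X ^+ m.+1 - Y ^+ m.+1) * Y.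
  exact: exprSB.
apply: le_trans (nmD _ _) _.
have h1 : nm (X ^+ m.+1 * (X - Y)) <= r ^+ m.+1 * nm (X - Y).
  rewrite (le_trans (nmMXn _ _ _))// ler_wpM2r ?nm_ge0// lerXn2r ?nnegrE ?nm_ge0//.
have h2 : nm ((X ^+ m.+1 - Y ^+ m.+1) * Y) <= m.+1%:R * r ^+ m * nm (X - Y) * r.
  by rewrite (le_trans (nmM _ _))// ler_pM ?nm_ge0.
apply: le_trans (lerD h1 h2) _.
by rewrite -[m.+2%:R]natr1 exprSr le_eqVlt; apply/orP; left; apply/eqP; ring.
Qed.

(** Near zero the exponential is a small perturbation of [X |-> 1 + X], hence
injective with a Lipschitz inverse.  This identifies the logarithms which are
small. *)
Lemma mexp_inj_small X Y : nm X <= 1 / 4 -> nm Y <= 1 / 4 ->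
  nm (X - Y) <= 2 * nm (mexp X - mexp Y).
Proof.
move=> X4 Y4; set d := nm (X - Y).
have d0 : 0 <= d by exact: nm_ge0.
suff : nm (mexp X - mexp Y - (X - Y)) <= d / 2.
  have := nm_le_sub (X - Y) (mexp X - mexp Y).
  by rewrite -/d (nm_distC (X - Y)); lra.
apply: (mcvg_le (mcvgB (mexp_cvg X) (mexp_cvg Y))); exists 2%N => p p2.
have -> : expp X p - expp Y p - (X - Y) =
    \sum_(2 <= m < p) (m`!%:R)^-1 *: (X ^+ m - Y ^+ m).
  rewrite /expp -sumrB (@big_cat_nat _ _ _ 2)//= big_nat_recr//= big_nat1.
  rewrite fact0 invr1 !expr0 subrr add0r !scale1r !expr1 addrAC subrr add0r.
  by apply: eq_bigr => i _; rewrite scalerBr.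
rewrite (le_trans (nm_sum _ _ _))//.
apply: (@le_trans _ _ (\sum_(1 <= m < p) (1 / 4) ^+ m * d)).
  case: p p2 => // p p2; rewrite big_add1 /=.
  rewrite [leRHS](@big_cat_nat _ _ _ p)//=.
  rewrite ler_wpDr ?sumr_ge0//.
    by move=> i _; rewrite mulr_ge0 ?exprn_ge0//.
  rewrite ler_sum_nat// => m /andP[m0 _]; rewrite nmZ cmod_invfact.
  apply: le_trans (ler_wpM2l (invfact_ge0 _ _) (nm_exprB _ X4 Y4)) _.
  rewrite -/d.
  rewrite !mulrA ler_wpM2r// ler_piMl ?exprn_ge0// factS natrM invfM mulrAC.
  by rewrite mulVf ?pnatr_eq0// mul1r invfact_le1.
rewrite -mulr_suml; have h := @geom_sum_le R (1 / 4) 1 p.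
have : 2 * (1 / 4) ^+ 1 <= 1 / 2 :> R by rewrite expr1; lra.
move=> /(le_trans (h _ _)) h'.
by rewrite mulrC ler_wpM2l// (le_trans (h' _ _)) ?mul1r//; lra.
Qed.

End MatrixExponential.

(** * Expansions at infinity with geometric error bounds *)

Section PartialSums.
Variables (R : realType) (k : nat).
Local Notation C := (Cplx R).
Implicit Types (F G : C -> 'M[C]_k) (a b : nat -> 'M[C]_k).

Definition psum a N (u : C) : 'M[C]_k := \sum_(j < N) u ^- j *: a j.

Lemma psumS a N u : psum a N.+1 u = psum a N u + u ^- N *: a N.
Proof. by rewrite /psum big_ord_recr. Qed.

Lemma psumD a b N u : psum (fun j => a j + b j) N u = psum a N u + psum b N u.
Proof. by rewrite /psum -big_split /=; apply: eq_bigr => j _; rewrite scalerDr. Qed.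

Lemma psumZ c a N u : psum (fun j => c *: a j) N u = c *: psum a N u.
Proof.
by rewrite /psum scaler_sumr; apply: eq_bigr => j _; rewrite !scalerA mulrC.
Qed.

Lemma psum_sub a p q u : (p <= q)%N ->
  psum a q u - psum a p u = \sum_(p <= j < q) u ^- j *: a j.
Proof.
move=> pq; rewrite /psum -!(big_mkord xpredT (fun j => u ^- j *: a j)).
by rewrite (@big_cat_nat _ _ _ p)//= addrAC subrr add0r.
Qed.

Lemma psum_sum I (r : seq I) (P : pred I) (A : I -> nat -> 'M[C]_k) N u :
  psum (fun j => \sum_(i <- r | P i) A i j) N u =
  \sum_(i <- r | P i) psum (A i) N u.
Proof.
rewrite /psum exchange_big /=; apply: eq_bigr => j _.
by rewrite scaler_sumr.
Qed.

(** With one constant [B] for the coefficients, the error bounds and the domain,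
the expansions at infinity which converge are closed under the operations below
by enlarging [B] only. *)
Definition geom (B : R) F a : Prop :=
  [/\ 1 <= B, forall j, nm (a j) <= B * B ^+ j &
   forall N u, B <= cmod u -> nm (F u - psum a N u) <= B * (B / cmod u) ^+ N].

Lemma geom_mono B B' F a : B <= B' -> geom B F a -> geom B' F a.
Proof.
move=> BB' [B1 ha hF]; have B0 : 0 <= B by rewrite (le_trans ler01).
split; first exact: le_trans BB'.
  move=> j; apply: le_trans (ha j) _; rewrite ler_pM ?exprn_ge0//.
  by rewrite lerXn2r ?nnegrE// (le_trans B0).
move=> N u Bu; have B'0 : 0 <= B' := le_trans B0 BB'.
have Bu0 : 0 <= (cmod u)^-1 by rewrite invr_ge0 cmod_ge0.
apply: le_trans (hF N u (le_trans BB' Bu)) _.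
rewrite ler_pM ?exprn_ge0 ?mulr_ge0//.
by rewrite lerXn2r ?nnegrE ?mulr_ge0// ler_wpM2r.
Qed.

Lemma geom_ext B F G a : (forall u, B <= cmod u -> F u = G u) ->
  geom B F a -> geom B G a.
Proof. by move=> FG [B1 ha hF]; split=> // N u Bu; rewrite -FG// hF. Qed.

Lemma geom_coef B F a b : (forall j, a j = b j) -> geom B F a -> geom B F b.
Proof. by move=> ab; have -> : b = a by apply/funext. Qed.

Lemma geom_bound B F a u : geom B F a -> B <= cmod u -> nm (F u) <= B.
Proof.
by move=> [_ _ h] /(h 0%N); rewrite /psum big_ord0 subr0 expr0 mulr1.
Qed.

Lemma geom_bound1 B F a u : a 0%N = 0 -> geom B F a -> B <= cmod u ->
  nm (F u) <= B * (B / cmod u).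
Proof.
move=> a0 [_ _ h] /(h 1%N); rewrite /psum big_ord_recl big_ord0 a0 scaler0 addr0.
by rewrite subr0 expr1.
Qed.

Lemma half_pow_small (K e : R) : 0 < e -> exists N, forall p, (N <= p)%N ->
  K * (1 / 2) ^+ p <= e.
Proof.
move=> e0; exists (Num.truncn (`|K| / e)).+1 => p Np.
rewrite (@le_trans _ _ (`|K| * (1 / 2) ^+ p))//.
  by rewrite ler_wpM2r ?exprn_ge0 ?ler_norm.
rewrite mul1r exprVn ler_pdivrMr ?exprn_gt0// mulrC -ler_pdivrMr//.
rewrite (le_trans (ltW (truncnS_gt _)))// (@le_trans _ _ p%:R) ?ler_nat//.
by rewrite -natrX ler_nat ltnW// ltn_expl.
Qed.

Lemma ratio_half B (u : C) : 0 < B -> 2 * B <= cmod u ->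
  0 <= B / cmod u <= 1 / 2.
Proof.
move=> B0 Bu; have u0 : 0 < cmod u by rewrite (lt_le_trans _ Bu)// mulr_gt0.
rewrite divr_ge0 ?cmod_ge0 ?(ltW B0)//= ler_pdivrMr//; lra.
Qed.

Lemma geom_cvg B F a u : geom B F a -> 2 * B <= cmod u ->
  mcvg (psum a ^~ u) (F u).
Proof.
move=> [B1 _ h] Bu e e0; have B0 : 0 < B by rewrite (lt_le_trans ltr01).
have [N hN] := half_pow_small B e0; exists N => p /hN; apply: le_trans.
rewrite nm_distC; apply: le_trans (h p u _) _.
  by apply: le_trans Bu; rewrite ler_peMl ?ler1n// ltW.
have /andP[q0 q1] := ratio_half B0 Bu.
by rewrite ler_wpM2l ?(ltW B0)// lerXn2r ?nnegrE.
Qed.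

Lemma nm_tail a (B : R) (u : C) p q : 0 < B -> (forall j, nm (a j) <= B * B ^+ j) ->
  2 * B <= cmod u ->
  nm (\sum_(p <= j < q) u ^- j *: a j) <= 2 * B * (B / cmod u) ^+ p.
Proof.
move=> B0 ha Bu; have /andP[q0 q1] := ratio_half B0 Bu.
apply: le_trans (nm_sum _ _ _) _.
apply: (@le_trans _ _ (B * \sum_(p <= j < q) (B / cmod u) ^+ j)).
  rewrite mulr_sumr; apply: ler_sum => j _.
  rewrite nmZ cmodXV exprMn exprVn mulrA mulrC ler_wpM2r//.
  by rewrite invr_ge0 exprn_ge0 ?cmod_ge0.
by rewrite -[leRHS]mulrA mulrCA ler_wpM2l ?(ltW B0)// geom_sum_le.
Qed.

(** For a convergent series the error bounds follow from the growth of the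
coefficients, by summing a geometric tail. *)
Lemma geom_limn a (B : R) F : 1 <= B -> (forall j, nm (a j) <= B * B ^+ j) ->
  (forall u, 2 * B <= cmod u -> mcvg (psum a ^~ u) (F u)) ->
  geom (2 * B) F a.
Proof.
move=> B1 ha hF; have B0 : 0 < B by rewrite (lt_le_trans ltr01).
have B2 : B <= 2 * B by rewrite ler_peMl ?ler1n// ltW.
split; first exact: le_trans B2.
  move=> j; apply: le_trans (ha j) _.
  by rewrite ler_pM ?exprn_ge0 ?(ltW B0)// lerXn2r ?nnegrE ?mulr_ge0 ?(ltW B0).
move=> N u Bu; apply: (mcvg_le (hF u Bu)); exists N => p Np.
rewrite psum_sub//; apply: le_trans (nm_tail _ _ B0 ha Bu) _.
have u0 : 0 <= (cmod u)^-1 by rewrite invr_ge0 cmod_ge0.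
rewrite ler_wpM2l ?mulr_ge0 ?(ltW B0)// lerXn2r ?nnegrE ?mulr_ge0 ?(ltW B0)//.
by rewrite ler_wpM2r.
Qed.

Lemma mcvg_coefs a (B : R) (u : C) : 0 < B -> (forall j, nm (a j) <= B * B ^+ j) ->
  2 * B <= cmod u -> exists l, mcvg (psum a ^~ u) l.
Proof.
move=> B0 ha Bu; have /andP[q0 q1] := ratio_half B0 Bu.
apply: mcvg_cauchy => e e0; have [N hN] := half_pow_small (2 * B) e0.
exists N => p q Np pq; rewrite psum_sub//; apply: le_trans (nm_tail _ _ B0 ha Bu) _.
apply: le_trans (hN p Np); rewrite ler_wpM2l ?mulr_ge0 ?(ltW B0)//.
by rewrite lerXn2r ?nnegrE.
Qed.

Lemma geomD B F G a b : geom B F a -> geom B G b ->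
  geom (2 * B) (fun u => F u + G u) (fun j => a j + b j).
Proof.
move=> hF hG; have [B1 _ _] := hF.
have B0 : 0 <= B by rewrite (le_trans ler01).
have B2 : B <= 2 * B by rewrite ler_peMl ?ler1n.
have dbl x y : 0 <= y -> x <= y -> B * x + B * x <= 2 * B * y.
  by move=> y0 xy; have := ler_wpM2l B0 xy; lra.
split; first exact: le_trans B2.
  move=> j; apply: le_trans (nmD _ _) _.
  have [_ ha _] := hF; have [_ hb _] := hG.
  apply: le_trans (lerD (ha j) (hb j)) _; apply: dbl.
    by rewrite exprn_ge0// mulr_ge0.
  by rewrite lerXn2r ?nnegrE ?mulr_ge0.
move=> N u Bu; have u0 : 0 <= (cmod u)^-1 by rewrite invr_ge0 cmod_ge0.
rewrite psumD opprD addrACA; apply: le_trans (nmD _ _) _.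
have [_ _ ha] := hF; have [_ _ hb] := hG.
apply: le_trans (lerD (ha N u (le_trans B2 Bu)) (hb N u (le_trans B2 Bu))) _.
apply: dbl; first by rewrite exprn_ge0// !mulr_ge0.
by rewrite lerXn2r ?nnegrE ?mulr_ge0// ler_wpM2r.
Qed.

Lemma geomZ c B F a : geom B F a -> exists B',
  geom B' (fun u => c *: F u) (fun j => c *: a j).
Proof.
move=> [B1 ha hF]; have B0 : 0 <= B by rewrite (le_trans ler01).
pose D := cmod c + 1; have D1 : 1 <= D by rewrite lerDr cmod_ge0.
have D0 : 0 <= D by rewrite (le_trans ler01).
have DB : B <= D * B by rewrite ler_peMl.
have D0' : 0 <= D * B by rewrite mulr_ge0.
have cD : cmod c <= D by rewrite lerDl.
exists (D * B); split; first exact: le_trans DB.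
  move=> j; rewrite nmZ -mulrA ler_pM ?cmod_ge0 ?nm_ge0//.
  apply: le_trans (ha j) _; rewrite ler_wpM2l//.
  by rewrite lerXn2r ?nnegrE.
move=> N u Bu; have u0 : 0 <= (cmod u)^-1 by rewrite invr_ge0 cmod_ge0.
rewrite psumZ -scalerBr nmZ -mulrA ler_pM ?cmod_ge0 ?nm_ge0//.
apply: le_trans (hF N u (le_trans DB Bu)) _; rewrite ler_wpM2l//.
by rewrite lerXn2r ?nnegrE ?mulr_ge0// ler_wpM2r.
Qed.

Lemma geom0 : geom 1 (fun=> 0) (fun=> 0).
Proof.
split=> // [j|N u u1]; rewrite ?nm0 ?expr1n ?mulr1//.
rewrite /psum big1 ?subr0 ?nm0; last by move=> j _; rewrite scaler0.
by rewrite mul1r exprn_ge0// divr_ge0 ?cmod_ge0.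
Qed.

Lemma geom_sum I (r : seq I) (P : pred I) (F : I -> C -> 'M[C]_k) A :
  (forall i, P i -> exists B, geom B (F i) (A i)) ->
  exists B, geom B (fun u => \sum_(i <- r | P i) F i u)
                   (fun j => \sum_(i <- r | P i) A i j).
Proof.
move=> h; elim: r => [|i r [B IH]].
  exists 1; have -> : (fun u : C => \sum_(i <- [::] | P i) F i u) = fun=> 0.
    by apply/funext => u; rewrite big_nil.
  have -> : (fun j => \sum_(i <- [::] | P i) A i j) = fun=> 0.
    by apply/funext => j; rewrite big_nil.
  exact: geom0.
have [Pi|Pi] := boolP (P i).
  have [B' hB'] := h i Pi; exists (2 * Num.max B B').
  have h1 : B <= Num.max B B' by rewrite le_max lexx.
  have h2 : B' <= Num.max B B' by rewrite le_max lexx orbT.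
  have := geomD (geom_mono h2 hB') (geom_mono h1 IH).
  congr (geom _ _ _); first by apply/funext => u; rewrite big_cons Pi.
  by apply/funext => j; rewrite big_cons Pi.
exists B; move: IH; congr (geom _ _ _).
  by apply/funext => u; rewrite big_cons (negbTE Pi).
by apply/funext => j; rewrite big_cons (negbTE Pi).
Qed.

End PartialSums.

(** * Translation and differentiation of expansions *)

Lemma bin_le_exp2 n m : ('C(n, m) <= 2 ^ n)%N.
Proof.
elim: n m => [|n IH] [|m]; rewrite ?bin0 ?expn_gt0// binS expnS mul2n -addnn.
by rewrite leq_add.
Qed.

Section NegativeBinomial.
Variable (K : fieldType).
Implicit Types x : K.

(** The binomial series of [(1 + x) ^- j], truncated below [x ^+ n]. *)
Definition negbin (j n : nat) x : K :=
  \sum_(i < n) (-1) ^+ i * 'C((j + i).-1, i)%:R * x ^+ i.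

Lemma negbin0 n x : negbin 0 n.+1 x = 1.
Proof.
rewrite /negbin big_ord_recl big1 ?addr0 ?expr0 ?mulr1//= => i _.
by rewrite add0n /= bin_small ?mulr0 ?mul0r.
Qed.

Lemma negbinS j n x : (1 + x) * negbin j.+1 n.+1 x =
  negbin j n.+1 x + (-1) ^+ n * 'C((j + n), n)%:R * x ^+ n.+1.
Proof.
elim: n => [|n IH].
  by rewrite /negbin !big_ord_recl !big_ord0 /= !addr0 !bin0 !expr0 !mulr1 expr1 mul1r.
rewrite /negbin [in LHS]big_ord_recr [in RHS]big_ord_recr /= -/(negbin _ _ _).
rewrite mulrDr -/(negbin j.+1 n.+1 x) IH -/(negbin j n.+1 x) !addnS ?addSn /= binS natrD.
rewrite !exprS; ring.
Qed.

End NegativeBinomial.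

Section Translation.
Variable R : realType.
Local Notation C := (Cplx R).

(** By induction on [j]: multiplying by [1 + x] lowers [j] by one up to a single
term of degree [n.+1] ([negbinS]). *)
Lemma negbin_rem j n (x : C) : cmod x <= 1 / 2 ->
  cmod ((1 + x) ^- j - negbin j n.+1 x) <= 4 ^+ (j + n.+1) * cmod x ^+ n.+1.
Proof.
move=> x2; have x0 := cmod_ge0 x.
have x1 : 1 / 2 <= cmod (1 + x).
  by have := cmod_subl 1 x; rewrite cmod1; lra.
have nz : 1 + x != 0 by rewrite -cmod_gt0; lra.
elim: j => [|j IH].
  by rewrite expr0 invr1 negbin0 subrr cmod0 mulr_ge0 ?exprn_ge0.
have -> : (1 + x) ^- j.+1 - negbin j.+1 n.+1 x = (1 + x)^-1 *
    (((1 + x) ^- j - negbin j n.+1 x) - (-1) ^+ n * 'C((j + n), n)%:R * x ^+ n.+1).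
  apply: (mulfI nz); rewrite [RHS]mulrA divff// mul1r mulrBr negbinS exprS invfM.
  by rewrite mulrA divff// mul1r opprD addrA.
rewrite cmodM cmodV.
have h1 : (cmod (1 + x))^-1 <= 2.
  by rewrite invf_ple ?posrE//; lra.
have h2 : cmod ((-1) ^+ n * 'C((j + n), n)%:R * x ^+ n.+1) <=
    4 ^+ (j + n.+1) * cmod x ^+ n.+1.
  rewrite !cmodM !cmodX cmodN cmod1 expr1n mul1r cmod_nat.
  rewrite ler_wpM2r ?exprn_ge0// -natrX ler_nat (leq_trans (bin_le_exp2 _ _))//.
  by rewrite (_ : 4 = 2 ^ 2)%N// -expnM leq_pexp2l//; lia.
apply: le_trans (_ : 2 * (2 * (4 ^+ (j + n.+1) * cmod x ^+ n.+1)) <= _).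
  rewrite ler_pM ?invr_ge0 ?cmod_ge0//; apply: le_trans (cmodB _ _) _.
  by have := lerD IH h2; lra.
by rewrite addSn [X in _ <= X * _]exprS; lra.
Qed.

(** The coefficient of [u ^- k] in the expansion of [(u + c) ^- j]. *)
Definition shiftc (c : C) (k j : nat) : C :=
  (-1) ^+ (k - j) * 'C(k.-1, k - j)%:R * c ^+ (k - j).

Lemma shift_pow_rem (rho : R) (c u : C) j N : cmod c <= rho -> 2 * rho <= cmod u ->
  0 < cmod u -> (j < N)%N ->
  cmod ((u + c) ^- j - \sum_(j <= k < N) shiftc c k j * u ^- k) <=
  4 ^+ N * rho ^+ (N - j) / cmod u ^+ N.
Proof.
move=> crho u2 u0 jN; have [n ->] : exists n, N = (j + n.+1)%N.
  by exists (N - j.+1)%N; lia.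
clear N jN; have unz : u != 0 by rewrite -cmod_gt0.
have rho0 : 0 <= rho by rewrite (le_trans (cmod_ge0 c)).
pose x := c / u.
have xE : cmod x = cmod c / cmod u by rewrite cmodM cmodV.
have x2 : cmod x <= 1 / 2.
  by rewrite xE ler_pdivrMr//; lra.
have -> : \sum_(j <= k < j + n.+1) shiftc c k j * u ^- k =
    u ^- j * negbin j n.+1 x.
  rewrite -{1}(add0n j) big_addn addKn big_mkord /negbin mulr_sumr; apply: eq_bigr => i _.
  rewrite /shiftc addnK [(i + j)%N]addnC exprD expr_div_n invfM; ring.
have -> : (u + c) ^- j = u ^- j * (1 + x) ^- j.
  by rewrite -invfM -exprMn mulrDr mulr1 /x mulrCA divff// mulr1.
rewrite -mulrBr cmodM cmodXV addKn mulrC ler_pdivrMr ?exprn_gt0//.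
apply: le_trans (negbin_rem j n x2) _.
have -> : 4 ^+ (j + n.+1) * rho ^+ n.+1 / cmod u ^+ (j + n.+1) * cmod u ^+ j =
    4 ^+ (j + n.+1) * (rho ^+ n.+1 / cmod u ^+ n.+1).
  by rewrite [cmod u ^+ (j + _)]exprD; field; rewrite ?expf_neq0 ?gt_eqF.
rewrite ler_wpM2l ?exprn_ge0//.
rewrite -exprVn -exprMn xE lerXn2r ?nnegrE ?divr_ge0 ?cmod_ge0//.
by rewrite ler_wpM2r// invr_ge0 ltW.
Qed.

Section MatrixShift.
Variable k : nat.
Implicit Types (F G : C -> 'M[C]_k) (a b : nat -> 'M[C]_k).

Definition mshift (c : C) a : nat -> 'M[C]_k :=
  fun p => \sum_(j < p.+1) shiftc c p j *: a j.

Lemma psum_mshift c a N u : psum (mshift c a) N u =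
  \sum_(j < N) (\sum_(j <= p < N) shiftc c p j * u ^- p) *: a j.
Proof.
elim: N => [|N IH]; first by rewrite /psum !big_ord0.
rewrite psumS IH /mshift [in LHS]big_ord_recr scalerDr addrA [in RHS]big_ord_recr /=.
congr (_ + _); last by rewrite big_nat1 scalerA mulrC.
rewrite scaler_sumr -big_split /=; apply: eq_bigr => j _.
by rewrite scalerA -scalerDl big_nat_recr ?(ltnW (ltn_ord j))//= mulrC.
Qed.

Lemma shiftc_sum_le (rho B : R) (c : C) a p q : cmod c <= rho -> 1 <= B ->
  (forall j, nm (a j) <= B * B ^+ j) -> (q <= p.+1)%N ->
  \sum_(j < q) cmod (shiftc c p j) * nm (a j) <= B * (4 * (B + rho)) ^+ p.
Proof.
move=> crho B1 ha qp; have rho0 : 0 <= rho by rewrite (le_trans (cmod_ge0 c)).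
have B0 : 0 <= B by rewrite (le_trans ler01).
apply: (@le_trans _ _ (\sum_(j < q) B * (2 * (B + rho)) ^+ p)).
  apply: ler_sum => -[j /= jq] _.
  have jp : (j <= p)%N by rewrite -ltnS (leq_trans jq).
  rewrite /shiftc !cmodM !cmodX cmodN cmod1 expr1n mul1r cmod_nat.
  have h1 : ('C(p.-1, p - j)%:R : R) <= 2 ^+ p.
    by rewrite -natrX ler_nat (leq_trans (bin_le_exp2 _ _))// leq_pexp2l// leq_pred.
  have h2 : cmod c ^+ (p - j) <= (B + rho) ^+ (p - j).
    by rewrite lerXn2r ?nnegrE ?cmod_ge0 ?addr_ge0// ler_wpDl.
  have h3 : nm (a j) <= B * (B + rho) ^+ j.
    apply: le_trans (ha j) _; rewrite ler_wpM2l// lerXn2r ?nnegrE ?addr_ge0//.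
    by rewrite lerDl.
  have e : (B + rho) ^+ p = (B + rho) ^+ (p - j) * (B + rho) ^+ j.
    by rewrite -exprD subnK.
  have -> : B * (2 * (B + rho)) ^+ p =
      2 ^+ p * (B + rho) ^+ (p - j) * (B * (B + rho) ^+ j) by rewrite exprMn e; ring.
  rewrite ler_pM ?mulr_ge0 ?exprn_ge0 ?cmod_ge0 ?nm_ge0//.
  by rewrite ler_pM ?exprn_ge0 ?cmod_ge0.
rewrite sumr_const card_ord -[leLHS]mulr_natl [leLHS]mulrCA ler_wpM2l//.
rewrite (_ : 4 * (B + rho) = 2 * (2 * (B + rho))); last by ring.
rewrite [leRHS]exprMn ler_wpM2r ?exprn_ge0 ?mulr_ge0 ?addr_ge0//.
by rewrite -natrX ler_nat (leq_trans qp)// ltn_expl.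
Qed.

(** Re-expanding each power [(u + c) ^- j] costs a remainder controlled by
[shift_pow_rem].  The constants depend on [c] through [rho] only, so that the
expansion can be integrated over a circle of values of [c]. *)
Lemma geom_shift (rho B : R) (c : C) F a : cmod c <= rho -> geom B F a ->
  geom (8 * (B + rho)) (fun u => F (u + c)) (mshift c a).
Proof.
move=> crho [B1 ha hF]; have rho0 : 0 <= rho by rewrite (le_trans (cmod_ge0 c)).
have B0 : 0 <= B by rewrite (le_trans ler01).
set D := 8 * (B + rho); have D8 : 8 * B + 8 * rho = D by rewrite /D mulrDr.
have D0 : 0 <= D by lra.
split; first by lra.
  move=> p; apply: le_trans (nm_sum _ _ _) _.
  under eq_bigr do rewrite nmZ.
  apply: le_trans (shiftc_sum_le crho B1 ha (leqnn _)) _.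
  rewrite ler_pM ?exprn_ge0 ?mulr_ge0 ?addr_ge0//; first by lra.
  by rewrite lerXn2r ?nnegrE ?mulr_ge0 ?addr_ge0//; lra.
move=> N u Du; have u0 : 0 < cmod u by rewrite (lt_le_trans _ Du)//; lra.
have u0i : 0 <= (cmod u)^-1 by rewrite invr_ge0 ltW.
have uc : cmod u / 2 <= cmod (u + c) by have := cmod_subl u c; lra.
have Buc : B <= cmod (u + c) by lra.
have h1 : nm (F (u + c) - psum a N (u + c)) <= B * (D / cmod u) ^+ N.
  apply: le_trans (hF N _ Buc) _; rewrite ler_wpM2l// lerXn2r ?nnegrE ?divr_ge0 ?cmod_ge0//.
  rewrite ler_pdivrMr; last by lra.
  by rewrite mulrAC ler_pdivlMr//; nra.
have h2 : nm (psum a N (u + c) - psum (mshift c a) N u) <= B * (D / cmod u) ^+ N.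
  rewrite psum_mshift /psum -sumrB; apply: le_trans (nm_sum _ _ _) _.
  apply: (@le_trans _ _ (\sum_(j < N) B * (4 * (B + rho) / cmod u) ^+ N)).
    apply: ler_sum => -[j jN] _ /=; rewrite -scalerBl nmZ.
    have rem := @shift_pow_rem rho c u j N crho _ u0 jN.
    have h3 : nm (a j) <= B * (B + rho) ^+ j.
      apply: le_trans (ha j) _; rewrite ler_wpM2l// lerXn2r ?nnegrE ?addr_ge0//.
      by rewrite lerDl.
    have h4 : rho ^+ (N - j) <= (B + rho) ^+ (N - j).
      by rewrite lerXn2r ?nnegrE ?addr_ge0// lerDr.
    apply: le_trans (ler_pM (cmod_ge0 _) (nm_ge0 _) (rem _) h3) _; first by lra.
    have e : (B + rho) ^+ N = (B + rho) ^+ (N - j) * (B + rho) ^+ j.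
      by rewrite -exprD subnK// ltnW.
    have -> : B * (4 * (B + rho) / cmod u) ^+ N =
      4 ^+ N * (B + rho) ^+ (N - j) / cmod u ^+ N * (B * (B + rho) ^+ j).
      by rewrite expr_div_n exprMn e; ring.
    rewrite ler_wpM2r ?mulr_ge0 ?exprn_ge0 ?addr_ge0//.
    rewrite ler_wpM2r ?invr_ge0 ?exprn_ge0 ?cmod_ge0//.
    by rewrite ler_wpM2l ?exprn_ge0.
  rewrite sumr_const card_ord -[leLHS]mulr_natl [leLHS]mulrCA ler_wpM2l//.
  have -> : D / cmod u = 2 * (4 * (B + rho) / cmod u) by rewrite /D; ring.
  rewrite [leRHS]exprMn ler_wpM2r ?exprn_ge0 ?divr_ge0 ?mulr_ge0 ?addr_ge0 ?cmod_ge0//.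
  by rewrite -natrX ler_nat ltnW// ltn_expl.
apply: le_trans (nm_dist_trans (psum a N (u + c)) _ _) _.
apply: le_trans (lerD h1 h2) _; rewrite -mulrDl ler_wpM2r ?exprn_ge0 ?divr_ge0 ?(ltW u0)//.
by lra.
Qed.

Definition mderiv a : nat -> 'M[C]_k := fun p => - (p.-1)%:R *: a p.-1.

(** The part of [mshift h a] of order at least two in [h]. *)
Let rest (h : C) a p : 'M[C]_k := \sum_(j < p.-1)
  ((-1) ^+ (p - j) * 'C(p.-1, p - j)%:R * h ^+ (p - j).-2) *: a j.

Let mshiftE h a p : mshift h a p = a p + h *: mderiv a p + h ^+ 2 *: rest h a p.
Proof.
rewrite /mshift /mderiv /rest; case: p => [|p] /=.
  rewrite big_ord_recl !big_ord0 !addr0 /shiftc subnn !expr0 !mulr1 ?bin0 scale1r.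
  by rewrite oppr0 scale0r !scaler0 !addr0.
rewrite !big_ord_recr /= /shiftc subnn subSnn !expr0 !mulr1 bin0 mul1r scale1r !expr1.
rewrite bin1 addrC -addrA; congr (_ + _); rewrite addrC; congr (_ + _).
  by rewrite scalerA mulN1r mulrC.
rewrite scaler_sumr; apply: eq_bigr => -[j /= jp] _.
rewrite scalerA; congr (_ *: _).
rewrite (_ : (p.+1 - j)%N = (p.+1 - j).-2.+2); last by lia.
by rewrite [X in _ * X = _]exprS [X in _ * (_ * X)]exprS expr2 /=; ring.
Qed.

Let nm_rest (h : C) a (B : R) p : cmod h <= 1 -> 1 <= B ->
  (forall j, nm (a j) <= B * B ^+ j) ->
  nm (rest h a p) <= (4 * (B + 1)) * (4 * (B + 1)) ^+ p.
Proof.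
move=> h1 B1 ha; have c1 : cmod (1 : C) <= 1 by rewrite cmod1.
have B0 : 0 <= B by rewrite (le_trans ler01).
have qp : (p.-1 <= p.+1)%N by lia.
apply: (@le_trans _ _ (B * (4 * (B + 1)) ^+ p)); last first.
  by rewrite ler_wpM2r ?exprn_ge0 ?mulr_ge0 ?addr_ge0//; lra.
apply: le_trans (shiftc_sum_le c1 B1 ha qp).
apply: le_trans (nm_sum _ _ _) _; apply: ler_sum => j _.
rewrite nmZ ler_wpM2r ?nm_ge0// /shiftc !cmodM ler_wpM2l ?mulr_ge0 ?cmod_ge0//.
by rewrite expr1n cmod1 cmodX exprn_ile1 ?cmod_ge0.
Qed.

Let nm_mderiv a (B : R) p : 1 <= B -> (forall j, nm (a j) <= B * B ^+ j) ->
  nm (mderiv a p) <= (2 * B) * (2 * B) ^+ p.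
Proof.
move=> B1 ha; have B0 : 0 <= B by rewrite (le_trans ler01).
rewrite /mderiv nmZ cmodN cmod_nat exprMn.
have h1 : (p.-1)%:R <= 2 ^+ p :> R.
  by rewrite -natrX ler_nat (leq_trans (leq_pred _))// ltnW// ltn_expl.
have h2 : nm (a p.-1) <= 2 * B * B ^+ p.
  apply: le_trans (ha _) _; rewrite ler_pM ?exprn_ge0//; first by lra.
  by rewrite ler_weXn2l// leq_pred.
by apply: le_trans (ler_pM (ler0n _ _) (nm_ge0 _) h1 h2) _; rewrite mulrCA.
Qed.

(** The expansion of [F (u + h)] is [mshift h a = a + h a' + O(h ^+ 2)] with
[a' = mderiv a], and all these coefficients grow geometrically. *)
Lemma geom_diff B F a (h u : C) n : geom B F a -> cmod h <= 1 ->
  16 * (B + 1) <= cmod u ->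
  nm (F (u + h) - F u - h *: psum (mderiv a) n u) <=
  cmod h ^+ 2 * (16 * (B + 1)) +
  cmod h * (16 * (B + 1) * (16 * (B + 1) / cmod u) ^+ n).
Proof.
move=> hF h1 Du; have [B1 ha _] := hF.
have [B1' _ hs] := geom_shift h1 hF; have [_ _ hf] := hF.
set D := 16 * (B + 1); have D16 : D = 16 * B + 16 by rewrite /D mulrDr mulr1.
have u0 : 0 < cmod u by lra.
have u0i : 0 <= (cmod u)^-1 by rewrite invr_ge0 ltW.
have B0 : 0 < B by lra.
have Bu : B <= cmod u by lra.
have Bu' : 8 * (B + 1) <= cmod u by lra.
have Bh : 0 < 8 * (B + 1) by lra.
have Bh2 : 2 * (8 * (B + 1)) <= cmod u by lra.
have /andP[q0 q1] := ratio_half Bh Bh2.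
apply/ler_addgt0Pr => e e0.
have [N0 hN] := half_pow_small (16 * (B + 1)) e0.
pose N := maxn n N0; have nN : (n <= N)%N by rewrite leq_maxl.
have {}hN : 16 * (B + 1) * (1 / 2) ^+ N <= e by apply: hN; rewrite leq_maxr.
have -> : F (u + h) - F u - h *: psum (mderiv a) n u =
  (F (u + h) - psum (mshift h a) N u) - (F u - psum a N u) +
  h ^+ 2 *: (psum (rest h a) N u - psum (rest h a) 0 u) +
  h *: (psum (mderiv a) N u - psum (mderiv a) n u).
  have -> : psum (mshift h a) N u =
    psum a N u + h *: psum (mderiv a) N u + h ^+ 2 *: psum (rest h a) N u.
    rewrite -!psumZ -!psumD; congr (psum _ _ _); apply/funext => p.
    exact: mshiftE.
  rewrite [psum (rest h a) 0 u]/psum big_ord0 subr0 scalerBr.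
  move: (F _) (F _) (psum a N u) (h *: _) (h ^+ 2 *: _) (h *: _) => x y z v w t.
  by apply/matrixP => i j; rewrite !mxE; ring.
have n1 := hs N u Bu'; have n2 := hf N u Bu.
have n3 : nm (psum (rest h a) N u - psum (rest h a) 0 u) <= D.
  have D4 : 0 < 4 * (B + 1) by lra.
  rewrite psum_sub//; apply: le_trans (nm_tail _ _ D4 (fun j => nm_rest j h1 B1 ha) _) _.
    by lra.
  by rewrite expr0 mulr1; lra.
have n4 : nm (psum (mderiv a) N u - psum (mderiv a) n u) <= D * (D / cmod u) ^+ n.
  have D4 : 0 < 2 * B by lra.
  rewrite psum_sub//; apply: le_trans (nm_tail _ _ D4 (fun j => nm_mderiv j B1 ha) _) _.
    by lra.
  rewrite ler_pM ?exprn_ge0 ?mulr_ge0 ?divr_ge0 ?(ltW B0) ?(ltW u0)//; first by lra.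
  rewrite lerXn2r ?nnegrE ?divr_ge0 ?mulr_ge0 ?addr_ge0 ?(ltW B0) ?(ltW u0)//.
  by rewrite ler_wpM2r//; lra.
have n12 : 8 * (B + 1) * (8 * (B + 1) / cmod u) ^+ N + B * (B / cmod u) ^+ N <= e.
  apply: le_trans hN; have -> : 16 * (B + 1) * (1 / 2) ^+ N =
      8 * (B + 1) * (1 / 2) ^+ N + 8 * (B + 1) * (1 / 2) ^+ N by ring.
  apply: lerD.
    by rewrite ler_wpM2l ?mulr_ge0 ?addr_ge0 ?(ltW B0)// lerXn2r ?nnegrE.
  rewrite ler_pM ?exprn_ge0 ?divr_ge0 ?(ltW B0) ?(ltW u0)//; first by lra.
  rewrite lerXn2r ?nnegrE ?divr_ge0 ?(ltW B0) ?(ltW u0)//.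
  by apply: le_trans q1; rewrite ler_wpM2r//; lra.
apply: le_trans (nmD _ _) _; apply: le_trans (lerD (nmD _ _) (lexx _)) _.
apply: le_trans (lerD (lerD (nmB _ _) (lexx _)) (lexx _)) _.
rewrite !nmZ cmodX.
have m3 : cmod h ^+ 2 * nm (psum (rest h a) N u - psum (rest h a) 0 u) <= cmod h ^+ 2 * D.
  by rewrite ler_wpM2l ?exprn_ge0 ?cmod_ge0.
have m4 : cmod h * nm (psum (mderiv a) N u - psum (mderiv a) n u) <=
    cmod h * (D * (D / cmod u) ^+ n) by rewrite ler_wpM2l ?cmod_ge0.
have m1 := lerD n1 n2.
rewrite -addrA -[leRHS]addrC lerD ?lerD//; exact: le_trans m1 n12.
Qed.

Lemma geom_lip B F a (h u : C) : geom B F a -> cmod h <= 1 ->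
  16 * (B + 1) <= cmod u -> nm (F (u + h) - F u) <= 32 * (B + 1) * cmod h.
Proof.
move=> hF h1 Du; have := geom_diff 0 hF h1 Du.
rewrite /psum big_ord0 scaler0 subr0 expr0 mulr1 => /le_trans; apply.
have [B1 _ _] := hF; have h0 := cmod_ge0 h.
have : cmod h ^+ 2 <= cmod h by rewrite expr2 ler_piMl.
by nra.
Qed.

(** As [h] tends to [0], the difference quotients tend to the derivative, and
[geom_diff] compares them with the differentiated expansion. *)
Lemma geom_derive B F a :
  (forall u, 16 * (B + 1) <= cmod u -> derivable F u 1) ->
  geom B F a -> geom (16 * (B + 1)) (derive1 F) (mderiv a).
Proof.
move=> dF hF; have [B1 ha _] := hF.
have B0 : 0 <= B by apply: le_trans B1; exact: ler01.
split; first by lra.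
  move=> p; apply: le_trans (nm_mderiv p B1 ha) _.
  rewrite ler_pM ?exprn_ge0 ?mulr_ge0//; first by lra.
  by rewrite lerXn2r ?nnegrE ?mulr_ge0 ?addr_ge0//; lra.
move=> n u Du; set E := 16 * (B + 1) * _.
have dFu : derive1 F u = lim ((fun h => h^-1 *: (F (h + u) - F u)) @ 0^').
  by [].
have cF : (fun h => h^-1 *: (F (h + u) - F u)) @ 0^' --> derive1 F u.
  rewrite dFu; have := dF u Du; rewrite /derivable.
  have -> : (fun h => h^-1 *: (F (h *: 1 + u) - F u)) = (fun h => h^-1 *: (F (h + u) - F u)).
    by apply/funext => h; rewrite /GRing.scale /= mulr1.
  by [].
apply/ler_addgt0Pr => e e0.
pose d := Num.min 1 (e / 2 / (16 * (B + 1))).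
have D0 : 0 < 16 * (B + 1) by lra.
have d0 : 0 < d by rewrite lt_min !divr_gt0 ?ltr01.
pose e' := e / 2 / (k * k).+1%:R.
have e'0 : 0 < e' by rewrite !divr_gt0.
have [h [hd h0 hE]] : exists h : C, [/\ cmod h <= d, h != 0 &
    `|derive1 F u - h^-1 *: (F (h + u) - F u)| <= real_to_C e'].
  have := cF; move=> /cvgrPdist_le/(_ (real_to_C e')).
  rewrite -real_to_C0 ltcR_real => /(_ e'0) hn.
  have hd : \forall h \near (0 : C)^', cmod h <= d /\ h != 0.
    have hd0 : \forall h \near nbhs (0 : C), `|h| <= real_to_C d.
      by apply/nbhs_normP; exists (real_to_C d) => [|h /=];
        [rewrite /= -real_to_C0 ltcR_real|rewrite sub0r normrN => /ltW].
    rewrite near_withinE; apply: filterS hd0 => h hd h0; split=> //.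
    by rewrite -lecR_real -cmodE.
  have [h [[h1 h2] h3]] : exists h : C, (cmod h <= d /\ h != 0) /\
     `|derive1 F u - h^-1 *: (F (h + u) - F u)| <= real_to_C e'.
    by apply: (@filter_ex _ (0 : C)^' _); apply: filterS2 hd hn => h ? ?; split.
  by exists h.
have hgt0 : 0 < cmod h by rewrite cmod_gt0.
have h1 : cmod h <= 1 by rewrite (le_trans hd)// ge_min lexx.
have := geom_diff n hF h1 Du; rewrite -/E => hdiff.
have h2 : nm (h^-1 *: (F (h + u) - F u) - psum (mderiv a) n u) <= e / 2 + E.
  have -> : h^-1 *: (F (h + u) - F u) - psum (mderiv a) n u =
    h^-1 *: (F (u + h) - F u - h *: psum (mderiv a) n u).
    by rewrite [h + u]addrC [RHS]scalerBr scalerA mulVf// scale1r.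
  rewrite nmZ cmodV mulrC ler_pdivrMr//; apply: le_trans hdiff _.
  have -> : (e / 2 + E) * cmod h = cmod h * (e / 2) + cmod h * E by ring.
  rewrite lerD2r expr2 -mulrA ler_wpM2l ?(ltW hgt0)//.
  by rewrite -ler_pdivlMr// (le_trans hd)// ge_min lexx orbT.
apply: le_trans (nm_dist_trans (h^-1 *: (F (h + u) - F u)) _ _) _.
apply: le_trans (lerD (nm_le_normr hE) h2) _.
rewrite addrA [leRHS]addrC lerD2r [leRHS]splitr lerD2r /e' mulrCA ler_piMr//.
  by rewrite divr_ge0// ltW.
by rewrite ler_pdivrMr ?ltr0n// mul1r ler_nat.
Qed.

End MatrixShift.
End Translation.

(** * The logarithm of a matrix-valued expansion *)

Lemma sum_conv (A : pzRingType) (a b : nat -> A) N :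
  \sum_(n < N) \sum_(j < n.+1) a j * b (n - j)%N =
  \sum_(j < N) a j * \sum_(i < N - j) b i.
Proof.
elim: N => [|N IH]; first by rewrite !big_ord0.
rewrite big_ord_recr /= IH [RHS]big_ord_recr /= subSnn big_ord1.
rewrite [X in _ + X = _]big_ord_recr /= subnn addrA; congr (_ + _).
rewrite -big_split /=; apply: eq_bigr => -[j /= jN] _.
by rewrite (subSn (ltnW jN)) [in RHS]big_ord_recr /= mulrDr.
Qed.

(** The truncated series of [exp (log (1 + X))] agrees with [1 + X] up to the
order of truncation, because it solves [(1 + X) f' = f] up to that order. *)
Section ExpLog.
Variables (R : realType) (M : nat).
Local Notation C := (Cplx R).

Definition logp : {poly C} := \sum_(1 <= m < M.+1) ((-1) ^+ m.-1 / m%:R) *: 'X^m.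
Definition explogp : {poly C} := \sum_(0 <= m < M.+1) (m`!%:R)^-1 *: logp ^+ m.

Lemma logp_dvdX : exists q : {poly C}, logp = 'X * q.
Proof.
rewrite /logp big_add1 /=.
exists (\sum_(0 <= i < M) ((-1) ^+ i / i.+1%:R) *: 'X^i).
by rewrite mulr_sumr; apply: eq_bigr => i _; rewrite -scalerAr exprS.
Qed.

Lemma deriv_logp : (1 + 'X) * logp^`() = 1 - (- 'X) ^+ M.
Proof.
have -> : logp^`() = \sum_(i < M) (- 'X) ^+ i.
  rewrite /logp big_add1 /= big_mkord raddf_sum; apply: eq_bigr => i _ /=.
  rewrite derivZ derivXn /= -[X in _ *: X = _]scaler_nat scalerA divfK ?pnatr_eq0//.
  by rewrite -[- 'X]mulN1r exprMn -polyC1 -polyCN -polyC_exp mul_polyC.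
have := subrX1 (- 'X : {poly C}) M.
rewrite -opprB => /(congr1 -%R); rewrite opprK => ->.
by rewrite -mulNr opprB opprK addrC.
Qed.

Lemma deriv_explogp : exists q : {poly C},
  (1 + 'X) * explogp^`() = explogp + 'X^M * q.
Proof.
have [q hq] := logp_dvdX.
have -> : explogp^`() = (\sum_(0 <= m < M) (m`!%:R)^-1 *: logp ^+ m) * logp^`().
  rewrite /explogp big_nat_recl// derivD derivZ expr0 derivC scaler0 add0r.
  rewrite raddf_sum mulr_suml; apply: eq_bigr => i _ /=.
  rewrite derivZ deriv_exp /= -[X in _ *: X = _]scaler_nat scalerA factS natrM.
  rewrite invfM mulrAC mulVf ?pnatr_eq0// mul1r -scalerAl; congr (_ *: _).
  exact: mulrC.
rewrite mulrCA deriv_logp.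
have -> : \sum_(0 <= m < M) (m`!%:R)^-1 *: logp ^+ m =
    explogp - (M`!%:R)^-1 *: logp ^+ M.
  by rewrite /explogp big_nat_recr//= addrK.
set f := explogp; set c := _^-1.
exists (- (c *: q ^+ M) - (-1) ^+ M * (f - c *: logp ^+ M)).
have -> : c *: logp ^+ M = 'X^M * (c *: q ^+ M) by rewrite hq exprMn scalerAr.
by rewrite -[- 'X]mulN1r exprMn; ring.
Qed.

(** The equation [(1 + X) f' = f] modulo [X^M] is the recurrence
[(m + 1) f_(m+1) = (1 - m) f_m], which breaks off after [f_1]. *)
Lemma coef_explogp n : (n <= M)%N -> explogp`_n = (n < 2)%:R.
Proof.
have [q hq] := deriv_explogp; have [q' hq'] := logp_dvdX.
have rec m : (m < M)%N -> m.+1%:R * explogp`_m.+1 = (1 - m%:R) * explogp`_m.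
  move=> mM; have := congr1 (fun p : {poly C} => p`_m) hq.
  rewrite mulrDl mul1r !coefD coefXM coefXnM mM addr0 !coef_deriv mulrBl mul1r.
  case: m mM => [|m] mM /= e; rewrite -[X in _ = X - _]e ?coef_deriv; ring.
elim: n => [|n IH] nM.
  rewrite /explogp big_nat_recl// invr1 scale1r expr0 coefD coef1 /=.
  rewrite coef_sum big1 ?addr0// => i _.
  by rewrite coefZ hq' exprMn exprS -mulrA coefXM mulr0.
have := rec n nM; rewrite IH ?(ltnW nM)// => e.
have n0 : (n.+1%:R : C) != 0 by rewrite pnatr_eq0.
apply: (mulfI n0); rewrite e; case: n {IH e n0 nM rec} => [|[|n]] /=.
- by rewrite subr0.
- by rewrite subrr mul0r mulr0.
- by rewrite !mulr0.
Qed.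

(** A submultiplicative seminorm for which [logp] has size at most
[\sum_m 2 ^- m = 1], so that [explogp] has size at most [e]. *)
Let W D (p : {poly C}) : R := \sum_(i < D) cmod p`_i * (1 / 2) ^+ i.

Let W_ge0 D p : 0 <= W D p.
Proof. by apply: sumr_ge0 => i _; rewrite mulr_ge0 ?cmod_ge0// exprn_ge0. Qed.

Let WD D p q : W D (p + q) <= W D p + W D q.
Proof.
rewrite /W -big_split /=; apply: ler_sum => i _.
by rewrite -mulrDl ler_wpM2r ?exprn_ge0// coefD cmodD.
Qed.

Let WZ D c p : W D (c *: p) = cmod c * W D p.
Proof. by rewrite /W mulr_sumr; apply: eq_bigr => i _; rewrite coefZ cmodM mulrA. Qed.

Let W_sum D I (r : seq I) (P : pred I) (F : I -> {poly C}) :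
  W D (\sum_(i <- r | P i) F i) <= \sum_(i <- r | P i) W D (F i).
Proof.
elim/big_ind2: _ => //; first by rewrite /W big1// => i _; rewrite coef0 cmod0 mul0r.
by move=> x1 x2 y1 y2 h1 h2; apply: le_trans (WD _ _ _) _; rewrite lerD.
Qed.

Let WM D p q : W D (p * q) <= W D p * W D q.
Proof.
apply: (@le_trans _ _ (\sum_(n < D) \sum_(i < n.+1)
    (cmod p`_i * (1 / 2) ^+ i) * (cmod q`_(n - i) * (1 / 2) ^+ (n - i)))).
  apply: ler_sum => n _; rewrite coefM.
  apply: le_trans (ler_wpM2r _ (cmod_sum _ _ _)) _; first by rewrite exprn_ge0.
  rewrite mulr_suml; apply: ler_sum => -[i /= ilen] _; rewrite ltnS in ilen.
  by rewrite cmodM -{2}(subnKC ilen) exprD mulrACA.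
rewrite (sum_conv (fun i => cmod p`_i * (1 / 2) ^+ i)
                  (fun i => cmod q`_i * (1 / 2) ^+ i)).
rewrite /W mulr_suml; apply: ler_sum => i _.
rewrite ler_wpM2l ?mulr_ge0 ?cmod_ge0 ?exprn_ge0//.
rewrite -!(big_mkord xpredT (fun j => cmod q`_j * (1 / 2) ^+ j)).
rewrite [leRHS](@big_cat_nat _ _ _ (D - i))//= ?leq_subr// lerDl.
by apply: sumr_ge0 => j _; rewrite !mulr_ge0 ?cmod_ge0 ?exprn_ge0.
Qed.

Let WX D p m : W D (p ^+ m) <= W D p ^+ m.
Proof.
elim: m => [|m IH].
  rewrite !expr0 /W; case: D => [|D]; first by rewrite big_ord0.
  rewrite big_ord_recl coef1 /= cmod1 expr0 mulr1 big1 ?addr0// => i _.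
  by rewrite coef1 cmod0 mul0r.
by rewrite !exprS; apply: le_trans (WM _ _ _) _; rewrite ler_wpM2l ?W_ge0.
Qed.

Let W_logp D : W D logp <= 1.
Proof.
apply: le_trans (W_sum _ _ _ _) _.
apply: (@le_trans _ _ (\sum_(1 <= m < M.+1) (1 / 2) ^+ m)).
  apply: ler_sum_nat => m /andP[m0 _]; rewrite WZ.
  have WXm : W D 'X^m <= (1 / 2) ^+ m.
    rewrite /W; have [mD|Dm] := ltnP m D.
      rewrite (bigD1 (Ordinal mD)) //= coefXn eqxx cmod1 mul1r big1 ?addr0// => i im.
      rewrite coefXn; move: im; rewrite -val_eqE /= => /negbTE ->.
      by rewrite cmod0 mul0r.
    rewrite big1 ?exprn_ge0// => -[i iD] _ /=; rewrite coefXn.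
    by rewrite ltn_eqF ?cmod0 ?mul0r// (leq_trans iD).
  rewrite cmodM cmodX cmodN cmod1 expr1n mul1r cmodV cmod_nat.
  apply: le_trans WXm; rewrite ler_piMl//.
  by rewrite invf_le1 ?ltr0n ?ler1n.
apply: le_trans (@geom_sum_le R (1 / 2) 1 _ _ _) _ => //; lra.
Qed.

Lemma coef_explogp_le (K : R) n : (forall N, expsum 1 N <= K) ->
  cmod explogp`_n <= K * 2 ^+ n.
Proof.
move=> hK; suff : W n.+1 explogp <= K.
  move=> WK; rewrite -ler_pdivrMr ?exprn_gt0// -exprVn -[2^-1]mul1r.
  apply: le_trans WK; rewrite /W big_ord_recr /= lerDr.
  by apply: sumr_ge0 => i _; rewrite mulr_ge0 ?cmod_ge0 ?exprn_ge0.
apply: le_trans (hK M.+1); apply: le_trans (W_sum _ _ _ _) _.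
apply: ler_sum => m _; rewrite WZ cmodV cmod_nat ler_wpM2l ?invfact_ge0//.
apply: le_trans (WX _ _ _) _.
by rewrite expr1n exprn_ile1 ?W_ge0 ?W_logp.
Qed.

End ExpLog.

Section MatrixLog.
Variables (R : realType).
Local Notation C := (Cplx R).

Lemma mxZl k (c : C) (X Y : 'M[C]_k) : (c *: X) * Y = c *: (X * Y).
Proof. exact: (esym (scalemxAl c X Y)). Qed.

Lemma mxZr k (c : C) (X Y : 'M[C]_k) : X * (c *: Y) = c *: (X * Y).
Proof. exact: (esym (scalemxAr c X Y)). Qed.

Lemma psum_fps_mul k (a b : nat -> 'M[C]_k) N u :
  psum (fps_mul a b) N u = \sum_(j < N) (u ^- j *: a j) * psum b (N - j) u.
Proof.
rewrite /psum -(sum_conv (fun j => u ^- j *: a j) (fun j => u ^- j *: b j)).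
apply: eq_bigr => n _; rewrite /fps_mul scaler_sumr; apply: eq_bigr => -[j /= jn] _.
rewrite ltnS in jn; rewrite mxZl mxZr scalerA.
by congr (_ *: _); rewrite -{1}(subnKC jn) exprD invfM.
Qed.

Lemma mul_psum_sub k (F G : 'M[C]_k) (a b : nat -> 'M[C]_k) N u :
  F * G - psum (fps_mul a b) N u =
  (F - psum a N u) * G + \sum_(j < N) (u ^- j *: a j) * (G - psum b (N - j) u).
Proof.
rewrite (eq_bigr (fun j : 'I_N =>
  (u ^- j *: a j) * G - (u ^- j *: a j) * psum b (N - j) u)); last first.
  by move=> j _; rewrite mulrBr.
by rewrite sumrB -mulr_suml -/(psum a N u) mulrBl addrA subrK psum_fps_mul.
Qed.

Lemma fps_pow_low k (z : nat -> 'M[C]_k) m r :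
  z 0%N = 0 -> (r < m)%N -> fps_pow z m r = 0.
Proof.
move=> z0; elim: m r => // m IH r rm; rewrite /fps_pow /= -/(fps_pow z m) /fps_mul.
apply: big1 => -[[|j] /= jr] _; first by rewrite z0 mul0r.
by rewrite IH ?mulr0//; lia.
Qed.

Lemma half_sum_le N : \sum_(j < N) (1 / 2) ^+ j <= 2 :> R.
Proof.
rewrite -(big_mkord xpredT (fun j => (1 / 2 : R) ^+ j)).
by apply: le_trans (geom_sum_le 0 N _ (lexx _)) _; rewrite ?expr0 ?mulr1.
Qed.

Section Powers.
Variables (k : nat) (B : R) (z : nat -> 'M[C]_k).
Hypotheses (B1 : 1 <= B) (hz : forall j, nm (z j) <= B * B ^+ j).

Let B0 : 0 <= B. Proof. exact: le_trans B1. Qed.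

Lemma nm_fps_pow m r :
  nm (fps_pow z m r) <= k.+1%:R * (3 * B) ^+ m * (2 * B) ^+ r.
Proof.
elim: m r => [|m IH] r.
  rewrite /fps_pow /= /fps_one expr0 mulr1.
  have h : 1 <= (2 * B) ^+ r by rewrite exprn_ege1//; have := B1; lra.
  case: eqP => _; last by rewrite nm0 mulr_ge0// (le_trans ler01).
  rewrite nm1; apply: (@le_trans _ _ k.+1%:R); first by rewrite ler_nat.
  by rewrite ler_peMr.
rewrite /fps_pow /= -/(fps_pow z m) /fps_mul; apply: le_trans (nm_sum _ _ _) _.
apply: (@le_trans _ _ (\sum_(j < r.+1) (k.+1%:R * (3 * B) ^+ m * (2 * B) ^+ r * B) *
    (1 / 2) ^+ j)).
  apply: ler_sum => -[j /= jr] _; rewrite ltnS in jr; apply: le_trans (nmM _ _) _.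
  apply: le_trans (ler_pM (nm_ge0 _) (nm_ge0 _) (hz j) (IH _)) _.
  rewrite -[in X in _ <= X](subnKC jr) [(2 * B) ^+ (j + _)]exprD.
  rewrite le_eqVlt; apply/orP; left; apply/eqP.
  rewrite [(2 * B) ^+ j]exprMn mul1r exprVn; field; rewrite expf_neq0//.
rewrite -mulr_sumr; apply: le_trans (ler_wpM2l _ (half_sum_le _)) _.
  by rewrite !mulr_ge0 ?exprn_ge0 ?mulr_ge0.
rewrite exprS (_ : _ * 2 = k.+1%:R * (2 * B * (3 * B) ^+ m) * (2 * B) ^+ r); last by ring.
rewrite ler_wpM2r ?exprn_ge0 ?mulr_ge0// ler_wpM2l// ler_wpM2r ?exprn_ge0 ?mulr_ge0//.
by have := B0; lra.
Qed.

(** The constant grows exponentially in [m], which the truncation of the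
logarithmic series at the order of the expansion can afford. *)
Lemma geom_pow F m N u : 2 * B <= cmod u ->
  (forall N, nm (F u - psum z N u) <= B * (B / cmod u) ^+ N) ->
  nm (F u ^+ m - psum (fps_pow z m) N u) <=
  k.+1%:R * (3 * B) ^+ m * (2 * (B / cmod u)) ^+ N.
Proof.
move=> Bu hF; have Bgt0 : 0 < B by have := B1; lra.
have /andP[q0 q1] := ratio_half Bgt0 Bu; set q := B / cmod u in q0 q1 hF *.
have u0 : 0 < cmod u by have := Bgt0; lra.
have FB : nm (F u) <= B.
  by have := hF 0%N; rewrite /psum big_ord0 subr0 expr0 mulr1.
elim: m N => [|m IH] N.
  rewrite !expr0 mulr1; case: N => [|N].
    by rewrite /psum big_ord0 subr0 nm1 expr0 mulr1 ler_nat.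
  rewrite /psum big_ord_recl big1 ?addr0; last first.
    by move=> i _; rewrite /fps_pow /fps_one /= scaler0.
  by rewrite expr0 invr1 scale1r subrr nm0 mulr_ge0// exprn_ge0// mulr_ge0.
rewrite exprS /fps_pow /= -/(fps_pow z m) mul_psum_sub.
have h1 : nm ((F u - psum z N u) * F u ^+ m) <=
    B * (2 * q) ^+ N * (k.+1%:R * (3 * B) ^+ m).
  apply: le_trans (nmM _ _) _; rewrite ler_pM ?nm_ge0//.
    apply: le_trans (hF N) _; rewrite ler_wpM2l// lerXn2r ?nnegrE ?(mulr_ge0 _ q0)//.
    by lra.
  apply: le_trans (nmX _ _) _; rewrite ler_wpM2l// lerXn2r ?nnegrE ?nm_ge0 ?mulr_ge0//.
  by have := B0; have := FB; lra.
have h2 : nm (\sum_(j < N) (u ^- j *: z j) * (F u ^+ m - psum (fps_pow z m) (N - j) u))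
    <= 2 * (B * (2 * q) ^+ N * (k.+1%:R * (3 * B) ^+ m)).
  apply: le_trans (nm_sum _ _ _) _.
  apply: (@le_trans _ _ (\sum_(j < N) (B * (2 * q) ^+ N * (k.+1%:R * (3 * B) ^+ m)) *
      (1 / 2) ^+ j)).
    apply: ler_sum => -[j /= jN] _; apply: le_trans (nmM _ _) _.
    have hj : nm (u ^- j *: z j) <= B * q ^+ j.
      rewrite nmZ cmodXV mulrC /q expr_div_n mulrA ler_wpM2r//.
      by rewrite invr_ge0 exprn_ge0// ltW.
    apply: le_trans (ler_pM (nm_ge0 _) (nm_ge0 _) hj (IH _)) _.
    have e : (2 * q) ^+ N = (2 * q) ^+ j * (2 * q) ^+ (N - j).
      by rewrite -exprD subnKC// ltnW.
    rewrite e [(2 * q) ^+ j]exprMn mul1r exprVn le_eqVlt; apply/orP; left; apply/eqP.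
    by field; rewrite expf_neq0.
  rewrite -mulr_sumr mulrC ler_wpM2r ?half_sum_le//.
  have x0 : 0 <= 2 * q by lra.
  by rewrite !mulr_ge0 ?exprn_ge0 ?x0 ?mulr_ge0.
apply: le_trans (nmD _ _) _; apply: le_trans (lerD h1 h2) _.
by rewrite exprS le_eqVlt; apply/orP; left; apply/eqP; ring.
Qed.

End Powers.

Definition mlogsum k (Z : 'M[C]_k) M : 'M[C]_k :=
  \sum_(1 <= m < M.+1) ((-1) ^+ m.-1 / m%:R) *: Z ^+ m.

Lemma horner_mx_sum k (Z : 'M[C]_k.+1) (p : {poly C}) :
  horner_mx Z p = \sum_(i < size p) p`_i *: Z ^+ i.
Proof.
rewrite -{1}[p]coefK poly_def rmorph_sum; apply: eq_bigr => i _ /=.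
by rewrite linearZ /= rmorphXn /= horner_mx_X.
Qed.

Lemma expp_mlogsum k (Z : 'M[C]_k.+1) M :
  expp (mlogsum Z M) M.+1 = horner_mx Z (explogp R M).
Proof.
have hL : horner_mx Z (logp R M) = mlogsum Z M.
  rewrite /logp rmorph_sum; apply: eq_bigr => i _ /=.
  by rewrite linearZ /= rmorphXn /= horner_mx_X.
rewrite /explogp rmorph_sum; apply: eq_bigr => i _ /=.
by rewrite linearZ /= rmorphXn /= hL.
Qed.

(** The polynomial [explogp - (1 + X)] starts in degree [M.+1] and has
coefficients [O(2 ^+ n)]. *)
Lemma explog_rem k (Z : 'M[C]_k) M (K : R) : (forall N, expsum 1 N <= K) ->
  nm Z <= 1 / 4 ->
  nm (expp (mlogsum Z M) M.+1 - (1 + Z)) <= 2 * (K + 1) * k.+1%:R * (2 * nm Z) ^+ M.+1.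
Proof.
move=> hK Z4; have K0 : 0 <= K.
  by apply: le_trans (hK 0%N); rewrite /expsum big_geq.
have Z0 := nm_ge0 Z.
case: k Z Z4 Z0 => [|k] Z Z4 Z0.
  rewrite [X in nm X]flatmx0 nm0 !mulr_ge0 ?exprn_ge0 ?mulr_ge0//.
  by rewrite addr_ge0.
rewrite expp_mlogsum.
have -> : horner_mx Z (explogp R M) - (1 + Z) = horner_mx Z (explogp R M - (1 + 'X)).
  by rewrite rmorphB rmorphD rmorph1 /= horner_mx_X.
rewrite horner_mx_sum; set p := _ - _.
have p0 i : (i <= M)%N -> p`_i = 0.
  move=> iM; rewrite /p coefB coef_explogp// coefD coef1 coefX.
  by case: i iM => [|[|i]] _; rewrite /= !(mulr0n, mulr1n, addr0, add0r) ?subrr ?oppr0.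
have ple i : cmod p`_i <= (K + 1) * 2 ^+ i.
  rewrite /p coefB; apply: le_trans (cmodB _ _) _.
  rewrite mulrDl lerD ?coef_explogp_le// mul1r coefD coef1 coefX.
  case: i => [|[|i]]; rewrite /= !(mulr0n, mulr1n, addr0, add0r) ?cmod1 ?cmod0 ?expr0 ?exprn_ge0//.
  by rewrite expr1; lra.
apply: le_trans (nm_sum _ _ _) _.
rewrite -(big_mkord xpredT (fun i => nm (p`_i *: Z ^+ i))).
apply: (@le_trans _ _ (\sum_(M.+1 <= i < size p) nm (p`_i *: Z ^+ i))).
  have [sM|Ms] := leqP (size p) M.+1.
    rewrite [leRHS]big_geq// big_nat_cond big1// => i /andP[/andP[_ ip] _].
    by rewrite p0 ?scale0r ?nm0// -ltnS (leq_trans ip).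
  rewrite (@big_cat_nat _ _ _ M.+1)//= ?(ltnW Ms)// big_nat_cond big1 ?add0r//.
  by move=> i /andP[/andP[_ ip] _]; rewrite p0 ?scale0r ?nm0.
apply: (@le_trans _ _ (\sum_(M.+1 <= i < size p) (K + 1) * k.+2%:R * (2 * nm Z) ^+ i)).
  apply: ler_sum => i _; rewrite nmZ exprMn.
  apply: le_trans (ler_pM (cmod_ge0 _) (nm_ge0 _) (ple i) (nmX _ _)) _.
  by rewrite le_eqVlt; apply/orP; left; apply/eqP; ring.
rewrite -mulr_sumr.
have h := @geom_sum_le R (2 * nm Z) M.+1 (size p).
have {}h : \sum_(M.+1 <= m < size p) (2 * nm Z) ^+ m <= 2 * (2 * nm Z) ^+ M.+1.
  by apply: h; lra.
apply: le_trans (ler_wpM2l _ h) _; first by apply: mulr_ge0 => //; exact: addr_ge0.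
by rewrite le_eqVlt; apply/orP; left; apply/eqP; ring.
Qed.

End MatrixLog.

Section GeomLog.
Variables (R : realType) (k : nat).
Local Notation C := (Cplx R).
Implicit Types (F G Z t : C -> 'M[C]_k) (a z : nat -> 'M[C]_k).

Lemma geomI (D E M : R) F a : 0 <= D -> 0 <= E ->
  (forall j, nm (a j) <= D * E ^+ j) ->
  (forall N u, M <= cmod u -> nm (F u - psum a N u) <= D * (E / cmod u) ^+ N) ->
  exists B, geom B F a.
Proof.
move=> D0 E0 ha hF; exists (1 + D + E + `|M|).
set B := 1 + D + E + `|M|; have M0 := normr_ge0 M; have MM := ler_norm M.
have DB : D <= B by rewrite /B; lra.
have EB : E <= B by rewrite /B; lra.
have B0 : 0 <= B := le_trans D0 DB.
split; first by rewrite /B -!addrA lerDl !addr_ge0.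
  by move=> j; apply: le_trans (ha j) _; rewrite ler_pM ?exprn_ge0// lerXn2r ?nnegrE.
move=> N u Bu; have u0 : 0 <= (cmod u)^-1 by rewrite invr_ge0 cmod_ge0.
have Mu : M <= cmod u by apply: le_trans Bu; apply: le_trans MM _; rewrite lerDr !addr_ge0.
apply: le_trans (hF N u Mu) _; rewrite ler_pM ?exprn_ge0 ?mulr_ge0//.
by rewrite lerXn2r ?nnegrE ?mulr_ge0// ler_wpM2r.
Qed.

Definition mlog z : nat -> 'M[C]_k :=
  fun r => \sum_(1 <= m < r.+1) ((-1) ^+ m.-1 / m%:R) *: fps_pow z m r.

Let cmod_logc m : cmod ((-1) ^+ m.-1 / m%:R : C) <= 1.
Proof.
rewrite cmodM cmodX cmodN cmod1 expr1n mul1r cmodV cmod_nat.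
by case: m => [|m]; rewrite ?invr0// invf_le1 ?ltr0n ?ler1n.
Qed.

Lemma psum_mlog z N u : z 0%N = 0 -> psum (mlog z) N u =
  \sum_(1 <= m < N) ((-1) ^+ m.-1 / m%:R) *: psum (fps_pow z m) N u.
Proof.
move=> z0; rewrite -[RHS](eq_bigr _ (fun m _ => psumZ _ _ _ _)) -psum_sum.
rewrite /psum; apply: eq_bigr => -[r /= rN] _; congr (_ *: _).
rewrite /mlog [RHS](@big_cat_nat _ _ _ r.+1)//=.
rewrite [X in _ = _ + X]big_nat_cond [X in _ = _ + X]big1 ?addr0// => m /andP[/andP[rm _] _].
by rewrite fps_pow_low ?scaler0.
Qed.

Lemma nm_mlogsum (Z : 'M[C]_k) M : nm Z <= 1 / 2 -> nm (mlogsum Z M) <= 2 * nm Z.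
Proof.
move=> Z2; apply: le_trans (nm_sum _ _ _) _.
apply: (@le_trans _ _ (\sum_(1 <= m < M.+1) nm Z ^+ m)).
  apply: ler_sum_nat => -[//|m] _; rewrite nmZ; apply: le_trans (nmXn _ _).
  by rewrite ler_piMl ?nm_ge0 ?cmod_logc.
by have := geom_sum_le 1 M.+1 (nm_ge0 Z) Z2; rewrite expr1.
Qed.

(** Cut the logarithmic series of [Z u] off at the order of the expansion.  Its
exponential is close to [1 + Z u], which is the exponential of [t u]; as both
logarithms are small, they are close to each other by [mexp_inj_small]. *)
Lemma geom_log B Z z t : z 0%N = 0 -> geom B Z z ->
  (forall u, B <= cmod u -> mexp (t u) = 1 + Z u /\ nm (t u) <= 1 / 4) ->
  exists B', geom B' t (mlog z).
Proof.
move=> z0 hZ ht; have [B1 hz hZ'] := hZ.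
have B0 : 0 <= B by apply: le_trans B1.
have [K hK] := @expsum_bounded R 1.
have K0 : 0 <= K by apply: le_trans (hK 0%N); rewrite /expsum big_geq.
pose D : R := 1 + 4 * k.+1%:R * (K + 2) + k.+1%:R.
have BB : B <= B ^+ 2 by rewrite expr2 ler_peMl.
have D0 : 0 <= 4 * k.+1%:R * (K + 2).
  by apply: mulr_ge0; [rewrite mulr_ge0|rewrite addr_ge0].
have kD : k.+1%:R <= D by rewrite /D; lra.
have D1 : 1 <= D by rewrite /D; have : 0 <= k.+1%:R :> R := ler0n _ _; lra.
have E0 : 0 <= 12 * B ^+ 2 by lra.
have loglin c N : 0 <= c -> \sum_(1 <= m < N) k.+1%:R * (3 * B) ^+ m * c <=
    k.+1%:R * (6 * B) ^+ N * c.
  move=> c0; rewrite -mulr_suml ler_wpM2r// -mulr_sumr ler_wpM2l//.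
  apply: (@le_trans _ _ (\sum_(1 <= m < N) (3 * B) ^+ N)).
    by apply: ler_sum_nat => m /andP[_ mN]; rewrite ler_weXn2l ?(ltnW mN)//; lra.
  rewrite sumr_const_nat -[leLHS]mulr_natl (_ : 6 * B = 2 * (3 * B)); last by ring.
  rewrite [leRHS]exprMn ler_wpM2r ?exprn_ge0 ?mulr_ge0//.
  by rewrite -natrX ler_nat (leq_trans (leq_subr _ _))// ltnW// ltn_expl.
(* Beyond [8 * B ^+ 2] one has [nm (Z u) <= 1 / 8], hence [nm L <= 1 / 4] below. *)
apply: (@geomI D (12 * B ^+ 2) (8 * B ^+ 2)) => //; first exact: le_trans D1.
  move=> r; apply: le_trans (nm_sum _ _ _) _.
  apply: (@le_trans _ _ (\sum_(1 <= m < r.+1) k.+1%:R * (3 * B) ^+ r * (2 * B) ^+ r)).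
    apply: ler_sum_nat => m /andP[_ mr]; rewrite nmZ.
    apply: (@le_trans _ _ (nm (fps_pow z m r))); first by rewrite ler_piMl ?nm_ge0 ?cmod_logc.
    apply: le_trans (nm_fps_pow B1 hz _ _) _.
    rewrite ler_wpM2r ?exprn_ge0 ?mulr_ge0// ler_wpM2l// ler_weXn2l//; lra.
  rewrite sumr_const_nat subn1 /= -[leLHS]mulr_natl.
  have h2 : r%:R <= 2 ^+ r :> R by rewrite -natrX ler_nat ltnW// ltn_expl.
  have y0 : 0 <= k.+1%:R * (3 * B) ^+ r * (2 * B) ^+ r.
    by rewrite !mulr_ge0 ?exprn_ge0 ?mulr_ge0.
  apply: le_trans (ler_wpM2r y0 h2) _.
  have -> : 2 ^+ r * (k.+1%:R * (3 * B) ^+ r * (2 * B) ^+ r) =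
    k.+1%:R * (12 * B ^+ 2) ^+ r.
    have -> : (12 * B ^+ 2) ^+ r = 2 ^+ r * (3 * B) ^+ r * (2 * B) ^+ r.
      by rewrite -!exprMn; congr (_ ^+ _); ring.
    ring.
  by rewrite ler_wpM2r ?exprn_ge0.
move=> N u Mu; have Bu2 : 2 * B <= cmod u by lra.
have Bu : B <= cmod u by lra.
have u0 : 0 < cmod u by have := B1; lra.
have u0i : 0 <= (cmod u)^-1 by rewrite invr_ge0 ltW.
have [et nt] := ht u Bu.
case: N => [|M].
  by rewrite /psum big_ord0 subr0 expr0 mulr1; lra.
set N := M.+1; set E := (12 * B ^+ 2 / cmod u) ^+ N.
have E00 : 0 <= E by rewrite /E exprn_ge0// mulr_ge0.
have x1 : nm (Z u) <= B ^+ 2 / cmod u.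
  by apply: le_trans (geom_bound1 z0 hZ Bu) _; rewrite expr2 mulrA.
have x8 : nm (Z u) <= 1 / 8.
  by apply: le_trans x1 _; rewrite ler_pdivrMr//; lra.
have xge0 := nm_ge0 (Z u).
pose L := mlogsum (Z u) M.
have L2 : nm L <= 2 * nm (Z u) by apply: nm_mlogsum; lra.
have L4 : nm L <= 1 / 4 by lra.
have xE : (2 * nm (Z u)) ^+ N <= E.
  rewrite lerXn2r ?nnegrE ?mulr_ge0//.
  apply: le_trans (ler_wpM2l _ x1) _ => //; rewrite mulrA ler_wpM2r//; lra.
have n1 : nm (t u - L) <= 4 * k.+1%:R * (K + 2) * E.
  apply: le_trans (mexp_inj_small nt L4) _.
  have L12 : nm L <= 1 / 2 by lra.
  have m1 := mexp_tail N L12.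
  have m2 : nm (Z u) <= 1 / 4 by lra.
  have {}m2 := explog_rem M hK m2; rewrite -/L -/N in m2.
  have m3 : nm L ^+ N <= E.
    by apply: le_trans xE; rewrite lerXn2r ?nnegrE ?nm_ge0 ?mulr_ge0.
  have m4 : nm (mexp (t u) - mexp L) <= 2 * k.+1%:R * E + 2 * (K + 1) * k.+1%:R * E.
    rewrite et; apply: le_trans (nm_dist_trans (expp L N) _ _) _.
    rewrite addrC lerD//.
      rewrite nm_distC; apply: le_trans m1 _; rewrite ler_wpM2l ?mulr_ge0//.
    rewrite nm_distC; apply: le_trans m2 _; rewrite ler_wpM2l//.
    by rewrite !mulr_ge0// addr_ge0.
  have m5 : 2 * nm (mexp (t u) - mexp L) <=
      2 * (2 * k.+1%:R * E + 2 * (K + 1) * k.+1%:R * E) by rewrite ler_wpM2l.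
  apply: le_trans m5 _; rewrite le_eqVlt; apply/orP; left; apply/eqP; ring.
have n2 : nm (L - psum (mlog z) N u) <= k.+1%:R * E.
  rewrite psum_mlog// /L /mlogsum -sumrB; apply: le_trans (nm_sum _ _ _) _.
  pose c := (2 * (B / cmod u)) ^+ N.
  have c0 : 0 <= c by rewrite /c exprn_ge0// !mulr_ge0.
  apply: le_trans (_ : \sum_(1 <= m < N) k.+1%:R * (3 * B) ^+ m * c <= _).
    apply: ler_sum_nat => m _; rewrite -scalerBr nmZ.
    apply: le_trans (geom_pow B1 hz m N Bu2 (fun N => hZ' N u Bu)).
    by rewrite ler_piMl ?nm_ge0 ?cmod_logc.
  apply: le_trans (loglin _ _ c0) _; rewrite -mulrA ler_wpM2l// /c -exprMn /E.
  by rewrite le_eqVlt; apply/orP; left; apply/eqP; congr (_ ^+ _); ring.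
apply: le_trans (nm_dist_trans L _ _) _; apply: le_trans (lerD n1 n2) _.
by rewrite -mulrDl ler_wpM2r// /D; lra.
Qed.

End GeomLog.

(** * Asymptotic expansions and a difference equation *)

Section Asymptotics.
Variables (R : realType) (k : nat).
Local Notation C := (Cplx R).
Implicit Types (F G : C -> 'M[C]_k) (a b : nat -> 'M[C]_k) (H : set C).

(** [asymptotic_expansion] with bounds in the ordered field [R], see [asympP]. *)
Definition asymp H F a : Prop := forall N, exists K M : R, 0 <= K /\
  forall s, H s -> M < cmod s -> nm (F s - psum a N s) <= K / cmod s ^+ N.

Lemma asympP H F a : asymp H F a -> asymptotic_expansion H F a.
Proof.
move=> hF N; have [K [M [K0 hK]]] := hF N; exists K, M => s Hs.
rewrite cmodE ltcR_real => Ms; apply: le_trans (normr_le_nm _) _.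
by rewrite -real_to_CX -real_to_CV -real_to_CM lecR_real; exact: hK.
Qed.

Lemma asymp_ext H F G a :
  (exists M : R, forall s, H s -> M < cmod s -> F s = G s) ->
  asymp H F a -> asymp H G a.
Proof.
move=> [M hM] hF N; have [K [M' [K0 hK]]] := hF N; exists K, (Num.max M M').
by split=> // s Hs; rewrite gt_max => /andP[h1 h2]; rewrite -hM//; exact: hK.
Qed.

Lemma geom_asymp H B F a : geom B F a -> asymp H F a.
Proof.
move=> [B1 ha hF] N; have B0 : 0 <= B by apply: le_trans B1.
exists (B * B ^+ N), B; split; first by rewrite mulr_ge0// exprn_ge0.
move=> s _ Bs; apply: le_trans (hF N s (ltW Bs)) _.
by rewrite expr_div_n mulrA.
Qed.

Lemma asymp_cst H : asymp H (fun=> 1) (@fps_one 'M[C]_k).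
Proof.
move=> [|N].
  exists k%:R, 0; split=> // s _ _.
  by rewrite /psum big_ord0 subr0 nm1 expr0 divr1.
exists 0, 0; split=> // s _ _; rewrite /psum big_ord_recl big1 ?addr0; last first.
  by move=> i _; rewrite /fps_one /= scaler0.
by rewrite /fps_one /= expr0 invr1 scale1r subrr nm0 mul0r.
Qed.

(** The product of two expansions uses those of lower order of one factor. *)
Lemma asymp_uniform H F a N : asymp H F a -> exists K M : R, 0 <= K /\
  forall n s, (n <= N)%N -> H s -> M < cmod s ->
    nm (F s - psum a n s) <= K / cmod s ^+ n.
Proof.
move=> hF; elim: N => [|N [K [M [K0 hK]]]].
  have [K [M [K0 hK]]] := hF 0%N; exists K, M; split=> // n s.
  by rewrite leqn0 => /eqP ->; exact: hK.
have [K' [M' [K'0 hK']]] := hF N.+1; exists (K + K'), (Num.max M M').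
split=> [|n s]; first by rewrite addr_ge0.
rewrite leq_eqVlt => /orP[/eqP ->|nN] Hs; rewrite gt_max => /andP[h1 h2].
  apply: le_trans (hK' s Hs h2) _; rewrite ler_wpM2r ?invr_ge0 ?exprn_ge0 ?cmod_ge0//.
  by rewrite lerDr.
apply: le_trans (hK n s nN Hs h1) _.
by rewrite ler_wpM2r ?invr_ge0 ?exprn_ge0 ?cmod_ge0// lerDl.
Qed.

Lemma asympM H F G a b : asymp H F a -> asymp H G b ->
  asymp H (fun s => F s * G s) (fps_mul a b).
Proof.
move=> hF hG N.
have [K [M [K0 hK]]] := hF N.
have [K' [M' [K'0 hK']]] := asymp_uniform N hG.
pose S := \sum_(j < N) nm (a j).
have S0 : 0 <= S by apply: sumr_ge0 => j _; exact: nm_ge0.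
exists (K * K' + S * K'), (Num.max 0 (Num.max M M')).
split; first by rewrite addr_ge0// mulr_ge0.
move=> s Hs; rewrite !gt_max => /and3P[s0 Ms M's].
have sN0 n : 0 <= (cmod s ^+ n)^-1 by rewrite invr_ge0 exprn_ge0// ltW.
rewrite mul_psum_sub; apply: le_trans (nmD _ _) _; rewrite [leRHS]mulrDl; apply: lerD.
  apply: le_trans (nmM _ _) _; rewrite mulrAC ler_pM ?nm_ge0//; first exact: hK.
  by have := hK' 0%N s (leq0n _) Hs M's; rewrite /psum big_ord0 subr0 expr0 divr1.
apply: le_trans (nm_sum _ _ _) _; rewrite -mulrA mulr_suml; apply: ler_sum => -[j /= jN] _.
apply: le_trans (nmM _ _) _; rewrite nmZ cmodXV [X in X * _]mulrC -mulrA ler_wpM2l ?nm_ge0//.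
apply: le_trans (ler_wpM2l (sN0 j) (hK' (N - j)%N s (leq_subr _ _) Hs M's)) _.
by rewrite mulrCA -invfM -exprD subnKC// ltnW.
Qed.

Lemma asymp_pow H F a m : asymp H F a ->
  asymp H (fun s => F s ^+ m) (fps_pow a m).
Proof.
move=> hF; elim: m => [|m IH].
  by apply: asymp_ext (asymp_cst H); exists 0 => s _ _; rewrite expr0.
have := asympM hF IH; apply: asymp_ext; exists 0 => s _ _.
by rewrite exprS.
Qed.

Definition fpsexp a : nat -> 'M[C]_k :=
  fun r => \sum_(0 <= m < r.+1) (m`!%:R)^-1 *: fps_pow a m r.

Lemma psum_fpsexp a N u : a 0%N = 0 -> psum (fpsexp a) N u =
  \sum_(0 <= m < N) (m`!%:R)^-1 *: psum (fps_pow a m) N u.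
Proof.
move=> a0; rewrite -[RHS](eq_bigr _ (fun m _ => psumZ _ _ _ _)) -psum_sum.
rewrite /psum; apply: eq_bigr => -[r /= rN] _; congr (_ *: _).
rewrite /fpsexp [RHS](@big_cat_nat _ _ _ r.+1)//=.
rewrite [X in _ = _ + X]big_nat_cond [X in _ = _ + X]big1 ?addr0// => m /andP[/andP[rm _] _].
by rewrite fps_pow_low ?scaler0.
Qed.

(** As [F s = O(s^-1)], the terms of the exponential series from degree [N] on are
[O(s ^- N)], and only finitely many powers of the expansion remain. *)
Lemma asymp_mexp H F a : a 0%N = 0 -> asymp H F a ->
  asymp H (fun s => mexp (F s)) (fpsexp a).
Proof.
move=> a0 hF N; have [K1 [M1 [K10 hK1]]] := hF 1%N.
have [K [M [K0 hK]]] : exists K M : R, 0 <= K /\ forall s, H s -> M < cmod s ->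
    nm (expp (F s) N - psum (fpsexp a) N s) <= K / cmod s ^+ N.
  suff h n : exists K M : R, 0 <= K /\ forall s, H s -> M < cmod s ->
      nm (\sum_(0 <= m < n) (m`!%:R)^-1 *: (F s ^+ m - psum (fps_pow a m) N s))
        <= K / cmod s ^+ N.
    have [K [M [K0 hK]]] := h N; exists K, M; split=> // s Hs Ms.
    apply: le_trans (hK s Hs Ms); rewrite psum_fpsexp// /expp -sumrB.
    by under [in leRHS]eq_bigr do rewrite scalerBr.
  elim: n => [|n [K [M [K0 hK]]]].
    by exists 0, 0; split=> // s _ _; rewrite big_geq// nm0 mul0r.
  have [K' [M' [K'0 hK']]] := asymp_pow n hF N.
  exists (K + K'), (Num.max M M'); split; first by rewrite addr_ge0.
  move=> s Hs; rewrite gt_max => /andP[Ms M's]; rewrite big_nat_recr//=.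
  apply: le_trans (nmD _ _) _; rewrite [leRHS]mulrDl lerD ?hK//.
  rewrite nmZ cmod_invfact; apply: le_trans (hK' s Hs M's).
  by rewrite ler_piMl ?nm_ge0// invfact_le1.
exists (2 * k.+1%:R * K1 ^+ N + K), (Num.max (1 + 2 * K1) (Num.max M M1)).
split; first by rewrite addr_ge0// mulr_ge0// exprn_ge0.
move=> s Hs; rewrite !gt_max => /and3P[K1s Ms M1s].
have s0 : 0 < cmod s by lra.
have n1 : nm (F s) <= K1 / cmod s.
  have := hK1 s Hs M1s; rewrite /psum big_ord_recl big_ord0 a0 scaler0 addr0 subr0.
  by rewrite expr1.
have n2 : nm (F s) <= 1 / 2 by apply: le_trans n1 _; rewrite ler_pdivrMr//; lra.
apply: le_trans (nm_dist_trans (expp (F s) N) _ _) _; rewrite [leRHS]mulrDl lerD ?hK//.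
apply: le_trans (mexp_tail N n2) _; rewrite -[leRHS]mulrA ler_wpM2l ?mulr_ge0//.
rewrite -expr_div_n lerXn2r ?nnegrE ?nm_ge0//.
by rewrite divr_ge0// ltW.
Qed.

End Asymptotics.

Section InverseSquares.
Variable R : realType.

(** Telescoping, since [1 / (w + t)^2 <= (1 / w - 1 / (w + t)) / t]. *)
Lemma inv_square_sum (z t : R) p q : 0 < t -> 2 * t <= z ->
  \sum_(p <= i < q) ((z + i%:R * t) ^+ 2)^-1 <= (t * (z + p%:R * t - t))^-1.
Proof.
move=> t0 tz.
have w0 i : 0 < z + i%:R * t - t.
  have : 0 <= i%:R * t by rewrite mulr_ge0// ltW.
  by lra.
have [qp|pq] := leqP q p.
  by rewrite big_geq// invr_ge0 ltW// mulr_gt0.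
suff : \sum_(p <= i < q) ((z + i%:R * t) ^+ 2)^-1 <=
    (t * (z + p%:R * t - t))^-1 - (t * (z + q%:R * t - t))^-1.
  by move=> /le_trans; apply; rewrite gerBl invr_ge0 ltW// mulr_gt0.
rewrite -(subnKC (ltnW pq)); elim: (q - p)%N => [|j IH].
  by rewrite addn0 big_geq// subrr.
rewrite addnS big_nat_recr ?leq_addr//=; apply: le_trans (lerD IH (lexx _)) _.
set i := (p + j)%N; have wi := w0 i.
have -> : z + i.+1%:R * t - t = z + i%:R * t.
  by rewrite -[i.+1%:R]natr1 mulrDl mul1r addrA addrK.
rewrite -addrA lerD2l; set w := z + i%:R * t - t in wi *.
have -> : z + i%:R * t = w + t by rewrite /w subrK.
rewrite addrC lerBlDr [leRHS]addrC.
have wt : 0 < w + t by rewrite addr_gt0.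
have -> : (t * w)^-1 - (t * (w + t))^-1 = (w * (w + t))^-1.
  by field; rewrite !gt_eqF.
rewrite lef_pV2 ?posrE ?mulr_gt0 ?exprn_gt0// expr2 ler_wpM2r ?(ltW wt)//.
by rewrite lerDl ltW.
Qed.

End InverseSquares.

Section DifferenceEquation.
Variables (R : realType) (k : nat).
Local Notation C := (Cplx R).

Let far_real (a r w x y q : R) : 0 <= q -> 2 * a <= r -> - a <= x ->
  r ^+ 2 = x ^+ 2 + y ^+ 2 -> w ^+ 2 = (x + q) ^+ 2 + y ^+ 2 ->
  (r + q) ^+ 2 <= 2 ^+ 2 * w ^+ 2.
Proof.
move=> q0 ar xa rE wE; have h1 : - (r * q) <= 2 * (x * q) by nra.
have h2 := sqr_ge0 (r - q).
have -> : 2 ^+ 2 = 4 :> R by rewrite -natrX.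
by rewrite wE; lra.
Qed.

(** As [Re (s / tau)] is bounded below, adding a positive multiple of [tau] cancels
only a bounded part of [s]. *)
Lemma halfplane_far (tau s : C) (m : R) p : tau != 0 ->
  m < complex.Re (s / tau : C) -> 2 * `|m| * cmod tau <= cmod s ->
  cmod s + p%:R * cmod tau <= 2 * cmod (s + p%:R * tau).
Proof.
move=> tau0 ms sbig; have t0 : 0 < cmod tau by rewrite cmod_gt0.
pose z := s / tau; have sE : s = z * tau by rewrite /z divfK.
have rbig : 2 * `|m| <= cmod z.
  by rewrite -(ler_pM2r t0) -cmodM -sE.
rewrite {2}sE -mulrDl [in leRHS]cmodM {1}sE cmodM -mulrDl mulrA ler_wpM2r ?(ltW t0)//.
have z0 := cmod_ge0 z; have w0 := cmod_ge0 (z + p%:R).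
have p0 : 0 <= p%:R :> R := ler0n _ _.
rewrite -(@ler_pXn2r _ 2) ?nnegrE ?addr_ge0 ?mulr_ge0// exprMn.
apply: (@far_real `|m| _ _ (complex.Re z) (complex.Im z)) => //.
- by apply: le_trans (ltW ms); rewrite lerNl -normrN ler_norm.
- exact: cmod_sqr.
- have -> : p%:R = real_to_C p%:R :> C by rewrite real_to_CMn.
  by rewrite cmod_sqr; case: (z) => x y /=; rewrite addr0.
Qed.

Lemma geom_trunc (phi : nat -> 'M[C]_k) N : exists B,
  geom B (psum phi N) (fun j => if (j < N)%N then phi j else 0).
Proof.
pose B : R := 1 + \sum_(j < N) nm (phi j).
have S0 : 0 <= \sum_(j < N) nm (phi j) by apply: sumr_ge0 => j _; exact: nm_ge0.
have B1 : 1 <= B by rewrite lerDl.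
exists (2 * B); apply: geom_limn => //.
  move=> j; case: ltnP => jN; last by rewrite nm0 mulr_ge0 ?exprn_ge0// (le_trans ler01).
  apply: (@le_trans _ _ B).
    rewrite /B (bigD1 (Ordinal jN)) //= addrCA lerDl addr_ge0//.
    by apply: sumr_ge0 => i _; exact: nm_ge0.
  by rewrite ler_peMr ?(le_trans ler01)// exprn_ege1.
move=> u _; apply: (@mcvg_eventually _ _ _ (fun=> psum phi N u) _ _ N); last exact: mcvg_cst.
move=> p Np; rewrite -[LHS]addr0.
rewrite -(subnKC Np) /psum big_split_ord /=; congr (_ + _).
  by apply: eq_bigr => j _; rewrite ltn_ord.
rewrite big1// => j _; rewrite ltnNge leq_addr scaler0//.
Qed.

Variables (tau : C) (m : R) (L : C -> 'M[C]_k) (l phi : nat -> 'M[C]_k) (B : R).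
Hypotheses (tau0 : tau != 0) (hL : geom B L l) (phi0 : phi 0%N = 0).
Hypothesis diffeq : forall p, mshift tau phi p - phi p = l p.

Let t := cmod tau.
Let t0 : 0 < t. Proof. by rewrite /t cmod_gt0. Qed.
Let B1 : 1 <= B. Proof. by case: hL. Qed.

(** In the limit, the solution [f (s) = - \sum_(p >= 0) L (s + p tau)] of the
difference equation [f (s + tau) - f (s) = L (s)]. *)
Definition shifted_sum (s : C) P : 'M[C]_k := - \sum_(0 <= p < P) L (s + p%:R * tau).

Lemma mshift_sub (c : C) (a : nat -> 'M[C]_k) p :
  mshift c a p - a p = \sum_(j < p) shiftc c p j *: a j.
Proof.
rewrite /mshift big_ord_recr /= {2}/shiftc subnn bin0 !expr0 !mulr1 scale1r.
by rewrite addrK.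
Qed.

(** A difference [mshift tau phi - phi] with [phi 0 = 0] starts in degree two. *)
Let L_decay u : B <= cmod u -> nm (L u) <= B ^+ 3 / cmod u ^+ 2.
Proof.
move=> Bu; have [_ _ /(_ 2%N u Bu)] := hL.
have l0 : l 0%N = 0 by rewrite -diffeq mshift_sub big_ord0.
have l1 : l 1%N = 0.
  by rewrite -diffeq mshift_sub big_ord1 phi0 scaler0.
rewrite /psum !big_ord_recl big_ord0 /= l0 /bump /= addn0 l1 !scaler0 !addr0 subr0.
by rewrite expr_div_n mulrA -exprS.
Qed.

Let M0 : R := Num.max (2 * B) (Num.max (2 * t) (2 * `|m| * t)).

Lemma shifted_far s p : m < complex.Re (s / tau : C) -> M0 < cmod s ->
  [/\ 2 * t <= cmod s, B <= cmod (s + p%:R * tau) &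
      cmod s + p%:R * t <= 2 * cmod (s + p%:R * tau)].
Proof.
move=> ms; rewrite /M0 !gt_max => /and3P[/ltW h1 /ltW h2 /ltW h3].
have h4 := halfplane_far p tau0 ms h3.
split=> //; have : 0 <= p%:R * t by rewrite mulr_ge0// ltW.
by move: h4; rewrite -/t; lra.
Qed.

Let inv_far (n : nat) (s : C) p : m < complex.Re (s / tau : C) -> M0 < cmod s ->
  (cmod (s + p%:R * tau) ^+ n)^-1 <= 2 ^+ n / (cmod s + p%:R * t) ^+ n.
Proof.
move=> ms Ms; have [h1 h2 h3] := shifted_far p ms Ms.
have z0 : 0 < cmod s + p%:R * t.
  have : 0 <= p%:R * t by rewrite mulr_ge0// ltW.
  by have := t0; lra.
have w0 : 0 < cmod (s + p%:R * tau) by lra.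
rewrite -exprVn -expr_div_n lerXn2r ?nnegrE ?invr_ge0 ?divr_ge0 ?(ltW z0) ?(ltW w0)//.
by rewrite ler_pdivlMr// mulrC ler_pdivrMr.
Qed.

Lemma shifted_sum_cvg s : m < complex.Re (s / tau : C) -> M0 < cmod s ->
  mcvg (shifted_sum s) (limn (shifted_sum s)).
Proof.
move=> ms Ms.
suff [f hf] : exists f, mcvg (shifted_sum s) f by rewrite (mcvg_limn hf).
have [h1 _ _] := shifted_far 0 ms Ms.
apply: mcvg_cauchy => e e0; pose D := 4 * B ^+ 3 / t ^+ 2 / e.
have B30 : 0 <= 4 * B ^+ 3 by rewrite mulr_ge0 ?exprn_ge0// (le_trans ler01 B1).
exists (Num.truncn D).+1 => p q Dp pq.
have Dp' : D <= p%:R.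
  by apply: le_trans (ltW (truncnS_gt _)) _; rewrite ler_nat.
have p0 : 0 < p%:R :> R by rewrite ltr0n (leq_trans _ Dp).
have -> : shifted_sum s q - shifted_sum s p = - \sum_(p <= i < q) L (s + i%:R * tau).
  by rewrite /shifted_sum (@big_cat_nat _ _ _ p)//= opprD opprK addrAC addNr add0r.
rewrite nmN; apply: le_trans (nm_sum _ _ _) _.
apply: (@le_trans _ _ (\sum_(p <= i < q) 4 * B ^+ 3 * ((cmod s + i%:R * t) ^+ 2)^-1)).
  apply: ler_sum => i _; have [_ hB _] := shifted_far i ms Ms.
  apply: le_trans (L_decay hB) _; rewrite (mulrC 4) -[leRHS]mulrA ler_wpM2l//.
    by rewrite exprn_ge0// (le_trans ler01 B1).
  by apply: le_trans (inv_far 2 i ms Ms) _; rewrite (_ : 2 ^+ 2 = 4) -?natrX.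
rewrite -mulr_sumr; apply: le_trans (ler_wpM2l B30 (inv_square_sum p q t0 h1)) _.
have w0 : p%:R * t <= cmod s + p%:R * t - t by have := t0; lra.
have pt0 : 0 < p%:R * t by rewrite mulr_gt0.
apply: (@le_trans _ _ (4 * B ^+ 3 / (t * (p%:R * t)))).
  have w1 := lt_le_trans pt0 w0.
  rewrite ler_wpM2l// lef_pV2 ?posrE ?mulr_gt0// ler_wpM2l//.
  exact: ltW.
rewrite ler_pdivrMr ?mulr_gt0//.
move: Dp'; rewrite /D ler_pdivrMr// ler_pdivrMr ?exprn_gt0// => /le_trans; apply.
by rewrite le_eqVlt; apply/orP; left; apply/eqP; ring.
Qed.

(** The truncation [psum phi N] satisfies the difference equation up to
[O(s ^- N.+1)]; summing these errors along [s + p tau] loses one power. *)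
Lemma shifted_sum_asymp :
  asymp [set s : C | m < complex.Re (s / tau : C)]
    (fun s => limn (shifted_sum s)) phi.
Proof.
suff step N : exists K M : R, 0 <= K /\ forall s : C, m < complex.Re (s / tau : C) ->
    M < cmod s -> nm (limn (shifted_sum s) - psum phi N.+1 s) <= K / cmod s ^+ N.+1.
  move=> [|N]; last exact: step.
  have [K [M [K0 hK]]] := step 0%N; exists K, (Num.max 1 M); split=> // s ms.
  rewrite gt_max => /andP[s1 Ms]; have := hK s ms Ms.
  rewrite /psum big_ord_recl !big_ord0 phi0 scaler0 addr0 => /le_trans; apply.
  by rewrite expr1 expr0 ler_wpM2l// invr1 invf_le1 ?(ltW s1)// (lt_trans ltr01).
have [B2 hG] := geom_trunc phi N.+1.
set phiN := (fun j => _) in hG; set G := psum phi N.+1 in hG *.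
have [B3 hh] : exists B3, geom B3 (fun u => G (u + tau) - G u - L u)
    (fun p => mshift tau phiN p - phiN p - l p).
  have g1 := geom_shift (lexx t) hG.
  have [b2 g2] := geomZ (-1) hG; have [b3 g3] := geomZ (-1) hL.
  pose b := Num.max (8 * (B2 + t)) (Num.max b2 b3).
  have e1 : 8 * (B2 + t) <= b by rewrite /b le_max lexx.
  have e2 : b2 <= b by rewrite /b !le_max lexx orbT.
  have e3 : b3 <= 2 * b.
    have : b3 <= b by rewrite /b !le_max lexx !orbT.
    by have [b31 _ _] := g3; lra.
  have := geomD (geomD (geom_mono e1 g1) (geom_mono e2 g2)) (geom_mono e3 g3) => h.
  exists (2 * (2 * b)); move: h; congr (geom _ _ _).
    by apply/funext => u; rewrite !scaleN1r.
  by apply/funext => p; rewrite !scaleN1r.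
have [B31 _ hE] := hh.
have B30 : 0 <= B3 by apply: le_trans B31.
have vanish p : (p <= N.+1)%N -> mshift tau phiN p - phiN p - l p = 0.
  move=> pN; rewrite -diffeq !mshift_sub -sumrB big1// => j _.
  by rewrite /phiN (leq_trans (ltn_ord j)) ?subrr.
have h_decay u : B3 <= cmod u -> nm (G (u + tau) - G u - L u) <=
    B3 ^+ N.+3 / cmod u ^+ N.+2.
  move=> Bu; have := hE N.+2 u Bu.
  rewrite /psum big1 ?subr0; last first.
    by move=> [j /= jN] _; rewrite vanish ?scaler0.
  by rewrite expr_div_n mulrA -exprS.
pose E := B3 ^+ N.+3 * 2 ^+ N.+2.
have E0 : 0 <= E by rewrite mulr_ge0 ?exprn_ge0.
exists (E * 2 / t), (Num.max M0 (2 * B3)).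
split; first exact: divr_ge0 (mulr_ge0 E0 (ler0n _ 2)) (ltW t0).
move=> s ms; rewrite gt_max => /andP[Ms /ltW B3s].
have [h1 _ _] := shifted_far 0 ms Ms; set z := cmod s in h1 B3s *.
have z0 : 0 < z by have := t0; lra.
have far p : B3 <= cmod (s + p%:R * tau).
  have [_ _ h3] := shifted_far p ms Ms.
  have : 0 <= p%:R * t by rewrite mulr_ge0// ltW.
  by move: h3; rewrite -/z; lra.
have tele P : shifted_sum s P - G s = - G (s + P%:R * tau) +
    \sum_(0 <= p < P) (G (s + p%:R * tau + tau) - G (s + p%:R * tau) - L (s + p%:R * tau)).
  elim: P => [|P IH].
    by rewrite /shifted_sum !big_geq// mul0r addr0 oppr0 add0r addr0.
  rewrite /shifted_sum !big_nat_recr//= opprD addrAC -/(shifted_sum s P) IH.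
  have -> : s + P%:R * tau + tau = s + P.+1%:R * tau.
    by rewrite -[P.+1%:R]natr1 mulrDl mul1r addrA.
  move: (\sum_(_ <= _ < _) _) (G _) (G _) (L _) => a b c d.
  by apply/matrixP => i j; rewrite !mxE; ring.
have sumh P : nm (\sum_(0 <= p < P) (G (s + p%:R * tau + tau) - G (s + p%:R * tau) -
    L (s + p%:R * tau))) <= E * 2 / t / z ^+ N.+1.
  apply: le_trans (nm_sum _ _ _) _.
  apply: (@le_trans _ _ (\sum_(0 <= p < P) E / z ^+ N * ((z + p%:R * t) ^+ 2)^-1)).
    apply: ler_sum => p _; apply: le_trans (h_decay _ (far p)) _.
    apply: le_trans (ler_wpM2l _ (inv_far N.+2 p ms Ms)) _; first by rewrite exprn_ge0.
    rewrite mulrA -/E -/z -mulrA ler_wpM2l// -invfM.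
    have pt : 0 <= p%:R * t by rewrite mulr_ge0// ltW.
    have zp : 0 < z + p%:R * t by lra.
    have e : (z + p%:R * t) ^+ N.+2 = (z + p%:R * t) ^+ N * (z + p%:R * t) ^+ 2.
      by rewrite -exprD addn2.
    rewrite e lef_pV2 ?posrE; [|exact: mulr_gt0 (exprn_gt0 _ _) (exprn_gt0 _ _)..].
    rewrite ler_wpM2r ?exprn_ge0 ?(ltW zp)// lerXn2r ?nnegrE ?(ltW z0) ?(ltW zp)//.
    by rewrite lerDl.
  rewrite -mulr_sumr.
  apply: le_trans (ler_wpM2l _ (inv_square_sum 0 P t0 h1)) _.
    by rewrite divr_ge0 ?exprn_ge0 ?(ltW z0).
  rewrite mul0r addr0.
  have -> : E * 2 / t / z ^+ N.+1 = E / z ^+ N * (2 / (t * z)).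
    by rewrite exprS; field; rewrite expf_neq0 !gt_eqF.
  rewrite ler_wpM2l ?divr_ge0 ?exprn_ge0 ?(ltW z0)//.
  rewrite ler_pdivlMr ?mulr_gt0// mulrC ler_pdivrMr ?mulr_gt0//; last by have := t0; lra.
  have := ler_wpM2l (ltW t0) h1; lra.
apply/ler_addgt0Pr => e e0.
apply: (mcvg_le (shifted_sum_cvg ms Ms)).
have B20 : 0 < B2 by case: hG => B21 _ _; rewrite (lt_le_trans ltr01).
exists (Num.truncn (2 * (B2 + B2 ^+ 2 / e) / t)).+1 => P hP.
have hP' : 2 * (B2 + B2 ^+ 2 / e) / t <= P%:R.
  by apply: le_trans (ltW (truncnS_gt _)) _; rewrite ler_nat.
rewrite tele; apply: le_trans (nmD _ _) _; rewrite addrC lerD// nmN.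
move: hP'; rewrite ler_pdivrMr// => hP'.
have [_ _ h3] := shifted_far P ms Ms; rewrite -/z in h3.
have Be : 0 <= B2 ^+ 2 / e by rewrite divr_ge0 ?exprn_ge0 ?(ltW B20) ?(ltW e0).
have hw : B2 + B2 ^+ 2 / e <= cmod (s + P%:R * tau) by lra.
have w0 : 0 < cmod (s + P%:R * tau) by lra.
have hw2 : B2 <= cmod (s + P%:R * tau) by lra.
apply: le_trans (geom_bound1 _ hG hw2) _; first by rewrite /phiN /= phi0.
rewrite mulrA -expr2 ler_pdivrMr// mulrC -ler_pdivrMr//.
by apply: le_trans hw; rewrite lerDr ltW.
Qed.

End DifferenceEquation.

(** * Contour integrals over circles *)

Section CircleScalar.
Variable R : realType.
Local Notation C := (Cplx R).
Implicit Types (f g : C -> C) (rho : R).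

Definition vcirc rho (x : R) : C := (rho * cos x +i* (rho * sin x))%C.

Lemma cmod_vcirc rho x : 0 <= rho -> cmod (vcirc rho x) = rho.
Proof.
move=> r0; apply/eqP; rewrite -(@eqrXn2 _ 2) ?cmod_ge0// cmod_sqr /=.
by rewrite !exprMn -mulrDr cos2Dsin2 mulr1.
Qed.

Definition ccont rho f := continuous (fun x : R => f (vcirc rho x)).

Lemma continuous_cplx (h : R -> C) :
  (forall x (e : R), 0 < e -> exists2 d : R, 0 < d &
     forall y, `|x - y| < d -> cmod (h x - h y) <= e) ->
  continuous h.
Proof.
move=> hh x; apply/cvgrPdist_le => e /pos_complex[r r0 ->].
have [d d0 hd] := hh x r r0; apply/nbhs_ballP; exists d => // y.
by rewrite /ball /= => /hd; rewrite cmodE lecR_real.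
Qed.

Lemma cplx_continuousE (h : R -> C) x (e : R) : continuous h -> 0 < e ->
  \forall y \near x, cmod (h x - h y) <= e.
Proof.
move=> ch e0; have /cvgrPdist_le/(_ (real_to_C e)) := ch x.
rewrite -real_to_C0 ltcR_real => /(_ e0).
by apply: filterS => y; rewrite cmodE lecR_real.
Qed.

Lemma continuous_Re (h : R -> C) : continuous h ->
  continuous (fun x => complex.Re (h x) : R^o).
Proof.
move=> ch x; apply/cvgrPdist_le => e e0.
apply: filterS (cplx_continuousE x ch e0) => y; apply: le_trans.
apply: le_trans (Re_le_cmod _).
by case: (h x) (h y) => ? ? [? ?].
Qed.

Lemma continuous_Im (h : R -> C) : continuous h ->
  continuous (fun x => complex.Im (h x) : R^o).
Proof.
move=> ch x; apply/cvgrPdist_le => e e0.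
apply: filterS (cplx_continuousE x ch e0) => y; apply: le_trans.
apply: le_trans (Im_le_cmod _).
by case: (h x) (h y) => ? ? [? ?].
Qed.

Lemma continuous_ReIm (a b : R -> R) : continuous (a : R -> R^o) ->
  continuous (b : R -> R^o) ->
  continuous (fun x => (a x +i* b x)%C : C).
Proof.
move=> ca cb x; apply/cvgrPdist_le => e /pos_complex[r r0 ->].
have r20 : 0 < r / 2 by rewrite divr_gt0.
have /cvgrPdist_le/(_ _ r20) h1 := ca x; have /cvgrPdist_le/(_ _ r20) h2 := cb x.
apply: filterS2 h1 h2 => y h1 h2; rewrite cmodE lecR_real.
by apply: le_trans (cmod_le_ReIm _) _; rewrite /= (splitr r) lerD.
Qed.

Lemma ccont_id rho : ccont rho id.
Proof.
apply: continuous_ReIm => x.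
  by apply: (@cvgM _ _ _ _ _ _ rho (cos x)); [exact: cvg_cst|exact: continuous_cos].
by apply: (@cvgM _ _ _ _ _ _ rho (sin x)); [exact: cvg_cst|exact: continuous_sin].
Qed.

Lemma ccont_cst rho (c : C) : ccont rho (fun=> c).
Proof. by move=> x; exact: cvg_cst. Qed.

Lemma ccontD rho f g : ccont rho f -> ccont rho g -> ccont rho (fun v => f v + g v).
Proof. by move=> cf cg x; apply: cvgD; [exact: cf|exact: cg]. Qed.

Lemma ccontM rho f g : ccont rho f -> ccont rho g -> ccont rho (fun v => f v * g v).
Proof. by move=> cf cg x; apply: cvgM; [exact: cf|exact: cg]. Qed.

Lemma ccontX rho f n : ccont rho f -> ccont rho (fun v => f v ^+ n).
Proof.
move=> cf; elim: n => [|n IH].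
  by under eq_fun do rewrite expr0; exact: ccont_cst.
by under eq_fun do rewrite exprS; exact: (ccontM cf IH).
Qed.

Lemma ccont_sum rho I (r : seq I) (P : pred I) (F : I -> C -> C) :
  (forall i, P i -> ccont rho (F i)) -> ccont rho (fun v => \sum_(i <- r | P i) F i v).
Proof.
move=> hF; elim: r => [|i r IH].
  by under eq_fun do rewrite big_nil; exact: ccont_cst.
have [Pi|Pi] := boolP (P i).
  by under eq_fun do rewrite big_cons Pi; exact: (ccontD (hF _ Pi) IH).
by under eq_fun do rewrite big_cons (negbTE Pi).
Qed.

Local Notation mu := (@lebesgue_measure R).
Local Notation I2pi := (`[0, 2 * pi]%classic : set R).

Let integrable_cont (h : R -> R^o) : continuous h -> mu.-integrable I2pi (EFin \o h).
Proof.
move=> ch; apply: continuous_compact_integrable; first exact: segment_compact.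
exact: continuous_subspaceT.
Qed.

Let IntD (f g : R -> R^o) : continuous f -> continuous g ->
  \int[mu]_(x in I2pi) (f x + g x) = \int[mu]_(x in I2pi) f x + \int[mu]_(x in I2pi) g x.
Proof. by move=> cf cg; rewrite RintegralD//; exact: integrable_cont. Qed.

Let IntB (f g : R -> R^o) : continuous f -> continuous g ->
  \int[mu]_(x in I2pi) (f x - g x) = \int[mu]_(x in I2pi) f x - \int[mu]_(x in I2pi) g x.
Proof. by move=> cf cg; rewrite RintegralB//; exact: integrable_cont. Qed.

Let IntZ (r : R) (f : R -> R^o) : continuous f ->
  \int[mu]_(x in I2pi) (r * f x) = r * \int[mu]_(x in I2pi) f x.
Proof. by move=> cf; rewrite RintegralZl//; exact: integrable_cont. Qed.

Let continuousZ (r : R) (f : R -> R^o) : continuous f ->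
  continuous (fun x => r * f x : R^o).
Proof. by move=> cf x; apply: cvgM; [exact: cvg_cst|exact: cf]. Qed.

Definition Ci rho f : C :=
  real_to_C (2 * pi)^-1 *
    Cintegral 0 (2 * pi) (fun x => f (vcirc rho x) * vcirc rho x).

Let twopi_gt0 : 0 < 2 * pi :> R. Proof. by rewrite mulr_gt0// pi_gt0. Qed.

Let CintegralD (h1 h2 : R -> C) : continuous h1 -> continuous h2 ->
  Cintegral 0 (2 * pi) (fun x => h1 x + h2 x) =
  Cintegral 0 (2 * pi) h1 + Cintegral 0 (2 * pi) h2.
Proof.
move=> c1 c2; rewrite /Cintegral; apply/eqP; rewrite eq_complex /=.
rewrite -(IntD (continuous_Re c1) (continuous_Re c2)).
rewrite -(IntD (continuous_Im c1) (continuous_Im c2)).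
apply/andP; split; apply/eqP; congr (fine _); apply: eq_integral => x _ /=.
  by case: (h1 x) (h2 x) => ? ? [].
by case: (h1 x) (h2 x) => ? ? [].
Qed.

Let CintegralZ (c : C) (h : R -> C) : continuous h ->
  Cintegral 0 (2 * pi) (fun x => c * h x) = c * Cintegral 0 (2 * pi) h.
Proof.
move=> ch; rewrite /Cintegral; apply/eqP; rewrite eq_complex /=.
have cR := continuous_Re ch; have cI := continuous_Im ch.
case: c => a b /=.
rewrite -(IntZ a cR) -(IntZ b cI) -(IntZ a cI) -(IntZ b cR).
rewrite -(IntB (continuousZ (r := a) cR) (continuousZ (r := b) cI)).
rewrite -(IntD (continuousZ (r := a) cI) (continuousZ (r := b) cR)).
by apply/andP; split; apply/eqP; congr (fine _); apply: eq_integral => x _ /=;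
  case: (h x).
Qed.

Let ccont_integrand rho f : ccont rho f ->
  continuous (fun x => f (vcirc rho x) * vcirc rho x : C).
Proof.
move=> cf; have h : ccont rho (fun v => f v * v).
  by apply: (ccontM cf); exact: ccont_id.
exact: h.
Qed.

Lemma CiD rho f g : ccont rho f -> ccont rho g ->
  Ci rho (fun v => f v + g v) = Ci rho f + Ci rho g.
Proof.
move=> cf cg.
rewrite /Ci -mulrDr -(CintegralD (ccont_integrand cf) (ccont_integrand cg)).
by congr (_ * Cintegral _ _ _); apply/funext => x; rewrite mulrDl.
Qed.

Lemma CiZ rho c f : ccont rho f -> Ci rho (fun v => c * f v) = c * Ci rho f.
Proof.
move=> cf; rewrite /Ci mulrCA -(CintegralZ c (ccont_integrand cf)).
by congr (_ * Cintegral _ _ _); apply/funext => x; rewrite mulrA.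
Qed.

Lemma Ci_sum rho I (r : seq I) (P : pred I) (F : I -> C -> C) :
  (forall i, P i -> ccont rho (F i)) ->
  Ci rho (fun v => \sum_(i <- r | P i) F i v) = \sum_(i <- r | P i) Ci rho (F i).
Proof.
move=> hF; elim: r => [|i r IH].
  rewrite big_nil; under eq_fun do rewrite big_nil -[0](mul0r 0).
  by rewrite (CiZ 0 (@ccont_cst rho 0)) mul0r.
rewrite big_cons; case: ifPn => Pi.
  under eq_fun do rewrite big_cons Pi.
  by rewrite CiD ?IH//; [exact: hF|exact: ccont_sum].
by under eq_fun do rewrite big_cons (negbTE Pi).
Qed.

Let Rint_bound (h : R -> R^o) (e : R) : continuous h -> (forall x, `|h x| <= e) ->
  `|\int[mu]_(x in I2pi) h x| <= 2 * pi * e.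
Proof.
move=> ch he; have ih := integrable_cont ch.
apply: (@le_trans _ _ (\int[mu]_(x in I2pi) `|h x|)).
  exact: le_normr_Rintegral.
have e0 : \int[mu]_(x in I2pi) e = 2 * pi * e.
  have muI : mu `[0, 2 * pi]%classic = (2 * pi)%:E.
    by rewrite lebesgue_measure_itv /= lte_fin twopi_gt0 oppr0 addr0.
  by rewrite Rintegral_cst//= muI mulrC.
rewrite -e0; apply: le_Rintegral => //.
  apply: integrable_cont => x; apply: cvg_norm; exact: ch.
by apply: integrable_cont => x; exact: cvg_cst.
Qed.

Lemma Ci_bound rho f (e : R) : 0 <= rho -> ccont rho f ->
  (forall v, cmod v = rho -> cmod (f v) <= e) -> cmod (Ci rho f) <= 2 * rho * e.
Proof.
move=> r0 cf fe; rewrite /Ci cmodM cmod_real gtr0_norm ?invr_gt0//.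
have ch := ccont_integrand cf.
have he x : cmod (f (vcirc rho x) * vcirc rho x) <= rho * e.
  by rewrite cmodM cmod_vcirc// mulrC ler_wpM2l// fe// cmod_vcirc.
rewrite ler_pdivrMl//; apply: le_trans (cmod_le_ReIm _) _; rewrite /Cintegral /=.
have h1 := Rint_bound (continuous_Re ch) (fun x => le_trans (Re_le_cmod _) (he x)).
have h2 := Rint_bound (continuous_Im ch) (fun x => le_trans (Im_le_cmod _) (he x)).
by apply: le_trans (lerD h1 h2) _; rewrite le_eqVlt; apply/orP; left; apply/eqP; ring.
Qed.

End CircleScalar.

Section CirclePowers.
Variable R : realType.
Local Notation C := (Cplx R).
Implicit Types (rho : R).
Local Notation mu := (@lebesgue_measure R).

Lemma vcircM r r' (x y : R) : vcirc r x * vcirc r' y = vcirc (r * r') (x + y).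
Proof.
rewrite /vcirc cosD sinD; apply/eqP; rewrite eq_complex /=.
by apply/andP; split; apply/eqP; ring.
Qed.

Lemma vcircX r (x : R) m : vcirc r x ^+ m = vcirc (r ^+ m) (m%:R * x).
Proof.
elim: m => [|m IH].
  by rewrite !expr0 mul0r /vcirc cos0 sin0 mulr1 mulr0.
by rewrite exprS IH vcircM -exprS -[m.+1%:R]natr1 mulrDl mul1r addrC.
Qed.

Lemma vcircV r (x : R) : r != 0 -> (vcirc r x)^-1 = vcirc r^-1 (- x).
Proof.
move=> r0; have h : vcirc r x * vcirc r^-1 (- x) = 1.
  by rewrite vcircM divff// subrr /vcirc cos0 sin0 mulr1 mulr0.
have nz : vcirc r x != 0.
  apply/eqP => v0; move: h; rewrite v0 mul0r => /esym/eqP.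
  by rewrite oner_eq0.
by apply: (mulfI nz); rewrite h divff.
Qed.

Let ftc (f F : R -> R) : continuous (f : R -> R^o) ->
  (forall x : R, is_derive x 1 F (f x)) ->
  \int[mu]_(x in `[0, 2 * pi]) f x = F (2 * pi) - F 0.
Proof.
move=> cf dF; rewrite /Rintegral.
have pi0 : 0 < 2 * pi :> R by rewrite mulr_gt0// pi_gt0.
have cF : continuous F.
  by move=> x; apply: differentiable_continuous; apply/derivable1_diffP; case: (dF x).
rewrite (@continuous_FTC2 _ f F 0 (2 * pi) pi0) //.
- exact: continuous_subspaceT.
- split.
  + by move=> x _; case: (dF x).
  + by apply: cvg_at_right_filter; exact: cF.
  + by apply: cvg_at_left_filter; exact: cF.
- by move=> x _; rewrite derive1E; case: (dF x).
Qed.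

Let is_derive_lin (c x : R) : is_derive x 1 (fun y : R => c * y) c.
Proof.
have -> : (fun y : R => c * y) = (cst c * id)%R by apply/funext.
apply: is_derive_eq; rewrite /GRing.scale /= mulr1 mulr0 addr0//.
Qed.

Let continuous_lin (c : R) : continuous (fun y : R => c * y : R^o).
Proof.
by move=> x; apply: (@cvgM _ _ _ _ _ _ c x); [exact: cvg_cst|exact: cvg_id].
Qed.

Let continuous_rcos (r c : R) : continuous (fun x : R => r * cos (c * x) : R^o).
Proof.
move=> x; apply: (@cvgM _ _ _ _ _ _ r (cos (c * x))); first exact: cvg_cst.
by apply: continuous_comp; [exact: continuous_lin|exact: continuous_cos].
Qed.

Let continuous_rsin (r c : R) : continuous (fun x : R => r * sin (c * x) : R^o).
Proof.
move=> x; apply: (@cvgM _ _ _ _ _ _ r (sin (c * x))); first exact: cvg_cst.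
by apply: continuous_comp; [exact: continuous_lin|exact: continuous_sin].
Qed.

Lemma Cintegral_vcirc r (c : R) : c != 0 -> sin (c * (2 * pi)) = 0 ->
  cos (c * (2 * pi)) = 1 ->
  Cintegral 0 (2 * pi) (fun x => vcirc r (c * x)) = 0.
Proof.
move=> c0 s0 c1; rewrite /Cintegral; apply/eqP; rewrite eq_complex /=.
have dsin (x : R) : is_derive x 1 (fun x : R => r / c * sin (c * x)) (r * cos (c * x)).
  have h := is_derive1_comp (is_derive_sin (c * x)) (is_derive_lin c x).
  have h2 := is_derive1_comp (is_derive_lin (r / c) (sin (c * x))) h.
  have e : r / c * (cos (c * x) * c) = r * cos (c * x) by field.
  exact: (is_derive_eq h2 e).
have dcos (x : R) : is_derive x 1 (fun x : R => - (r / c) * cos (c * x)) (r * sin (c * x)).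
  have h := is_derive1_comp (is_derive_cos (c * x)) (is_derive_lin c x).
  have h2 := is_derive1_comp (is_derive_lin (- (r / c)) (cos (c * x))) h.
  have e : - (r / c) * (- sin (c * x) * c) = r * sin (c * x) by field.
  exact: (is_derive_eq h2 e).
apply/andP; split; apply/eqP.
  by rewrite (ftc (@continuous_rcos r c) dsin) s0 !mulr0 sin0 mulr0 subrr.
by rewrite (ftc (@continuous_rsin r c) dcos) c1 mulr0 cos0 subrr.
Qed.

Let trig_period m : sin (m%:R * (2 * pi)) = 0 :> R /\ cos (m%:R * (2 * pi)) = 1 :> R.
Proof.
elim: m => [|m [h1 h2]]; first by rewrite mul0r sin0 cos0.
have e : 2 * pi = pi *+ 2 :> R by rewrite mulr_natl.
rewrite -[m.+1%:R]natr1 mulrDl mul1r.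
by split; rewrite ?sinD ?cosD h1 h2 e sin2pi cos2pi ?mulr0 ?mul0r ?mulr1 ?addr0 ?subr0.
Qed.

Lemma ccont_invX rho p : 0 < rho -> ccont rho (fun v => v ^- p).
Proof.
move=> r0; set c : R := - p%:R; set r : R := rho^-1 ^+ p.
have e : (fun x : R => vcirc rho x ^- p) = (fun x : R => vcirc r (c * x)).
  apply/funext => x.
  by rewrite -exprVn vcircV ?gt_eqF// vcircX mulrN mulNr.
rewrite /ccont e.
exact: continuous_ReIm (@continuous_rcos r c) (@continuous_rsin r c).
Qed.

(** The residue of [v ^ (q - p)] at the origin. *)
Lemma Ci_pow rho q p : 0 < rho ->
  Ci rho (fun v => v ^+ q * v ^- p) = (p == q.+1)%:R.
Proof.
move=> r0; have rn0 : rho != 0 by rewrite gt_eqF.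
have vn0 x : vcirc rho x != 0 by rewrite -cmod_gt0 cmod_vcirc// ltW.
rewrite /Ci; set h := (fun x : R => _).
have hE x : h x = vcirc rho x ^+ q.+1 * vcirc rho x ^- p.
  by rewrite /h exprSr mulrAC.
have [pq|pq|pq] := ltngtP p q.+1.
- have [s0 c1] := trig_period (q.+1 - p).
  have -> : h = fun x => vcirc (rho ^+ (q.+1 - p)) ((q.+1 - p)%:R * x).
    apply/funext => x; rewrite hE -vcircX -{1}(subnK (ltnW pq)) exprD mulfK//.
    by rewrite expf_neq0.
  rewrite Cintegral_vcirc ?mulr0//.
  by rewrite pnatr_eq0 -lt0n subn_gt0.
- have [s0 c1] := trig_period (p - q.+1).
  have -> : h = fun x => vcirc (rho^-1 ^+ (p - q.+1)) (- (p - q.+1)%:R * x).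
    apply/funext => x; rewrite hE mulNr -mulrN -vcircX -vcircV//.
    rewrite -{1}(subnK (ltnW pq)) exprD invfM mulrCA divff ?mulr1 ?exprVn//.
    by rewrite expf_neq0.
  rewrite Cintegral_vcirc ?mulr0// ?mulNr ?sinN ?cosN ?s0 ?c1 ?oppr0//.
  by rewrite oppr_eq0 pnatr_eq0 -lt0n subn_gt0.
have -> : h = fun=> 1.
  by apply/funext => x; rewrite hE pq divff// expf_neq0.
have pi0 : 0 < 2 * pi :> R by rewrite mulr_gt0// pi_gt0.
have muI : mu `[0, 2 * pi]%classic = (2 * pi)%:E.
  by rewrite lebesgue_measure_itv /= lte_fin pi0 oppr0 addr0.
rewrite /Cintegral /= !Rintegral_cst//= muI mul0r mul1r.
by rewrite -[(_ +i* _)%C]/(real_to_C (2 * pi)) -real_to_CM mulVf ?gt_eqF.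
Qed.

End CirclePowers.

Section CircleMatrix.
Variable R : realType.
Local Notation C := (Cplx R).

Definition mcont m n (rho : R) (F : C -> 'M[C]_(m, n)) :=
  forall i j, ccont rho (fun v => F v i j).

(** [circle_integral], also for rectangular matrices. *)
Definition mCi m n (rho : R) (F : C -> 'M[C]_(m, n)) : 'M[C]_(m, n) :=
  \matrix_(a, b) Ci rho (fun v => F v a b).

Lemma circle_integralE k (rho : R) (F : C -> 'M[C]_k) :
  circle_integral rho F = mCi rho F.
Proof. by []. Qed.

Section Rectangular.
Variables (m n : nat) (rho : R).
Hypothesis rho0 : 0 < rho.
Implicit Types F G : C -> 'M[C]_(m, n).

Lemma mcontD F G : mcont rho F -> mcont rho G -> mcont rho (fun v => F v + G v).
Proof.
move=> cF cG i j; have := ccontD (cF i j) (cG i j).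
by congr ccont; apply/funext => v; rewrite !mxE.
Qed.

Lemma mcontZ (c : C -> C) F : ccont rho c -> mcont rho F ->
  mcont rho (fun v => c v *: F v).
Proof.
move=> cc cF i j; have := ccontM cc (cF i j).
by congr ccont; apply/funext => v; rewrite !mxE.
Qed.

Lemma mcontZc (c : C) F : mcont rho F -> mcont rho (fun v => c *: F v).
Proof. by move=> cF; exact: (mcontZ (@ccont_cst R rho c) cF). Qed.

Lemma mcont_cst (X : 'M[C]_(m, n)) : mcont rho (fun=> X).
Proof. by move=> i j; exact: ccont_cst. Qed.

Lemma mcontB F G : mcont rho F -> mcont rho G -> mcont rho (fun v => F v - G v).
Proof.
move=> cF cG; have := mcontD cF (mcontZ (@ccont_cst R rho (-1)) cG).
by congr mcont; apply/funext => v; rewrite scaleN1r.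
Qed.

Lemma mcont_sum I (r : seq I) (P : pred I) (F : I -> C -> 'M[C]_(m, n)) :
  (forall i, P i -> mcont rho (F i)) ->
  mcont rho (fun v => \sum_(i <- r | P i) F i v).
Proof.
move=> hF; elim: r => [|i r IH].
  by have := @mcont_cst 0; congr mcont; apply/funext => v; rewrite big_nil.
have [Pi|Pi] := boolP (P i).
  by have := mcontD (hF _ Pi) IH; congr mcont; apply/funext => v; rewrite big_cons Pi.
by move: IH; congr mcont; apply/funext => v; rewrite big_cons (negbTE Pi).
Qed.

Lemma mCiD F G : mcont rho F -> mcont rho G ->
  mCi rho (fun v => F v + G v) = mCi rho F + mCi rho G.
Proof.
move=> cF cG; apply/matrixP => i j; rewrite !mxE -CiD//.
by congr (Ci rho); apply/funext => v; rewrite mxE.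
Qed.

Lemma mCiZ c F : mcont rho F -> mCi rho (fun v => c *: F v) = c *: mCi rho F.
Proof.
move=> cF; apply/matrixP => i j; rewrite !mxE -CiZ//.
by congr (Ci rho); apply/funext => v; rewrite mxE.
Qed.

Lemma mCiB F G : mcont rho F -> mcont rho G ->
  mCi rho (fun v => F v - G v) = mCi rho F - mCi rho G.
Proof.
move=> cF cG.
have e : (fun v => F v - G v) = (fun v => F v + (-1) *: G v).
  by apply/funext => v; rewrite scaleN1r.
have cG' : mcont rho (fun v => (-1) *: G v) := mcontZ (@ccont_cst R rho (-1)) cG.
by rewrite e (mCiD cF cG') (mCiZ _ cG) scaleN1r.
Qed.

Lemma mCi_sum I (r : seq I) (P : pred I) (F : I -> C -> 'M[C]_(m, n)) :
  (forall i, P i -> mcont rho (F i)) ->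
  mCi rho (fun v => \sum_(i <- r | P i) F i v) = \sum_(i <- r | P i) mCi rho (F i).
Proof.
move=> hF; apply/matrixP => i j; rewrite summxE !mxE.
under [RHS]eq_bigr do rewrite mxE.
rewrite -Ci_sum; last by move=> p Pp; exact: hF.
by congr (Ci rho); apply/funext => v; rewrite summxE.
Qed.

Lemma mCi_bound F (e : R) : mcont rho F ->
  (forall v, cmod v = rho -> nm (F v) <= e) ->
  nm (mCi rho F) <= (m * n)%:R * (2 * rho * e).
Proof.
move=> cF Fe; apply: nm_entrywise => i j; rewrite mxE.
apply: Ci_bound (ltW rho0) (cF i j) _ => v /Fe; apply: le_trans.
exact: cmod_le_nm.
Qed.

End Rectangular.

(** A function with a geometric expansion is Lipschitz far out, by [geom_lip]. *)
Lemma mcont_geom_shift k (rho B : R) (b : C) (F : C -> 'M[C]_k) a : 0 <= rho ->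
  geom B F a -> (forall v, cmod v = rho -> 16 * (B + 1) <= cmod (v + b)) ->
  mcont rho (fun v => F (v + b)).
Proof.
move=> rho0 hF vb; have [B1 _ _] := hF.
move=> i j; apply: continuous_cplx => x e e0.
pose d := Num.min 1 (e / (32 * (B + 1))).
have D0 : 0 < 32 * (B + 1) by lra.
have d0 : 0 < d by rewrite lt_min ltr01 divr_gt0.
have /cvgrPdist_lt/(_ (real_to_C d)) := @ccont_id R rho x.
rewrite -real_to_C0 ltcR_real => /(_ d0) /nbhs_ballP[r /= r0 hr].
exists r => // y /hr /=; rewrite cmodE ltcR_real => hd.
have h1 : cmod (vcirc rho x - vcirc rho y) <= 1.
  by rewrite (le_trans (ltW hd))// ge_min lexx.
have yB : 16 * (B + 1) <= cmod (vcirc rho y + b) by rewrite vb// cmod_vcirc.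
have := geom_lip hF h1 yB.
have -> : vcirc rho y + b + (vcirc rho x - vcirc rho y) = vcirc rho x + b by ring.
move=> h; have -> : F (vcirc rho x + b) i j - F (vcirc rho y + b) i j =
  (F (vcirc rho x + b) - F (vcirc rho y + b)) i j by rewrite !mxE.
apply: le_trans (cmod_le_nm _ _ _) _; apply: le_trans h _.
rewrite mulrC -ler_pdivlMr// (le_trans (ltW hd))// ge_min lexx orbT//.
Qed.

Lemma mcont_geom k (rho B : R) (F : C -> 'M[C]_k) a : geom B F a ->
  16 * (B + 1) <= rho -> mcont rho F.
Proof.
move=> hF Brho; have rho0 : 0 <= rho by have [B1 _ _] := hF; lra.
have hv v : cmod v = rho -> 16 * (B + 1) <= cmod (v + 0 : C) by rewrite addr0 => ->.
have := mcont_geom_shift rho0 hF hv.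
by congr mcont; apply/funext => v; rewrite addr0.
Qed.

(** Termwise integration of a convergent Laurent expansion. *)
Lemma mCi_geom k (rho B : R) (F : C -> 'M[C]_k) a q : geom B F a ->
  16 * (B + 1) <= rho -> mCi rho (fun v => v ^+ q *: F v) = a q.+1.
Proof.
move=> hF Brho; have [B1 _ hF'] := hF; have B0 : 0 < B by lra.
have rho0 : 0 < rho by lra.
have cv p : ccont rho (fun v => v ^- p) := @ccont_invX R rho p rho0.
have cq : ccont rho (fun v => v ^+ q) := @ccontX R rho id q (@ccont_id R rho).
have cF := mcont_geom hF Brho.
have cqF : mcont rho (fun v => v ^+ q *: F v) := mcontZ cq cF.
have cps N : mcont rho (fun v => v ^+ q *: psum a N v).
  apply: (mcontZ cq); rewrite /psum; apply: mcont_sum => j _.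
  exact: (@mcontZ k k rho (fun v => v ^- j) (fun=> a j) (cv j) (@mcont_cst k k rho (a j))).
have hps N : (q.+1 < N)%N -> mCi rho (fun v => v ^+ q *: psum a N v) = a q.+1.
  move=> qN; rewrite /psum.
  have -> : (fun v => v ^+ q *: (\sum_(j < N) v ^- j *: a j)) =
      (fun v => \sum_(j < N) (v ^+ q * v ^- j) *: a j).
    apply/funext => v; rewrite scaler_sumr; apply: eq_bigr => j _.
    by rewrite scalerA.
  have cterm (j : 'I_N) : mcont rho (fun v => (v ^+ q * v ^- j) *: a j).
    exact: (@mcontZ k k rho (fun v => v ^+ q * v ^- j) (fun=> a j)
      (ccontM cq (cv j)) (@mcont_cst k k rho (a j))).
  rewrite (mCi_sum _ (fun j _ => cterm j)).
  have mterm (j : 'I_N) : mCi rho (fun v => (v ^+ q * v ^- j) *: a j) =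
      ((j : nat) == q.+1)%:R *: a j.
    apply/matrixP => i l; rewrite !mxE -(Ci_pow q j rho0) [RHS]mulrC.
    rewrite -(CiZ _ (ccontM cq (cv j))).
    by congr (Ci rho); apply/funext => v; rewrite mxE mulrC.
  rewrite (eq_bigr _ (fun j _ => mterm j)) (bigD1 (Ordinal qN)) //= eqxx scale1r.
  rewrite big1 ?addr0// => j; rewrite -val_eqE /= => /negbTE ->.
  by rewrite scale0r.
apply/eqP; rewrite -subr_eq0 -nm_eq0 eq_le nm_ge0 andbT.
apply/ler_addgt0Pr => e e0; rewrite add0r.
have [N0 hN] := half_pow_small ((k * k)%:R * (2 * rho * (rho ^+ q * B))) e0.
pose N := maxn N0 q.+2.
rewrite -(hps N) ?leq_maxr// -(mCiB cqF (cps N)).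
have cd := mcontB cqF (cps N).
apply: le_trans (mCi_bound rho0 (e := rho ^+ q * (B * (1 / 2) ^+ N)) cd _) _.
  move=> v vrho; rewrite -scalerBr nmZ cmodX vrho ler_wpM2l ?exprn_ge0 ?(ltW rho0)//.
  have Bv : B <= cmod v by lra.
  have Bv2 : 2 * B <= cmod v by lra.
  apply: le_trans (hF' N v Bv) _; rewrite ler_wpM2l ?(ltW B0)//.
  by have /andP[h1 h2] := ratio_half B0 Bv2; rewrite lerXn2r ?nnegrE.
apply: le_trans (hN N (leq_maxl _ _)).
by rewrite le_eqVlt; apply/orP; left; apply/eqP; ring.
Qed.

End CircleMatrix.

Section TensorIntegral.
Variables (R : realType) (k1 k2 : nat).
Local Notation C := (Cplx R).
Implicit Types (X : 'M[C]_k1) (Y : 'M[C]_k2).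

Lemma tens_Zl (c : C) X Y : (c *: X) *t Y = c *: (X *t Y).
Proof. by apply/matrixP => i j; rewrite !mxE mulrA. Qed.

Lemma tens_Zr (c : C) X Y : X *t (c *: Y) = c *: (X *t Y).
Proof. by apply/matrixP => i j; rewrite !mxE mulrCA. Qed.

Lemma tens_Br X Y Y' : X *t (Y - Y') = X *t Y - X *t Y'.
Proof. by apply/matrixP => i j; rewrite !mxE mulrBr. Qed.

Lemma tens_sumr I (r : seq I) (P : pred I) X (G : I -> 'M[C]_k2) :
  X *t (\sum_(i <- r | P i) G i) = \sum_(i <- r | P i) X *t G i.
Proof.
apply/matrixP => i j; rewrite !mxE !summxE mulr_sumr.
by apply: eq_bigr => a _; rewrite !mxE.
Qed.

Lemma mcont_tens (rho : R) (F : C -> 'M[C]_k1) (G : C -> 'M[C]_k2) :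
  mcont rho F -> mcont rho G -> mcont rho (fun v => F v *t G v).
Proof.
move=> cF cG i j; case: (mxtens_indexP i) => i1 i2; case: (mxtens_indexP j) => j1 j2.
have := ccontM (cF i1 j1) (cG i2 j2).
by congr ccont; apply/funext => v; rewrite tensmxE.
Qed.

Lemma mCi_tensr (rho : R) (F : C -> 'M[C]_k1) Y : mcont rho F ->
  mCi rho (fun v => F v *t Y) = mCi rho F *t Y.
Proof.
move=> cF; apply/matrixP => i j.
case: (mxtens_indexP i) => i1 i2; case: (mxtens_indexP j) => j1 j2.
rewrite tensmxE !mxE [RHS]mulrC -CiZ; last exact: cF.
by congr (Ci rho); apply/funext => v; rewrite tensmxE mulrC.
Qed.

(** The coefficients of [b |-> \oint D(v) (x) T(v + b) dv]. *)
Definition jcoef (d : nat -> 'M[C]_k1) (tau : nat -> 'M[C]_k2) (p : nat) :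
    'M[C]_(k1 * k2) :=
  \sum_(j < p.+1) ((-1) ^+ (p - j) * 'C(p.-1, p - j)%:R) *: (d (p - j).+1 *t tau j).

Section Contour.
Variables (D : C -> 'M[C]_k1) (d : nat -> 'M[C]_k1).
Variables (T : C -> 'M[C]_k2) (tau : nat -> 'M[C]_k2) (B1 B2 rho : R).
Hypotheses (hD : geom B1 D d) (hT : geom B2 T tau) (Brho : 16 * (B1 + 1) <= rho).

Let B11 : 1 <= B1. Proof. by case: hD. Qed.
Let rho0 : 0 < rho. Proof. by have := B11; have := Brho; lra. Qed.
Let cD : mcont rho D. Proof. exact: mcont_geom hD Brho. Qed.

Let cterm p j : mcont rho (fun v => (v ^+ (p - j) *: D v) *t tau j).
Proof.
apply: (@mcont_tens rho (fun v => v ^+ (p - j) *: D v) (fun=> tau j)).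
  exact: (@mcontZ R k1 k1 rho (fun v => v ^+ (p - j)) D
    (@ccontX R rho id _ (@ccont_id R rho)) cD).
exact: mcont_cst.
Qed.

Let integrandE p v : D v *t mshift v tau p = \sum_(j < p.+1)
  ((-1) ^+ (p - j) * 'C(p.-1, p - j)%:R) *: ((v ^+ (p - j) *: D v) *t tau j).
Proof.
rewrite /mshift tens_sumr; apply: eq_bigr => j _.
by rewrite /shiftc tens_Zr tens_Zl scalerA.
Qed.

Let cmshift p : mcont rho (fun v => D v *t mshift v tau p).
Proof.
have -> : (fun v => D v *t mshift v tau p) = (fun v => \sum_(j < p.+1)
  ((-1) ^+ (p - j) * 'C(p.-1, p - j)%:R) *: ((v ^+ (p - j) *: D v) *t tau j)).
  by apply/funext => v; exact: integrandE.
apply: mcont_sum => j _.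
apply: mcontZc; exact: cterm.
Qed.

Lemma jcoefE p : mCi rho (fun v => D v *t mshift v tau p) = jcoef d tau p.
Proof.
have -> : (fun v => D v *t mshift v tau p) = (fun v => \sum_(j < p.+1)
  ((-1) ^+ (p - j) * 'C(p.-1, p - j)%:R) *: ((v ^+ (p - j) *: D v) *t tau j)).
  by apply/funext => v; exact: integrandE.
rewrite mCi_sum; last first.
  move=> j _; apply: mcontZc; exact: cterm.
apply: eq_bigr => j _; rewrite (mCiZ _ (@cterm p j)); congr (_ *: _).
rewrite mCi_tensr; last first.
  exact: (@mcontZ R k1 k1 rho (fun v => v ^+ (p - j)) D
    (@ccontX R rho id _ (@ccont_id R rho)) cD).
by rewrite (mCi_geom _ hD Brho).
Qed.

(** On the circle, [T (v + b)] has an expansion in [b] whose coefficients are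
polynomials in [v], with bounds uniform in [v].  It can be integrated termwise,
and the moments of [D] are its own coefficients by [mCi_geom]. *)
Lemma geom_contour : exists B,
  geom B (fun b => mCi rho (fun v => D v *t T (v + b))) (jcoef d tau).
Proof.
set B4 := 8 * (B2 + rho); have [B21 _ _] := hT.
have B40 : 0 <= B4 by rewrite /B4; have := rho0; lra.
have hS v : cmod v = rho -> geom B4 (fun u => T (u + v)) (mshift v tau).
  by move=> vrho; apply: geom_shift hT; rewrite vrho.
have DB v : cmod v = rho -> nm (D v) <= B1.
  by move=> vrho; apply: geom_bound hD _; rewrite vrho; have := B11; have := Brho; lra.
have rho0' := rho0; have B11' := B11.
pose K := ((k1 * k2) * (k1 * k2))%:R * (2 * rho * B1) * B4.
have K0 : 0 <= K by rewrite /K; apply: mulr_ge0 => //; rewrite !mulr_ge0//; lra.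
apply: (@geomI R _ K B4 (rho + 16 * (B2 + 1) + B4)) => //.
  move=> p; rewrite -jcoefE.
  have h v : cmod v = rho -> nm (D v *t mshift v tau p) <= B1 * (B4 * B4 ^+ p).
    move=> vrho; rewrite nm_tens ler_pM ?nm_ge0 ?DB//.
    by have [_ hc _] := hS v vrho; exact: hc.
  apply: le_trans (mCi_bound rho0 (@cmshift p) h) _.
  by rewrite le_eqVlt; apply/orP; left; apply/eqP; rewrite /K; ring.
move=> N b bbig; set q := B4 / cmod b.
have Bb : B4 <= cmod b by lra.
have cT : mcont rho (fun v => T (v + b)).
  apply: (mcont_geom_shift (ltW rho0) hT) => v vrho.
  by have := cmod_subl b v; rewrite [b + v]addrC vrho; lra.
have cDT : mcont rho (fun v => D v *t T (v + b)) := mcont_tens cD cT.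
have psE v : D v *t psum (mshift v tau) N b =
    \sum_(p < N) b ^- p *: (D v *t mshift v tau p).
  by rewrite /psum tens_sumr; apply: eq_bigr => p _; rewrite tens_Zr.
have cps : mcont rho (fun v => D v *t psum (mshift v tau) N b).
  have -> : (fun v => D v *t psum (mshift v tau) N b) =
    (fun v => \sum_(p < N) b ^- p *: (D v *t mshift v tau p)).
    by apply/funext.
  apply: mcont_sum => p _.
  apply: mcontZc; exact: cmshift.
have -> : psum (jcoef d tau) N b = mCi rho (fun v => D v *t psum (mshift v tau) N b).
  have -> : (fun v => D v *t psum (mshift v tau) N b) =
    (fun v => \sum_(p < N) b ^- p *: (D v *t mshift v tau p)).
    by apply/funext.
  rewrite mCi_sum; last first.
    move=> p _.
    apply: mcontZc; exact: cmshift.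
  by apply: eq_bigr => p _; rewrite (mCiZ _ (@cmshift p)) jcoefE.
rewrite -(mCiB cDT cps).
have h v : cmod v = rho ->
    nm (D v *t T (v + b) - D v *t psum (mshift v tau) N b) <= B1 * (B4 * q ^+ N).
  move=> vrho; rewrite -tens_Br nm_tens ler_pM ?nm_ge0 ?DB//.
  by have [_ _ hc] := hS v vrho; rewrite [v + b]addrC; exact: hc.
apply: le_trans (mCi_bound rho0 (mcontB cDT cps) h) _.
by rewrite le_eqVlt; apply/orP; left; apply/eqP; rewrite /K; ring.
Qed.

End Contour.
End TensorIntegral.

(** * Rational germs *)

Section RationalGerms.
Variables (R : realType).
Local Notation C := (Cplx R).

Lemma for_largeP (P : C -> Prop) : for_large P <->
  exists M : R, forall u, M < cmod u -> P u.
Proof.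
split=> -[M hM]; exists M => u.
  by move=> Mu; apply: hM; rewrite cmodE ltcR_real.
by rewrite cmodE ltcR_real; exact: hM.
Qed.

Lemma for_largeI (P Q : C -> Prop) : for_large P -> for_large Q ->
  for_large (fun u => P u /\ Q u).
Proof.
move=> /for_largeP[M hM] /for_largeP[M' hM']; apply/for_largeP.
exists (Num.max M M') => u; rewrite gt_max => /andP[h1 h2].
by split; [exact: hM|exact: hM'].
Qed.

Lemma for_large_ex (P : C -> Prop) : for_large P -> exists u, P u.
Proof.
move=> /for_largeP[M hM]; exists (real_to_C (`|M| + 1)); apply: hM.
rewrite cmod_real ger0_norm ?addr_ge0//.
by rewrite (le_lt_trans (ler_norm M))// ltrDl.
Qed.

Lemma for_large_sub (P Q : C -> Prop) : (forall u, P u -> Q u) ->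
  for_large P -> for_large Q.
Proof. by move=> PQ [M hM]; exists M => u /hM /PQ. Qed.

Lemma poly_large_neq0 (Q : {poly C}) : Q != 0 ->
  exists M : R, forall u, M < cmod u -> Q.[u] != 0.
Proof.
move=> Q0; have [rs hQ] := closed_field_poly_normal Q.
exists (\sum_(z <- rs) cmod z) => u hu; rewrite hQ hornerZ mulf_neq0 ?lead_coef_eq0//.
rewrite horner_prod prodf_seq_neq0; apply/allP => z zrs /=.
rewrite hornerXsubC subr_eq0; apply: contraTneq hu => ->; rewrite -leNgt.
by rewrite (big_rem z)//= lerDl; apply: sumr_ge0 => *; exact: cmod_ge0.
Qed.

Lemma poly_large_eq0 (Q : {poly C}) : for_large (fun u => Q.[u] = 0) -> Q = 0.
Proof.
move=> hQ; apply/eqP/negPn/negP => /poly_large_neq0[M hM].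
have h2 : for_large (fun u => Q.[u] != 0) by apply/for_largeP; exists M.
by have [u [/eqP h]] := for_large_ex (for_largeI hQ h2); rewrite h.
Qed.

Section Matrix.
Variable k : nat.
Implicit Types F G : C -> 'M[C]_k.

Lemma frac_evalE (P : 'M[{poly C}]_k) Q (u : C) i j :
  frac_eval P Q u i j = Q.[u]^-1 * (P i j).[u].
Proof. by rewrite !mxE. Qed.

(** Two representations of one germ agree at infinity, hence as polynomials after
clearing denominators. *)
Lemma represents_eq F P Q P' Q' u : represents P Q F -> represents P' Q' F ->
  Q.[u] != 0 -> Q'.[u] != 0 -> frac_eval P Q u = frac_eval P' Q' u.
Proof.
move=> [Q0 h] [Q'0 h'] Qu Q'u; apply/matrixP => i j; rewrite !frac_evalE.
have [M hM] := poly_large_neq0 Q0; have [M' hM'] := poly_large_neq0 Q'0.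
have e : Q' * P i j - Q * P' i j = 0.
  apply: poly_large_eq0.
  have hQ : for_large (fun u => Q.[u] != 0) by apply/for_largeP; exists M.
  have hQ' : for_large (fun u => Q'.[u] != 0) by apply/for_largeP; exists M'.
  apply: for_large_sub (for_largeI (for_largeI h h') (for_largeI hQ hQ')).
  move=> w [[h1 h2] [q1 q2]].
  have : frac_eval P Q w i j = frac_eval P' Q' w i j by rewrite -h1 -h2.
  rewrite !frac_evalE hornerD hornerN !hornerM => e.
  have -> : (P i j).[w] = Q.[w] * (Q'.[w]^-1 * (P' i j).[w]).
    by rewrite -e mulrA divff// mul1r.
  by field.
have : (Q' * P i j - Q * P' i j).[u] = 0 by rewrite e horner0.
rewrite hornerD hornerN !hornerM => /eqP; rewrite subr_eq0 => /eqP e2.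
apply: (mulfI Qu); apply: (mulfI Q'u).
by rewrite mulVKf// e2; field.
Qed.

Lemma rat_extE F : rational_germ F ->
  exists M : R, forall u, M < cmod u -> rat_ext F u = F u.
Proof.
move=> [P [Q PQ]]; have [Q0 /for_largeP[M hM]] := PQ.
have [M' hM'] := poly_large_neq0 Q0; exists (Num.max M M') => u.
rewrite gt_max => /andP[/hM Fu /hM' Qu]; rewrite Fu /rat_ext.
case: xgetP => [X _ [P' [Q' [r' Q'u ->]]]|h].
  exact: represents_eq r' PQ Q'u Qu.
by case: (h (frac_eval P Q u)); exists P, Q.
Qed.

Lemma rational_poles_bounded F : rational_germ F ->
  exists M : R, forall a, is_pole F a -> cmod a <= M.
Proof.
move=> [P [Q PQ]]; have [Q0 _] := PQ.
have [M hM] := poly_large_neq0 Q0; exists M => a ha; rewrite leNgt.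
by apply/negP => /hM Qa; apply: ha; exists P, Q.
Qed.

(** A vector killed by [X] is fixed by [1 - X], which contracts. *)
Lemma unitmx_near1 (X : 'M[C]_k) : nm (X - 1) < 1 -> X \in unitmx.
Proof.
move=> X1; rewrite unitmxE unitfE; apply/det0P => -[v v0 vX].
have : nm v <= nm v * nm (X - 1).
  apply: le_trans (nmM _ _); rewrite -nmN.
  rewrite (_ : v *m (X - 1) = - v)//.
  by rewrite mulmxBr vX mulmx1 sub0r.
have v1 : 0 < nm v by rewrite lt_def nm_ge0 andbT; apply: contraNneq v0 => /eqP; rewrite nm_eq0.
have := nm_ge0 (X - 1); move: v1 X1; nra.
Qed.

(** By Cramer's rule the inverse is the adjugate over the determinant. *)
Lemma rational_invmx F : rational_germ F ->
  for_large (fun u => F u \in unitmx) -> rational_germ (fun u => invmx (F u)).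
Proof.
move=> [P [Q [Q0 hPQ]]] hF; have [M hM] := poly_large_neq0 Q0.
have hQ : for_large (fun u => Q.[u] != 0) by apply/for_largeP; exists M.
have evE u : frac_eval P Q u = Q.[u]^-1 *: map_mx (horner_eval u) P.
  by [].
have D0 : \det P != 0.
  apply/eqP => D0; have [u [[Fu PQu] Qu]] := for_large_ex (for_largeI (for_largeI hF hPQ) hQ).
  move: Fu; rewrite PQu evE unitmxE detZ det_map_mx D0 rmorph0 mulr0 unitr0//.
exists (map_mx (fun p => Q * p) (\adj P)), (\det P); split=> //.
have [M' hM'] := poly_large_neq0 D0.
have hD : for_large (fun u => (\det P).[u] != 0) by apply/for_largeP; exists M'.
apply: for_large_sub (for_largeI (for_largeI hF hPQ) (for_largeI hQ hD)).
move=> u [[Fu PQu] [Qu Du]].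
have e : F u *m frac_eval (map_mx (fun p => Q * p) (\adj P)) (\det P) u = 1%:M.
  have -> : frac_eval (map_mx (fun p => Q * p) (\adj P)) (\det P) u =
     ((\det P).[u]^-1 * Q.[u]) *: \adj (map_mx (horner_eval u) P).
    apply/matrixP => i j; rewrite -map_mx_adj !mxE /= /horner_eval hornerM mulrA//.
  rewrite PQu evE -scalemxAl -scalemxAr scalerA mul_mx_adj det_map_mx /= /horner_eval.
  rewrite scale_scalar_mx mulrCA mulVf// mulr1 mulVf//.
have [_ h] := mulmx1_unit e.
by rewrite -[LHS]mulmx1 -e mulmxA mulVmx// mul1mx.
Qed.

(** A Laurent series whose coefficients satisfy a linear recurrence is
rational: multiplying by the characteristic polynomial of the recurrence leaves
a polynomial. *)
Lemma rational_recurrence F a (B : R) (p : {poly C}) : geom B F a -> p != 0 ->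
  (forall r, \sum_(i < size p) p`_i *: a (r + i).+1 = 0) -> rational_germ F.
Proof.
move=> hF p0 rec; have [B1 _ _] := hF.
pose P : 'M[{poly C}]_k := \matrix_(x, y)
  \sum_(i < size p) \sum_(j < i.+1) (p`_i * a j x y) *: 'X^(i - j).
exists P, p; split=> //; apply/for_largeP.
have [M hM] := poly_large_neq0 p0; exists (Num.max (2 * B) M) => u.
rewrite gt_max => /andP[/ltW uB /hM pu].
have unz : u != 0 by rewrite -cmod_gt0; lra.
have key : p.[u] *: F u = \sum_(i < size p) (p`_i * u ^+ i) *: psum a i.+1 u.
  apply/eqP; rewrite -subr_eq0; apply/eqP.
  rewrite horner_coef scaler_suml -sumrB.
  have cv := geom_cvg hF uB.
  apply: (@mcvg_unique _ _ _ (fun N => \sum_(i < size p) (p`_i * u ^+ i) *: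
     (psum a (N + i.+1) u - psum a i.+1 u))).
    apply: mcvg_sum => i _; rewrite -scalerBr; apply: mcvgZ.
    by apply: mcvgB (mcvg_cst _); exact: mcvg_shift cv.
  apply: (mcvg_ext _ (mcvg_cst 0)) => N; apply/esym.
  have e (i : 'I_(size p)) : (p`_i * u ^+ i) *: (psum a (N + i.+1) u - psum a i.+1 u) =
      \sum_(j < N) u ^- j.+1 *: (p`_i *: a (j + i).+1).
    rewrite psum_sub ?leq_addl// -{1}(add0n i.+1) big_addn addnK big_mkord scaler_sumr.
    apply: eq_bigr => j _; rewrite !scalerA addnS; congr (_ *: _).
    rewrite [u ^+ (j + i).+1]exprS exprD [u ^+ j.+1]exprS.
    by field; rewrite unz !expf_neq0.
  rewrite (eq_bigr _ (fun i _ => e i)) exchange_big /=; apply: big1 => j _.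
  by rewrite -scaler_sumr rec scaler0.
have -> : F u = p.[u]^-1 *: (p.[u] *: F u) by rewrite scalerA mulVf// scale1r.
rewrite key; apply/matrixP => x y; rewrite frac_evalE !mxE; congr (_ * _).
rewrite summxE horner_sum; apply: eq_bigr => i _.
rewrite mxE summxE horner_sum mulr_sumr; apply: eq_bigr => -[j /= ji] _.
rewrite mxE hornerZ hornerXn.
have -> : u ^+ i = u ^+ (i - j) * u ^+ j by rewrite -exprD subnK.
by field; rewrite expf_neq0.
Qed.

End Matrix.
End RationalGerms.

(** * Growth of the Yangian generators in a representation *)

Section Presentations.
Variables (K : comPzRingType) (G : Type) (rel : aterm K G -> aterm K G -> Prop).
Local Notation pi := (apres rel : aterm K G -> palg rel).

Lemma apresD x y : pi (TAdd x y) = pi x + pi y.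
Proof. exact: (esym (palg_addE rel x y)). Qed.

Lemma apresN x : pi (TOpp x) = - pi x.
Proof. exact: (esym (palg_oppE rel x)). Qed.

Lemma apresM x y : pi (TMul x y) = pi x * pi y.
Proof. exact: (esym (palg_mulE rel x y)). Qed.

Lemma apresZ c x : pi (TScale c x) = c *: pi x.
Proof. exact: (esym (palg_scaleE rel c x)). Qed.

Lemma apres0 : pi TZero = 0.
Proof. by []. Qed.

Lemma apres1 : pi TOne = 1.
Proof. by []. Qed.

Lemma apres_comm x y : pi (tcomm x y) = pi x * pi y - pi y * pi x.
Proof. by rewrite /tcomm apresD apresN !apresM. Qed.

Lemma apres_rel x y : rel x y -> pi x = pi y.
Proof. by move=> h; apply/apresP; exact: acong_rel. Qed.

End Presentations.

Section YangianRelations.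
Variables (R : realType) (n : nat) (g : semisimple n) (hbar : Cplx R).
Local Notation C := (Cplx R).
Local Notation xi := (yxi g hbar).
Local Notation xp := (yx g hbar true).
Local Notation xm := (yx g hbar false).
Local Notation relY := (@yangian_rel R n g hbar).

Lemma yxi_comm i j r s : xi i r * xi j s = xi j s * xi i r.
Proof.
have := apres_rel (yrel_xi_xi g hbar i j r s).
by rewrite apres_comm apres0 => /eqP; rewrite subr_eq0 => /eqP.
Qed.

Lemma yxi0_x i s : xi i 0 * xp i s - xp i s * xi i 0 = ipC R g i i *: xp i s.
Proof.
have := apres_rel (yrel_xi0_x g hbar true i i s).
by rewrite apres_comm apresZ mul1r.
Qed.

Lemma yxi1_x i s : xi i 1 * xp i s - xp i s * xi i 1 =
  (xi i 0 * xp i s.+1 - xp i s.+1 * xi i 0) +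
  (hbar * (ipC R g i i / 2)) *: (xi i 0 * xp i s + xp i s * xi i 0).
Proof.
have := apres_rel (yrel_xi_x g hbar true i i 0 s).
rewrite apresD apresN !apres_comm apresZ apresD !apresM mul1r => /eqP.
by rewrite subr_eq [X in _ == X]addrC => /eqP.
Qed.

Lemma yx_pm i r : xp i r * xm i 0 - xm i 0 * xp i r = xi i r.
Proof.
have := apres_rel (yrel_xp_xm g hbar i i r 0).
by rewrite apres_comm eqxx addn0 => h; exact: h.
Qed.

(** The element [xi_1 - (hbar / 2) xi_0^2] raises the index of the generators
[x^+], up to a nonzero factor: this makes them, and hence the [xi_r], iterates
of a single operator. *)
Definition yraise i : yangian g hbar := xi i 1 - (hbar / 2) *: (xi i 0 * xi i 0).

Lemma yraise_x i s :
  yraise i * xp i s - xp i s * yraise i = ipC R g i i *: xp i s.+1.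
Proof.
have e2 : xi i 0 * xi i 0 * xp i s - xp i s * (xi i 0 * xi i 0) =
   ipC R g i i *: (xi i 0 * xp i s + xp i s * xi i 0).
  rewrite scalerDr scalerAr scalerAl -yxi0_x mulrBr mulrBl !mulrA.
  by rewrite addrA subrK.
have -> : yraise i * xp i s - xp i s * yraise i =
    (xi i 1 * xp i s - xp i s * xi i 1) -
    (hbar / 2) *: (xi i 0 * xi i 0 * xp i s - xp i s * (xi i 0 * xi i 0)).
  rewrite mulrBl mulrBr -scalerAl -scalerAr scalerBr !opprD !opprK.
  by rewrite -!addrA; congr (_ + _); rewrite addrCA.
rewrite e2 yxi1_x yxi0_x scalerA.
have -> : hbar / 2 * ipC R g i i = hbar * (ipC R g i i / 2) by rewrite mulrAC mulrA.
by rewrite addrK.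
Qed.

Lemma ipC_diag i : ipC R g i i != 0.
Proof.
rewrite /ipC /ipsimple cartan_diag intr_eq0 mulf_neq0//.
by have := dsym_gt0 g i; case: (dsym g i).
Qed.

Lemma yx_succ i s :
  xp i s.+1 = (ipC R g i i)^-1 *: (yraise i * xp i s - xp i s * yraise i).
Proof. by rewrite yraise_x scalerA mulVf ?ipC_diag// scale1r. Qed.

End YangianRelations.

(** The iterates of [X |-> c [T, X]] grow geometrically and, the matrices forming a
finite dimensional space, satisfy a linear recurrence with constant
coefficients.  Both properties pass to their commutators with [Y]. *)
Section IteratedCommutators.
Variables (R : realType) (k : nat).
Local Notation C := (Cplx R).
Variables (c : C) (T Y : 'M[C]_k) (x : nat -> 'M[C]_k).
Hypothesis xS : forall s, x s.+1 = c *: (T * x s - x s * T).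

Lemma nm_iter_comm : exists B, 1 <= B /\ forall r,
  nm (x r * Y - Y * x r) <= B * B ^+ r.
Proof.
have nmM' (A D : 'M[C]_k) : nm (A * D) <= nm A * nm D by exact: nmM.
pose q := cmod c * (2 * nm T); have q0 : 0 <= q by rewrite !mulr_ge0 ?cmod_ge0 ?nm_ge0.
have hx r : nm (x r) <= nm (x 0%N) * q ^+ r.
  elim: r => [|r IH]; first by rewrite expr0 mulr1.
  rewrite xS nmZ exprS mulrCA; apply: (@le_trans _ _ (q * nm (x r))); last first.
    exact: ler_wpM2l.
  rewrite /q -mulrA ler_wpM2l ?cmod_ge0//; apply: le_trans (nmB _ _) _.
  have := nmM' T (x r); have := nmM' (x r) T; rewrite mulrC; lra.
pose D := 2 * nm Y * nm (x 0%N); have D0 : 0 <= D by rewrite !mulr_ge0 ?nm_ge0.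
exists (1 + D + q); split; first by rewrite -addrA lerDl addr_ge0.
move=> r; apply: (@le_trans _ _ (D * q ^+ r)).
  apply: le_trans (nmB _ _) _.
  have h1 := nmM' (x r) Y; have h2 := nmM' Y (x r).
  apply: (@le_trans _ _ (2 * nm Y * nm (x r))); first by move: h1 h2; rewrite [nm Y * _]mulrC; lra.
  by rewrite /D -[leRHS]mulrA ler_wpM2l// mulr_ge0 ?nm_ge0.
apply: ler_pM => //; [exact: exprn_ge0|lra|].
by apply: lerXn2r; rewrite ?nnegrE; lra.
Qed.

Lemma recurrence_iter_comm : exists2 p : {poly C}, p != 0 &
  forall r, \sum_(i < size p) p`_i *: (x (r + i)%N * Y - Y * x (r + i)%N) = 0.
Proof.
pose A := \matrix_(i < (k * k).+1) mxvec (x i).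
have : kermx A != 0.
  by rewrite kermx_eq0 /row_free; apply/negP => /eqP e; have := rank_leq_col A; rewrite e ltnn.
move=> /rowV0Pn[v /sub_kermxP vA v0].
pose p := \poly_(i < (k * k).+1) v 0 (inord i).
have pE (i : 'I_(k * k).+1) : p`_i = v 0 i by rewrite coef_poly ltn_ord inord_val.
have sp : (size p <= (k * k).+1)%N := size_poly _ _.
exists p.
  apply: contraNneq v0 => p0; apply/eqP/rowP => i.
  by rewrite -pE p0 coef0 mxE.
(* The operator carries one linear relation along the sequence. *)
have h0 r : \sum_(i < (k * k).+1) v 0 i *: x (r + i)%N = 0.
  elim: r => [|r IH].
    apply: (can_inj mxvecK); rewrite linear0 linear_sum -[RHS]vA mulmx_sum_row.
    by apply: eq_bigr => i _; rewrite rowK linearZ.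
  have -> : \sum_(i < (k * k).+1) v 0 i *: x (r.+1 + i)%N =
      c *: (T * (\sum_(i < (k * k).+1) v 0 i *: x (r + i)%N) -
           (\sum_(i < (k * k).+1) v 0 i *: x (r + i)%N) * T).
    rewrite mulr_sumr mulr_suml -sumrB scaler_sumr; apply: eq_bigr => i _.
    by rewrite addSn xS mxZl mxZr -scalerBr !scalerA [_ * c]mulrC.
  by rewrite IH mulr0 mul0r subr0 scaler0.
move=> r.
have -> : \sum_(i < size p) p`_i *: (x (r + i)%N * Y - Y * x (r + i)%N) =
   \sum_(i < (k * k).+1) v 0 i *: (x (r + i)%N * Y - Y * x (r + i)%N).
  rewrite (big_ord_widen _ (fun i => p`_i *: (x (r + i)%N * Y - Y * x (r + i)%N)) sp).
  rewrite big_mkcond; apply: eq_bigr => i _; rewrite -pE.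
  by case: ifPn => //; rewrite -leqNgt => /(nth_default 0) ->; rewrite scale0r.
have -> : \sum_(i < (k * k).+1) v 0 i *: (x (r + i)%N * Y - Y * x (r + i)%N) =
   (\sum_(i < (k * k).+1) v 0 i *: x (r + i)%N) * Y -
   Y * (\sum_(i < (k * k).+1) v 0 i *: x (r + i)%N).
  rewrite mulr_sumr mulr_suml -sumrB; apply: eq_bigr => i _.
  by rewrite mxZl mxZr scalerBr.
by rewrite h0 mulr0 mul0r subr0.
Qed.

End IteratedCommutators.

(** * The series xi_i(u) and t_i(u) on a representation *)

Section Commuting.
Variable A : pzRingType.

Lemma fps_pow_comm (f : fps A) x : (forall p, GRing.comm x (f p)) ->
  forall m r, GRing.comm x (fps_pow f m r).
Proof.
move=> xf; elim=> [|m IH] r.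
  by rewrite /fps_pow /= /fps_one; case: (r == 0%N); [exact: commr1|exact: commr0].
apply: commr_sum => j _; apply: commrM; [exact: xf|exact: IH].
Qed.

End Commuting.

Lemma fps_log1p_comm (K : fieldType) (A : algType K) (f : fps A) x :
  (forall p, GRing.comm x (f p)) -> forall r, GRing.comm x (fps_log1p f r).
Proof.
move=> xf r; apply: commr_sum => m _; rewrite /GRing.comm -scalerAr -scalerAl.
by congr (_ *: _); exact: fps_pow_comm.
Qed.

Lemma fps_pow_morph (A B : pzRingType) (V : {rmorphism A -> B}) (f : fps A) m r :
  V (fps_pow f m r) = fps_pow (fun p => V (f p)) m r.
Proof.
elim: m r => [|m IH] r; first by rewrite /fps_pow /= /fps_one rmorph_nat.
rewrite /fps_pow /= -!/(fps_pow _ _) rmorph_sum; apply: eq_bigr => j _.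
by rewrite rmorphM; congr (_ * _); exact: IH.
Qed.

Section GeomExtra.
Variables (R : realType) (k : nat).
Local Notation C := (Cplx R).

Lemma geom_cst (X : 'M[C]_k) : exists B, geom B (fun=> X) (fun j => if j is 0%N then X else 0).
Proof.
have [B hB] := geom_trunc (fun=> X) 1; exists B.
apply: geom_coef (geom_ext _ hB) => [[|j]//|u _].
by rewrite /psum big_ord1 expr0 invr1 scale1r.
Qed.

Lemma geomDe (F G : C -> 'M[C]_k) a b (B B' : R) : geom B F a -> geom B' G b ->
  exists D, geom D (fun u => F u + G u) (fun j => a j + b j).
Proof.
move=> hF hG; exists (2 * Num.max B B'); apply: geomD.
  by apply: geom_mono hF; rewrite le_max lexx.
by apply: geom_mono hG; rewrite le_max lexx orbT.
Qed.

End GeomExtra.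

Section Representation.
Variables (R : realType) (n : nat) (g : semisimple n) (hbar : Cplx R).
Hypothesis hbar0 : hbar != 0.
Variables (k : nat) (V : {lrmorphism yangian g hbar -> 'M[Cplx R]_k}).
Local Notation C := (Cplx R).
Implicit Types i : 'I_n.

Definition xicoef i : nat -> 'M[C]_k :=
  fun r => if r is l.+1 then hbar *: V (yxi g hbar i l) else 0.

Definition tcoef i : nat -> 'M[C]_k :=
  fun r => if r is l.+1 then hbar *: V (yt g hbar i l) else 0.

Lemma rep_xi i r : V (yxi g hbar i r) =
  V (yx g hbar true i r) * V (yx g hbar false i 0) -
  V (yx g hbar false i 0) * V (yx g hbar true i r).
Proof. by rewrite -yx_pm rmorphB !rmorphM. Qed.

Lemma rep_yx_succ i s : V (yx g hbar true i s.+1) =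
  (ipC R g i i)^-1 *: (V (yraise g hbar i) * V (yx g hbar true i s) -
                       V (yx g hbar true i s) * V (yraise g hbar i)).
Proof. by rewrite yx_succ linearZ /= rmorphB !rmorphM. Qed.

Lemma nm_rep_xi i : exists B, 1 <= B /\ forall r, nm (V (yxi g hbar i r)) <= B * B ^+ r.
Proof.
have [B [B1 hB]] := nm_iter_comm (V (yx g hbar false i 0)) (rep_yx_succ i).
by exists B; split=> // r; rewrite rep_xi.
Qed.

Lemma geom_xi_germ i : exists B,
  geom B (fun u => xi_germ V i u - 1) (xicoef i).
Proof.
have [B [B1 hB]] := nm_rep_xi i; have B0 : 0 < B by apply: lt_le_trans B1; exact: ltr01.
pose a r : 'M[C]_k := if r is l.+1 then V (yxi g hbar i l) else 0.
have ha (r : nat) : nm (a r) <= B * B ^+ r.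
  case: r => [|r]; first by rewrite nm0 expr0 mulr1 ltW.
  by apply: le_trans (hB r) _; rewrite ler_pM2l// exprS ler_peMl// exprn_ge0// ltW.
pose L u := limn (fun N => \sum_(0 <= r < N) u ^- r.+1 *: V (yxi g hbar i r)).
have hL : geom (2 * B) L a.
  apply: geom_limn => // u uB; have [l hl] := mcvg_coefs B0 ha uB.
  have -> : L u = l; last exact: hl.
  apply: mcvg_limn; apply: (mcvg_ext _ (mcvg_shift 1 hl)) => N.
  by rewrite addn1 /psum big_ord_recl scaler0 add0r big_mkord.
have [B' hB'] := geomZ hbar hL; exists B'.
apply: geom_coef (geom_ext _ hB') => [[|j]//|u _]; first by rewrite scaler0.
by rewrite /xi_germ -/(L u); move: (hbar *: L u) => X; rewrite addrC addKr.
Qed.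

Lemma xi_germ_near1 i (e : R) : 0 < e -> exists M : R, 0 <= M /\
  forall u, M < cmod u -> nm (xi_germ V i u - 1) <= e.
Proof.
move=> e0; have [B hB] := geom_xi_germ i; have [B1 _ _] := hB.
have B0 : 0 < B by apply: lt_le_trans B1; exact: ltr01.
have D0 : 0 < B * B / e by rewrite divr_gt0// mulr_gt0.
exists (B + B * B / e); split=> [|u hu]; first by lra.
have Bu : B <= cmod u by lra.
apply: le_trans (geom_bound1 _ hB Bu) _ => //.
have u0 : 0 < cmod u by lra.
rewrite mulrA ler_pdivrMr// [e * _]mulrC -ler_pdivrMr//; lra.
Qed.

(** The [xi_r] are the commutators of the iterates [x^+_r] with [x^-_0]. *)
Lemma xi_germ_rational i : rational_germ (xi_germ V i).
Proof.
have [B hB] := geom_xi_germ i; have [B' hB'] := geom_cst (1 : 'M[C]_k).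
have [D hD] := geomDe hB' hB.
have [p p0 hp] := recurrence_iter_comm (V (yx g hbar false i 0)) (rep_yx_succ i).
have hD' : geom D (xi_germ V i) (fun j => (if j is 0%N then 1 else 0) + xicoef i j).
  apply: geom_ext hD => u _; move: (xi_germ V i u) => X; exact: subrKC.
apply: (rational_recurrence hD' p0) => r.
have e0 := congr1 (fun X => hbar *: X) (hp r); rewrite scaler0 in e0.
apply: etrans e0; rewrite scaler_sumr; apply: eq_bigr => j _; rewrite /xicoef add0r rep_xi.
by move: (_ - _) => X; rewrite !scalerA [hbar * _]mulrC.
Qed.

Lemma xi_germ_inv_rational i : rational_germ (fun u => invmx (xi_germ V i u)).
Proof.
apply: rational_invmx (xi_germ_rational i) _; apply/for_largeP.
have e0 : 0 < 1 / 2 :> R by lra.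
have [M [_ hM]] := xi_germ_near1 i e0.
by exists M => u /hM h; apply: unitmx_near1; lra.
Qed.

Lemma sigma_bounded : exists M : R, forall i a, sigma V i a -> cmod a <= M.
Proof.
have h i : exists M : R, 0 <= M /\ forall a, sigma V i a -> cmod a <= M.
  have [M hM] := rational_poles_bounded (xi_germ_rational i).
  have [M' hM'] := rational_poles_bounded (xi_germ_inv_rational i).
  exists (`|M| + `|M'|); split=> [|a [/hM|/hM'] ha]; first exact: addr_ge0.
    by apply: le_trans ha _; apply: le_trans (ler_norm M) _; rewrite lerDl.
  by apply: le_trans ha _; apply: le_trans (ler_norm M') _; rewrite lerDr.
have [f hf] := choice h; exists (\sum_i f i) => i a /(hf i).2 ha.
apply: le_trans ha _; rewrite (bigD1 i)//= lerDl.
by apply: sumr_ge0 => j _; exact: (hf j).1.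
Qed.

Lemma mlog_xicoef i r : mlog (xicoef i) r = tcoef i r.
Proof.
case: r => [|r]; first by rewrite /mlog big_geq.
rewrite /mlog /tcoef /yt linearZ scalerA divff// scale1r /fps_log1p linear_sum /=.
apply: eq_bigr => m _; rewrite linearZ /=; congr (_ *: _).
rewrite (fps_pow_morph V); congr (fps_pow _ m _); apply/funext => -[|l] /=.
  by rewrite rmorph0.
by rewrite linearZ.
Qed.

Lemma yt_comm i (j : 'I_n) r s : GRing.comm (yt g hbar i r) (yt g hbar j s).
Proof.
have h i' x : (forall l, GRing.comm x (yxi g hbar i' l)) -> forall r, GRing.comm x (yt g hbar i' r).
  move=> xc r'; rewrite /GRing.comm /yt -scalerAr -scalerAl; congr (_ *: _).
  apply: fps_log1p_comm => -[|l]; first exact: commr0.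
  by rewrite /GRing.comm -scalerAr -scalerAl; congr (_ *: _); exact: xc.
apply: (h) => l; apply: commr_sym; apply: (h) => l'; exact: yxi_comm.
Qed.

Lemma tcoef_comm i (j : 'I_n) r s : tcoef i r * tcoef j s = tcoef j s * tcoef i r.
Proof.
case: r s => [|r] [|s]; rewrite ?mulr0 ?mul0r// /tcoef !mxZl !mxZr.
by rewrite -!rmorphM yt_comm !scalerA.
Qed.

(** Far from the origin there are no cuts and no poles, so that [t_i] is there a
logarithm of [xi_i]; being small, it is the one given by the logarithmic series. *)
Lemma tfun_geom t i : is_tfun V t -> exists B,
  geom B (t i) (tcoef i) /\ forall u, B <= cmod u -> derivable (t i) u 1.
Proof.
move=> /(_ i) [ht1 ht2 ht3]; have [Ms hMs] := sigma_bounded.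
have far u : Ms < cmod u -> (~` \bigcup_(a in sigma V i)
    [set real_to_C x * a | x in [set x : R | 0 <= x <= 1]]) u.
  move=> Mu [a /hMs ha [x /andP[x0 x1] /= ua]]; move: Mu; rewrite -ua cmodM cmod_real.
  rewrite ger0_norm// ltNge; apply/negP/negPn; apply: le_trans ha.
  by rewrite ler_piMl// cmod_ge0.
have [M1 hM1] := rat_extE (xi_germ_rational i).
have [B hB] := geom_xi_germ i.
pose e : R := 1 / (4 * (k * k).+1%:R).
have e0 : 0 < e by rewrite divr_gt0// mulr_gt0.
have /for_largeP[M2 hM2] := ht3 e e0.
pose B' := B + `|Ms| + 1 + `|M1| + `|M2|.
have [[N1 N2] N3] := (ler_norm Ms, ler_norm M1, ler_norm M2).
have [[P1 P2] P3] := (normr_ge0 Ms, normr_ge0 M1, normr_ge0 M2).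
have [B1 _ _] := hB.
have hB' : geom B' (fun u => xi_germ V i u - 1) (xicoef i).
  by apply: geom_mono hB; rewrite /B'; lra.
have := @geom_log R k B' (fun u => xi_germ V i u - 1) (xicoef i) (t i) erefl hB'.
case=> [u uB|D hD].
  have h1 : Ms < cmod u by apply: lt_le_trans uB; rewrite /B'; lra.
  have h2 : M1 < cmod u by apply: lt_le_trans uB; rewrite /B'; lra.
  have h3 : M2 < cmod u by apply: lt_le_trans uB; rewrite /B'; lra.
  split.
    rewrite (ht2 u (far u h1)) /xi_fun hM1//; move: (xi_germ V i u) => X.
    exact: esym (subrKC _ _).
  apply: le_trans (nm_le_normr (ltW (hM2 u h3))) _.
  have kS : (k * k)%:R <= (k * k).+1%:R :> R by rewrite ler_nat.
  by rewrite /e mulrA ler_pdivrMr ?mulr_gt0//; lra.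
exists (Num.max D B'); split.
  apply: geom_mono (geom_coef (mlog_xicoef i) hD); by rewrite le_max lexx.
move=> u; rewrite ge_max => /andP[_ uB]; apply: ht1; apply: far.
by apply: lt_le_trans uB; rewrite /B'; lra.
Qed.

End Representation.

(** * Formal translations *)

Lemma strong_recursion (T : Type) (t0 : T) (Phi : nat -> (nat -> T) -> T) :
  (forall k f f', (forall j, (j < k)%N -> f j = f' j) -> Phi k f = Phi k f') ->
  exists f, forall k, f k = Phi k f.
Proof.
move=> loc; pose F := fix F p := if p is q.+1 then fun k => Phi k (F q) else fun=> t0.
have stable k : forall p q, (k < p)%N -> (k < q)%N -> F p k = F q k.
  elim/ltn_ind: k => k IH [|p] [|q] //; rewrite !ltnS => kp kq /=.
  by apply: loc => j jk; apply: IH => //; [exact: leq_trans jk kp|exact: leq_trans jk kq].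
exists (fun k => F k.+1 k) => k /=; apply: loc => j jk.
exact: (stable j k j.+1 jk (ltnSn j)).
Qed.

Section FormalShift.
Variable R : realType.
Local Notation C := (Cplx R).
Local Notation D := (@fps_deriv C).
Implicit Types (f : fps C) (a b : C).

Lemma iter_fps_deriv m f k :
  iter m D f k = (-1) ^+ m * (k.-1 ^_ m)%:R * f (k - m)%N.
Proof.
elim: m k => [|m IH] k; first by rewrite expr0 ffactn0 subn0 !mul1r.
rewrite iterS /fps_deriv -/(iter m D f) IH ffactnS natrM exprS.
have -> : (k.-1 - m = k - m.+1)%N by rewrite -subn1 -subnDA.
by ring.
Qed.

Lemma iter_fps_deriv_eq0 m f k : (k <= m)%N -> (k, m) <> (0%N, 0%N) ->
  iter m D f k = 0.
Proof.
case: k => [|k] km h; rewrite iter_fps_deriv ffact_small ?mulr0 ?mul0r//.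
by case: m km h.
Qed.

(** Taylor's formula: translation is the exponential of differentiation. *)
Lemma fps_shift_taylor a f k P : (k < P)%N ->
  fps_shift a f k = \sum_(m < P) a ^+ m / m`!%:R * iter m D f k.
Proof.
move=> kP; rewrite -(subnKC kP) big_split_ord /= [X in _ + X]big1 ?addr0; last first.
  move=> m _; rewrite -[X in _ * X = _]/(iter (k.+1 + m) D f k).
  by rewrite iter_fps_deriv_eq0 ?mulr0//; lia.
rewrite /fps_shift (reindex_inj rev_ord_inj) /=; apply: eq_bigr => -[m /= mk] _.
rewrite subSS subKn// iter_fps_deriv -bin_ffact natrM.
have := pnatr_eq0 C m`!; rewrite eqn0Ngt fact_gt0 /= => /negbT m0.
by field.
Qed.

Lemma fps_shift_deriv a f : fps_shift a (D f) = D (fps_shift a f).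
Proof.
apply/funext => k; rewrite (fps_shift_taylor _ _ (ltnSn k)) /fps_deriv -/(fps_shift a f k.-1).
have kP : (k.-1 < k.+1)%N by rewrite ltnS leq_pred.
rewrite (fps_shift_taylor _ _ kP) mulr_sumr; apply: eq_bigr => m _.
by rewrite -iterSr iterS mulrCA.
Qed.

Lemma fps_shift_iter_deriv a f m : fps_shift a (iter m D f) = iter m D (fps_shift a f).
Proof. by elim: m f => [|m IH] f //; rewrite !iterS fps_shift_deriv IH. Qed.

(** The binomial theorem, in the form of the functional equation of the
exponential. *)
Lemma fps_shiftD a b f : fps_shift a (fps_shift b f) = fps_shift (a + b) f.
Proof.
apply/funext => k; set P := k.+1; have kP : (k < P)%N := ltnSn k.
rewrite !(fps_shift_taylor _ _ kP).
pose c (m l : nat) : C := (a ^+ m / m`!%:R) * (b ^+ l / l`!%:R).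
have h (m : 'I_P) : a ^+ m / m`!%:R * iter m D (fps_shift b f) k =
    \sum_(i < P) if (m <= i)%N then c m (i - m)%N * iter i D f k else 0.
  have vanish i : (P <= i)%N -> iter i D f k = 0.
    move=> Pi; apply: iter_fps_deriv_eq0; first exact: leq_trans Pi.
    by move=> [_ i0]; move: Pi; rewrite i0.
  rewrite -fps_shift_iter_deriv (fps_shift_taylor _ _ kP) mulr_sumr.
  transitivity (\sum_(0 <= l < P) c m l * iter (l + m) D f k).
    by rewrite big_mkord; apply: eq_bigr => l _; rewrite /c iterD mulrA.
  rewrite -big_mkcond -[RHS](big_mkord (fun i => (m <= i)%N)
    (fun i => c m (i - m)%N * iter i D f k)).
  have mP : (m <= P)%N := ltnW (ltn_ord m).
  rewrite [RHS](big_cat_nat (n := m)) //= [X in _ = X + _]big1_seq ?add0r; last first.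
    by move=> i /andP[mi]; rewrite mem_index_iota => /andP[_]; rewrite ltnNge mi.
  rewrite (big_cat_nat (n := (P - m)%N)) ?leq_subr//= [X in _ + X]big1_seq ?addr0; last first.
    by move=> i /andP[_]; rewrite mem_index_iota => /andP[mi _]; rewrite vanish ?mulr0//; lia.
  rewrite -[X in _ = \sum_(X <= _ < _ | _) _]add0n [RHS]big_addn big_mkord [RHS]big_mkord.
  by apply: eq_big => [l|l _]; rewrite ?leq_addl// addnK.
rewrite (eq_bigr _ (fun m _ => h m)) exchange_big; apply: eq_bigr => -[i /= iP] _.
rewrite -big_mkcond /= -mulr_suml; congr (_ * _).
rewrite -(big_mkord (fun m => (m <= i)%N) (fun m => c m (i - m)%N)).
rewrite (big_cat_nat (n := i.+1)) //= [X in _ + X]big1_seq ?addr0; last first.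
  by move=> m /andP[mi]; rewrite mem_index_iota => /andP[]; rewrite ltnNge mi.
rewrite big_mkord addrC exprDn mulr_suml; apply: eq_big => [[m mi]//|[m /= mi] _].
have fm : (m`!)%:R != 0 :> C by rewrite pnatr_eq0 -lt0n fact_gt0.
have fim : ((i - m)`!)%:R != 0 :> C by rewrite pnatr_eq0 -lt0n fact_gt0.
have fb : 'C(i, m)%:R != 0 :> C by rewrite pnatr_eq0 -lt0n bin_gt0.
rewrite -(@bin_fact i m) // !natrM /c -[X in _ = X / _]mulr_natl; field.
by rewrite fm fim fb.
Qed.

Lemma fps_shiftC a b f : fps_shift a (fps_shift b f) = fps_shift b (fps_shift a f).
Proof. by rewrite !fps_shiftD addrC. Qed.

Lemma fps_shift0 f : fps_shift 0 f = f.
Proof.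
apply/funext => k; rewrite (fps_shift_taylor _ _ (ltnSn k)) big_ord_recl /= expr0 mul1r invr1 mul1r.
by rewrite big1 ?addr0// => i _; rewrite expr0n /= mul0r mul0r.
Qed.

(** In degree [k + 1] the equation reads [k f_k = \sum_(j < k) c_j f_j + (k == 1)],
which defines [f_k] for [k > 0] by recursion. *)
Lemma gserP : gser C 0%N = 0 /\
  forall k, fps_shift 1 (gser C) k = gser C k - (k == 2%N)%:R.
Proof.
apply: (@xgetPex _ _ [set f : fps C | f 0%N = 0 /\
  forall k, fps_shift 1 f k = f k - (k == 2%N)%:R]).
pose c k j : C := (-1) ^+ (k - j) * 'C(k.-1, k - j)%:R * 1 ^+ (k - j).
(* Degree [1] of the equation is trivial, which leaves [f 0 = 0] free to choose. *)
pose Phi k (f : nat -> C) : C := if k == 0%N then 0 else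
  k%:R^-1 * (\sum_(j < k) c k.+1 j * f j + (k == 1%N)%:R).
have [k f f' ff'|f hf] := @strong_recursion C 0 Phi.
  rewrite /Phi; case: (k == 0%N) => //; congr (_ * (_ + _)).
  by apply: eq_bigr => -[j jk] _; rewrite ff'.
exists f; have f0 : f 0%N = 0 by rewrite hf.
split=> // -[|[|k]].
- by rewrite /fps_shift big_ord1 /= f0 mulr0 subr0.
- rewrite /fps_shift big_ord_recl big_ord1 /= f0 mulr0 add0r subr0.
  by rewrite !expr0 bin0 !mul1r.
rewrite /fps_shift big_ord_recr /= subnn !expr0 bin0 !mul1r [LHS]addrC; congr (_ + _).
rewrite big_ord_recr /= subSn// subnn bin1 !expr1.
have k0 : k.+1%:R != 0 :> C by rewrite pnatr_eq0.
have := hf k.+1; rewrite /Phi /= => /(congr1 (fun x => k.+1%:R * x)).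
rewrite mulrA divff// mul1r => h.
rewrite mulr1 mulN1r mulNr h !eqSS /c /= opprD addrA subrr add0r//.
Qed.

Lemma gser_scaled (tau : C) k :
  fps_shift tau (fun p => gser C p * tau ^+ p) k =
  gser C k * tau ^+ k - tau ^+ 2 * (k == 2%N)%:R.
Proof.
have [_ hg] := gserP.
have -> : fps_shift tau (fun p => gser C p * tau ^+ p) k = tau ^+ k * fps_shift 1 (gser C) k.
  rewrite /fps_shift mulr_sumr; apply: eq_bigr => -[j /= jk] _.
  have -> : tau ^+ k = tau ^+ (k - j) * tau ^+ j by rewrite -exprD subnK.
  by rewrite expr1n; ring.
rewrite hg mulrBr mulrC; congr (_ - _); case: (k =P 2%N) => [->//|_].
by rewrite !mulr0.
Qed.

Lemma iter_deriv_delta2 m k :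
  iter m D (fun p => (p == 2%N)%:R) k = (-1) ^+ m * m.+1`!%:R * (k == m.+2)%:R.
Proof.
rewrite iter_fps_deriv; have [->|km] := eqVneq k m.+2.
  rewrite /= subSn// subSn// subnn eqxx; congr (_ * _ * _).
  by rewrite -(ffactnn m.+1) ffactnSr subSn// subnn muln1.
have [mk|mk] := leqP k m.
  have := @iter_fps_deriv_eq0 m (fun=> 1) k mk.
  case: k km mk => [|k] km mk; last by rewrite ffact_small ?mulr0 ?mul0r.
  by rewrite sub0n !mulr0.
have /negbTE -> : (k - m)%N != 2%N by lia.
by rewrite !mulr0.
Qed.

Lemma fps_shiftE a f k : fps_shift a f k = \sum_(j < k.+1) shiftc a k j * f j.
Proof. by []. Qed.

End FormalShift.

(** * The formal logarithm solves the difference equation *)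

Section Contraction.
Variables (R : realType) (k1 k2 : nat).
Local Notation C := (Cplx R).
Local Notation D := (@fps_deriv C).
Variables (a : nat -> 'M[C]_k1) (b : nat -> 'M[C]_k2).

(** The operator [\sum_(l, m) (D^l / l!) (x) ((- D)^m / m!)] paired with coefficients of
[a] and [b], applied to [f]: the image of [BB] under two representations.  In
degree [p] the derivatives of order at least [p] vanish, so that any [P >= p]
gives the full sum, if [f 0 = 0]. *)
Definition contract (P : nat) (f : fps C) (p : nat) : 'M[C]_(k1 * k2) :=
  \sum_(l < P) \sum_(m < P)
    ((-1) ^+ m / (l`! * m`!)%:R * iter (l + m) D f p) *: (a l.+1 *t b m.+1).

Lemma contract_widen P p f : f 0%N = 0 -> (p <= P)%N ->
  contract P f p = contract p f p.
Proof.
move=> f0 pP; have z l m : ((p <= l) || (p <= m))%N -> iter (l + m) D f p = 0.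
  move=> h; have [e|/eqP ne] := eqVneq (p, (l + m)%N) (0%N, 0%N).
    by case: e => -> ->.
  by apply: iter_fps_deriv_eq0 => //; lia.
rewrite /contract (big_ord_widen P (fun l => \sum_(m < p)
  ((-1) ^+ m / (l`! * m`!)%:R * iter (l + m) D f p) *: (a l.+1 *t b m.+1)) pP).
rewrite [RHS]big_mkcond; apply: eq_bigr => l _; case: ifPn => lp; last first.
  by apply: big1 => m _; rewrite z ?mulr0 ?scale0r// leqNgt lp.
rewrite (big_ord_widen P (fun m =>
  ((-1) ^+ m / (l`! * m`!)%:R * iter (l + m) D f p) *: (a l.+1 *t b m.+1)) pP).
rewrite [RHS]big_mkcond; apply: eq_bigr => m _; case: ifPn => mp //.
by rewrite z ?mulr0 ?scale0r// [(p <= m)%N]leqNgt mp orbT.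
Qed.

Lemma contract_shift P c f p :
  mshift c (contract P f) p = contract P (fps_shift c f) p.
Proof.
rewrite /mshift /contract.
under eq_bigr => j _ do rewrite scaler_sumr.
rewrite exchange_big; apply: eq_bigr => l _ /=.
under eq_bigr => j _ do rewrite scaler_sumr.
rewrite exchange_big; apply: eq_bigr => m _ /=.
under eq_bigr => j _ do rewrite scalerA.
rewrite -scaler_suml; congr (_ *: _).
rewrite -fps_shift_iter_deriv fps_shiftE mulr_sumr; apply: eq_bigr => j _.
exact: mulrCA.
Qed.

Lemma contract_sub P (f h : fps C) (c : C) p :
  contract P (fun q => f q - c * h q) p = contract P f p - c *: contract P h p.
Proof.
rewrite /contract scaler_sumr -sumrB; apply: eq_bigr => l _.
rewrite scaler_sumr -sumrB; apply: eq_bigr => m _.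
rewrite scalerA -scalerBl; congr (_ *: _); rewrite !iter_fps_deriv; ring.
Qed.

(** The two-fold sum over the derivatives of [x^-2] collects, in each degree,
the same products of coefficients as the residue defining the contour integral
of [a'(v) (x) b(v + s)]. *)
Lemma contract_delta2 P p : b 0%N = 0 -> (p <= P)%N ->
  contract P (fun q => (q == 2%N)%:R) p = jcoef (mderiv a) b p.
Proof.
move=> b0 pP; rewrite /jcoef big_ord_recl /= b0.
have -> (X : 'M[C]_k1) : X *t (0 : 'M[C]_k2) = 0.
  by apply/matrixP => i j; rewrite !mxE mulr0.
rewrite scaler0 add0r.
pose J m : 'M[C]_(k1 * k2) := ((-1) ^+ (p - m.+1) * 'C(p.-1, p - m.+1)%:R) *:
    (mderiv a (p - m.+1).+1 *t b m.+1).
rewrite -[RHS]/(\sum_(m < p) J m) (big_ord_widen P J pP) big_mkcond /=.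
rewrite /contract exchange_big; apply: eq_bigr => -[m /= mP] _.
under eq_bigr => l _ do rewrite iter_deriv_delta2.
have [mp|pm] := ltnP m p; last first.
  apply: big1 => -[l /= lP] _.
  by have /negbTE -> : p != (l + m).+2 by [lia]; rewrite !mulr0 scale0r.
rewrite /J; case e : (p - m.+1)%N => [|l].
  rewrite /mderiv /= oppr0 scale0r.
  have -> (X : 'M[C]_k2) : (0 : 'M[C]_k1) *t X = 0.
    by apply/matrixP => i j; rewrite !mxE mul0r.
  rewrite scaler0; apply: big1 => -[l /= lP] _.
  by have /negbTE -> : p != (l + m).+2 by [lia]; rewrite !mulr0 scale0r.
have lP : (l < P)%N by lia.
have pE : p = (l + m).+2 by lia.
rewrite (bigD1 (Ordinal lP)) //= [X in _ + X]big1 ?addr0; last first.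
  move=> -[l' /= l'P] ne; have /negbTE -> : p != (l' + m).+2.
    by apply: contraNneq ne => h; apply/eqP/val_inj => /=; lia.
  by rewrite !mulr0 scale0r.
rewrite -pE eqxx mulr1 /mderiv /= tens_Zl scalerA; congr (_ *: _).
have fl : (l`!)%:R != 0 :> C by rewrite pnatr_eq0 -lt0n fact_gt0.
have fm : (m`!)%:R != 0 :> C by rewrite pnatr_eq0 -lt0n fact_gt0.
have hb : 'C((l + m).+1, l.+1)%:R * (l.+1%:R * (l`!)%:R * (m`!)%:R) = ((l + m).+1`!)%:R :> C.
  rewrite -!natrM -factS.
  have lm : (l.+1 <= (l + m).+1)%N by lia.
  by rewrite -(bin_fact lm) subSS addKn.
have em : (-1) ^+ m * (-1) ^+ m = 1 :> C by rewrite -expr2 sqrr_sign.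
rewrite pE /= -hb natrM exprD exprS; set s := (-1) ^+ m.
rewrite (_ : s / _ * _ = (s * s) * ((-1) ^+ l * 'C((l + m).+1, l.+1)%:R * l.+1%:R)); last first.
  by field; rewrite fm fl.
by rewrite em; ring.
Qed.

End Contraction.

Section MshiftLinear.
Variables (R : realType) (k : nat).
Local Notation C := (Cplx R).
Implicit Types u v : nat -> 'M[C]_k.

Lemma mshift_local c u v p : (forall j, (j <= p)%N -> u j = v j) ->
  mshift c u p = mshift c v p.
Proof. by move=> uv; apply: eq_bigr => -[j /= jp] _; rewrite uv. Qed.

Lemma mshift_sum c I (r : seq I) (Q : pred I) (u : I -> nat -> 'M[C]_k) p :
  mshift c (fun q => \sum_(i <- r | Q i) u i q) p = \sum_(i <- r | Q i) mshift c (u i) p.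
Proof.
rewrite /mshift exchange_big; apply: eq_bigr => j _; exact: scaler_sumr.
Qed.

Lemma mshiftZ c d u p : mshift c (fun q => d *: u q) p = d *: mshift c u p.
Proof.
rewrite /mshift scaler_sumr; apply: eq_bigr => j _.
by rewrite !scalerA [X in X *: _]mulrC.
Qed.

End MshiftLinear.

(** The scaled series [g] satisfies [g (s + tau) = g (s) - tau^2 s^-2], and every
operator in sight commutes with translations. *)
Lemma contract_difference (R : realType) (k1 k2 : nat)
    (a : nat -> 'M[Cplx R]_k1) (b : nat -> 'M[Cplx R]_k2) (tau c : Cplx R) P p :
  b 0%N = 0 -> (p <= P)%N ->
  let u := contract a b P (fps_shift c (fun q => gser (Cplx R) q * tau ^+ q)) in
  mshift tau u p - u p = - tau ^+ 2 *: mshift c (jcoef (mderiv a) b) p.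
Proof.
move=> b0 pP u; rewrite /u contract_shift fps_shiftC.
have -> : fps_shift tau (fun q => gser (Cplx R) q * tau ^+ q) =
    (fun q => gser (Cplx R) q * tau ^+ q - tau ^+ 2 * (q == 2%N)%:R).
  by apply/funext => q; exact: gser_scaled.
rewrite -!contract_shift.
have <- : mshift c (contract a b P (fun q => (q == 2%N)%:R)) p =
    mshift c (jcoef (mderiv a) b) p.
  apply: mshift_local => j jp.
  by rewrite (contract_delta2 a b0 (leq_trans jp pP)).
have -> : mshift c (contract a b P
      (fun q => gser (Cplx R) q * tau ^+ q - tau ^+ 2 * (q == 2%N)%:R)) p =
    mshift c (contract a b P (fun q => gser (Cplx R) q * tau ^+ q)) p -
    tau ^+ 2 *: mshift c (contract a b P (fun q => (q == 2%N)%:R)) p.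
  rewrite -mshiftZ /mshift -sumrB; apply: eq_bigr => j _.
  by rewrite contract_sub scalerBr.
move: (mshift c _ p) (mshift c _ p) => X Y.
by rewrite addrAC subrr add0r scaleNr.
Qed.

(** * The image of the formal series in a tensor product of representations *)

Section TensMap.
Variables (K : comPzRingType) (A B : algType K) (n1 n2 : nat).
Variables (f : {lrmorphism A -> 'M[K]_n1}) (h : {lrmorphism B -> 'M[K]_n2}).
Local Notation T := (@tens_map K A B n1 n2 f h).

Let aevalE t : T (apres (@tens_rel K A B) t) = aeval (@tens_gen_map K A B n1 n2 f h) t.
Proof. by apply: palg_lift_apres; exact: tens_gen_map_rel. Qed.

Lemma tens_map_is_zmod_morphism : zmod_morphism T.
Proof.
elim/palg_ind => x; elim/palg_ind => y.
by rewrite -apresN -apresD !aevalE.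
Qed.

Lemma tens_map_is_scalable : scalable T.
Proof. by move=> c; elim/palg_ind => x; rewrite -apresZ !aevalE. Qed.

Lemma tens_map_is_monoid_morphism : monoid_morphism T.
Proof.
split; first by rewrite -apres1 aevalE.
by elim/palg_ind => x; elim/palg_ind => y; rewrite -apresM !aevalE.
Qed.

HB.instance Definition _ := GRing.isZmodMorphism.Build (tensalg A B) 'M[K]_(n1 * n2) T
  tens_map_is_zmod_morphism.
HB.instance Definition _ := GRing.isMonoidMorphism.Build (tensalg A B) 'M[K]_(n1 * n2) T
  tens_map_is_monoid_morphism.
HB.instance Definition _ := GRing.isScalable.Build K (tensalg A B) 'M[K]_(n1 * n2) *:%R T
  tens_map_is_scalable.

End TensMap.

Section QuantumCartan.
Variables (n : nat) (g : semisimple n).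
Implicit Types (S : {set 'I_n}) (i j : 'I_n).

Lemma qcoef_finite S i j : finite_set [set r | qcoef g S i j r != 0%N].
Proof.
rewrite /qcoef; case: xgetP => [c _ [fc _] //|_].
by rewrite (_ : [set r | _] = set0)//; apply/seteqP; split.
Qed.

Definition qsupp S i j : seq int := finmap.enum_fset (fset_set [set r | qcoef g S i j r != 0%N]).

Lemma qcoef_sum (K : pzRingType) (U : lmodType K) S i j (F : int -> U) :
  \sum_(r \in [set: int]) (qcoef g S i j r)%:R *: F r =
  \sum_(r <- qsupp S i j) (qcoef g S i j r)%:R *: F r.
Proof.
apply: fsbigTE => r; rewrite in_fset_set; last exact: qcoef_finite.
rewrite notin_setE /= => /negP/negPn/eqP ->.
exact: scale0r.
Qed.

End QuantumCartan.

Section FormalImage.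
Variables (R : realType) (n : nat) (g : semisimple n) (hbar : Cplx R).
Hypothesis hbar0 : hbar != 0.
Local Notation C := (Cplx R).
Local Notation Y := (yangian g hbar).
Variables (k1 k2 : nat).
Variables (V1 : {lrmorphism Y -> 'M[C]_k1}) (V2 : {lrmorphism Y -> 'M[C]_k2}).
Local Notation T := (tens_map V1 V2).
Implicit Types (S : {set 'I_n}) (i j : 'I_n).

Definition log_formal S (p : nat) : 'M[C]_(k1 * k2) := T (logR0 g hbar S p).

Lemma tens_map_BB i j (f : fps C) p P : f 0%N = 0 -> (p <= P)%N ->
  T (BB g hbar i j f p) = contract (tcoef V1 i) (tcoef V2 j) P f p.
Proof.
move=> f0 pP; rewrite contract_widen// /BB linear_sum; apply: eq_bigr => l _.
rewrite linear_sum; apply: eq_bigr => m _; rewrite linearZ /= tens_mapE.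
rewrite /tcoef tens_Zl tens_Zr !scalerA; congr (_ *: _).
by ring.
Qed.

(** The coefficients at infinity of [log A]. *)
Definition lcoef S (p : nat) : 'M[C]_(k1 * k2) :=
  - \sum_(i in S) \sum_(j in S) \sum_(r <- qsupp g S i j) (qcoef g S i j r)%:R *:
    mshift ((ellC R g S + r%:~R) / 2 * hbar)
      (jcoef (mderiv (tcoef V1 i)) (tcoef V2 j)) p.

Lemma log_formalE S p P : (p <= P)%N -> log_formal S p =
  ((ellC R g S * hbar) ^+ 2)^-1 *:
    \sum_(i in S) \sum_(j in S) \sum_(r <- qsupp g S i j) (qcoef g S i j r)%:R *:
      contract (tcoef V1 i) (tcoef V2 j) P
        (fps_shift ((ellC R g S + r%:~R) / 2 * hbar)
           (fun q => gser C q * (ellC R g S * hbar) ^+ q)) p.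
Proof.
move=> pP; rewrite /log_formal /logR0 linearZ /=; congr (_ *: _).
rewrite linear_sum; apply: eq_bigr => i _.
rewrite linear_sum; apply: eq_bigr => j _; rewrite qcoef_sum.
rewrite linear_sum; apply: eq_bigr => r _.
rewrite linearZ /=; congr (_ *: _); apply: tens_map_BB => //.
by rewrite /fps_shift big_ord1 /= (@gserP R).1 mul0r mulr0.
Qed.

Lemma log_formal0 S : log_formal S 0%N = 0.
Proof.
rewrite (log_formalE _ (leqnn 0)).
rewrite big1 ?scaler0// => i _; apply: big1 => j _; apply: big1 => r _.
by rewrite /contract big_ord0 scaler0.
Qed.

(** Termwise this is [contract_difference]; the factors [tau ^+ 2] cancel. *)
Lemma log_formal_difference S p : ellC R g S != 0 ->
  mshift (ellC R g S * hbar) (log_formal S) p - log_formal S p = lcoef S p.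
Proof.
move=> ell0; set tau := ellC R g S * hbar.
have tau0 : tau != 0 by rewrite mulf_neq0.
rewrite (log_formalE _ (leqnn p)).
rewrite (@mshift_local _ _ _ _ _ _ (fun q jp => log_formalE S jp)).
rewrite mshiftZ mshift_sum -scalerBr -sumrB /lcoef -sumrN scaler_sumr.
apply: eq_bigr => i _; rewrite mshift_sum -sumrB -sumrN scaler_sumr.
apply: eq_bigr => j _; rewrite mshift_sum -sumrB -sumrN scaler_sumr.
apply: eq_bigr => r _; rewrite mshiftZ -scalerBr.
rewrite (contract_difference _ _ _ _ (leqnn p))//.
rewrite !scalerA -[RHS]scaleNr; congr (_ *: _).
by rewrite mulrAC mulrN mulVf ?expf_neq0// mulN1r.
Qed.

Lemma R0_formalE p : R0_formal V1 V2 p =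
  (\big[@fps_mul _/@fps_one _]_(S in simple_factors g) fpsexp (log_formal S)) p.
Proof.
have TM (a b : fps (tensalg Y Y)) :
    (fun q => T (fps_mul a b q)) = fps_mul (fun q => T (a q)) (fun q => T (b q)).
  apply/funext => q; rewrite /fps_mul rmorph_sum; apply: eq_bigr => j _.
  exact: rmorphM.
have T1 : (fun q => T (@fps_one (tensalg Y Y) q)) = @fps_one _.
  by apply/funext => q; rewrite /fps_one rmorph_nat.
have := big_morph (fun (a : fps (tensalg Y Y)) q => T (a q)) TM T1.
move=> /(_ _ (index_enum _) (fun S => S \in simple_factors g)
  (fun S => fps_expt (logR0 g hbar S))) /(congr1 (fun a => a p)).
move=> e; apply: (etrans e); congr (_ p); apply: eq_bigr => S _; apply/funext => q.
rewrite /fps_expt linear_sum; apply: eq_bigr => m _.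
by rewrite linearZ /= fps_pow_morph.
Qed.

End FormalImage.

(** * Positivity of the shift parameter *)

Section ShiftParameter.
Variables (n : nat) (g : semisimple n) (S : {set 'I_n}).

Lemma iproot_ge0 x : 0 <= iproot g x x.
Proof.
have [->|x0] := eqVneq x 0; last exact: ltW (cartan_posdef g x0).
by rewrite /iproot big1// => i _; rewrite big1// => j _; rewrite mxE !mul0r.
Qed.

Lemma ge0_divz (a b : int) : 0 <= a -> 0 <= b -> 0 <= divz a b.
Proof.
by move=> a0; rewrite le_eqVlt => /orP[/eqP <-|b0]; rewrite ?divz0// divz_ge0.
Qed.

(** Both factors of [ell] are nonnegative: the form is positive definite, and the
highest root dominates the simple roots of the factor. *)
Lemma ell_ge0 : 0 <= ell g S.
Proof.
have h0 : 0 <= half_theta2 g S by apply: ge0_divz; rewrite ?iproot_ge0.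
rewrite /ell; have [->|t0] := eqVneq (half_theta2 g S) 0; first by rewrite mul0r.
rewrite mulr_ge0// /dual_coxeter addr_ge0// sumr_ge0// => i iS.
apply: ge0_divz => //; rewrite mulr_ge0//.
move: t0; rewrite /half_theta2 /highest_root; case: xgetP => [th _ [_ hth] _|_].
  have : is_factor_root g S (simple_root i).
    split; first exact: root_simple.
    by move=> j jS; rewrite mxE (negPf (_ : j != i)) ?andbF//; apply: contraNneq jS => ->.
  by move=> /hth /(_ i); apply: le_trans; rewrite mxE !eqxx.
rewrite /iproot big1 ?div0z ?eqxx// => k _; rewrite big1// => j _.
by rewrite mxE !mul0r.
Qed.

(** After multiplication by a power of [q] this is a polynomial identity, which is
evaluated at [q = 1]. *)
Lemma qvar_lincomb_eq0 (s : seq int) (c : int -> nat) :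
  \sum_(r <- s) (c r)%:R * qvar ^ r = 0 -> forall r, r \in s -> c r = 0%N.
Proof.
move=> e0; pose M := (\sum_(r <- s) absz r)%N.
have q0 : qvar != 0 by rewrite tofrac_eq0 polyX_eq0.
have rM r : r \in s -> exists p, r + M%:Z = p%:Z.
  move=> rs; exists (absz (r + M%:Z)); rewrite gez0_abs//.
  have : (absz r <= M)%N by rewrite /M (big_rem r)//= leq_addr.
  lia.
pose P : {poly rat} := \sum_(r <- s) (c r)%:R *: 'X^(absz (r + M%:Z)).
have P0 : P = 0.
  apply/eqP; rewrite -tofrac_eq0; apply/eqP.
  have := congr1 (fun x => x * qvar ^ M%:Z) e0; rewrite mul0r mulr_suml => e1.
  rewrite -[RHS]e1 rmorph_sum; apply: eq_big_seq => r rs.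
  rewrite -mulrA -expfzDr//; have [p rp] := rM r rs; rewrite rp absz_nat.
  by rewrite -mul_polyC polyC_natr rmorphM rmorphXn rmorph_nat.
have : P.[1] = 0 by rewrite P0 horner0.
rewrite horner_sum => /eqP.
rewrite psumr_eq0; last by move=> r _; rewrite hornerZ hornerXn expr1n mulr1 ler0n.
move=> /allP h r rs; have := h r rs.
by rewrite /= hornerZ hornerXn expr1n mulr1 pnatr_eq0 => /eqP.
Qed.

(** Since [[0]_q = 0], the entry of the inverse vanishes, and the powers of [q] are
linearly independent. *)
Lemma qcoef_eq0 i j r : ell g S = 0 -> qcoef g S i j r = 0%N.
Proof.
move=> l0; rewrite /qcoef; case: xgetP => [c _ [fc]|//].
have -> : qcartan_inv g S i j = 0.
  by rewrite /qcartan_inv l0 /qint oppr0 subrr mul0r scale0r mxE.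
rewrite (@fsbigTE _ _ _ _ (fset_set [set r | c r != 0%N])); last first.
  by move=> k; rewrite in_fset_set// notin_setE /= => /negP/negPn/eqP ->; rewrite mul0r.
move=> /qvar_lincomb_eq0 h; apply/eqP/negPn/negP => cr.
have : r \in finmap.enum_fset (fset_set [set r | c r != 0%N]).
  by apply: (etrans (in_fset_set fc r)); exact: mem_set.
by move=> /h c0; rewrite c0 in cr.
Qed.

End ShiftParameter.

(** * The logarithm of the abelian R-matrix *)

Lemma mcvg_comm (R : realType) k (u : nat -> 'M[Cplx R]_k) l X :
  (forall p, u p * X = X * u p) -> mcvg u l -> l * X = X * l.
Proof.
move=> uX ul; apply: (mcvg_unique (mcvgM ul (mcvg_cst X))).
exact: (mcvg_ext (fun p => esym (uX p)) (mcvgM (mcvg_cst X) ul)).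
Qed.

Lemma geom_comm (R : realType) k (F : Cplx R -> 'M[Cplx R]_k) a (B : R) u v :
  geom B F a -> (forall p q, a p * a q = a q * a p) ->
  2 * B <= cmod u -> 2 * B <= cmod v -> F u * F v = F v * F u.
Proof.
move=> hF ac uB vB; apply: (mcvg_comm _ (geom_cvg hF uB)) => p.
apply/esym; apply: (mcvg_comm _ (geom_cvg hF vB)) => q.
rewrite /psum !mulr_suml; under eq_bigr => i _ do rewrite mulr_sumr.
under [RHS]eq_bigr => i _ do rewrite mulr_sumr.
rewrite exchange_big; apply: eq_bigr => i _; apply: eq_bigr => j _.
rewrite !mxZl !mxZr ac; move: (a _ * a _) => X.
by rewrite !scalerA [X in X *: _]mulrC.
Qed.

Section AbelianLog.
Variables (R : realType) (n : nat) (g : semisimple n) (hbar : Cplx R).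
Hypothesis hbar0 : hbar != 0.
Local Notation C := (Cplx R).
Local Notation Y := (yangian g hbar).
Variables (k1 k2 : nat).
Variables (V1 : {lrmorphism Y -> 'M[C]_k1}) (V2 : {lrmorphism Y -> 'M[C]_k2}).
Implicit Types (S : {set 'I_n}) (i j : 'I_n).

Lemma commr_scalemx k (X Z : 'M[C]_k) (c : C) : GRing.comm X Z -> GRing.comm X (c *: Z).
Proof. by rewrite /GRing.comm mxZl mxZr => ->. Qed.

Lemma lcoef_commr (X : 'M[C]_(k1 * k2)) :
  (forall i l j m, GRing.comm X (tcoef V1 i l *t tcoef V2 j m)) ->
  forall S p, GRing.comm X (lcoef V1 V2 S p).
Proof.
move=> h S p; apply: commrN; apply: commr_sum => i _; apply: commr_sum => j _.
apply: commr_sum => r _; apply: commr_scalemx; apply: commr_sum => q _.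
apply: commr_scalemx; apply: commr_sum => m _; apply: commr_scalemx.
rewrite /mderiv tens_Zl; apply: commr_scalemx; exact: h.
Qed.

Lemma lcoef_comm S p q : lcoef V1 V2 S p * lcoef V1 V2 S q =
  lcoef V1 V2 S q * lcoef V1 V2 S p.
Proof.
apply: lcoef_commr => i l j m; apply: commr_sym; apply: lcoef_commr => i' l' j' m'.
rewrite /GRing.comm -[LHS]/(_ *m _) -[RHS]/(_ *m _) !tensmx_mul.
by congr (_ *t _); exact: tcoef_comm.
Qed.

Lemma tfun_geom_uniform k (V : {lrmorphism Y -> 'M[C]_k}) t : is_tfun V t ->
  exists B, 1 <= B /\ forall i, geom B (t i) (tcoef V i) /\
    forall u, B <= cmod u -> derivable (t i) u 1.
Proof.
move=> ht; have [f hf] := choice (fun i => tfun_geom hbar0 i ht).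
exists (1 + \sum_i `|f i|); split; first by rewrite lerDl; apply: sumr_ge0 => i _; exact: normr_ge0.
move=> i; have fB : f i <= 1 + \sum_i `|f i|.
  apply: le_trans (ler_norm _) _; rewrite (bigD1 i)//= addrCA lerDl addr_ge0//.
  by apply: sumr_ge0 => j _; exact: normr_ge0.
have [h1 h2] := hf i; split; first exact: geom_mono h1.
by move=> u uB; apply: h2; apply: le_trans uB.
Qed.

(** On a large circle every [t_i] is given by its expansion, so that the contour
integrals have expansions by [geom_contour]. *)
Lemma abelian_A_log S (A : C -> 'M[C]_(k1 * k2)) : is_abelian_A V1 V2 S A ->
  exists B L, geom B L (lcoef V1 V2 S) /\ forall u, B <= cmod u -> A u = mexp (L u).
Proof.
move=> [t1 [t2 [ht1 ht2 hA]]].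
have [B1 [B11 h1]] := tfun_geom_uniform ht1.
have [B2 [B21 h2]] := tfun_geom_uniform ht2.
have [Ms hMs] := sigma_bounded V1.
pose rho := 16 * (16 * (B1 + 1) + 1) + `|Ms|.
have Ms0 := normr_ge0 Ms; have MsM := ler_norm Ms.
have rhoB : 16 * (16 * (B1 + 1) + 1) <= rho by rewrite lerDl.
have rho0 : 0 < rho by lra.
have [|rA ->] := hA rho rho0.
  move=> i a _ /hMs ha; rewrite cmodE ltcR_real; rewrite /rho; lra.
pose bet r : C := (ellC R g S + r%:~R) / 2 * hbar.
pose L s : 'M[C]_(k1 * k2) := - \sum_(i in S) \sum_(j in S)
  \sum_(r <- qsupp g S i j) (qcoef g S i j r)%:R *:
    mCi rho (fun v => derive1 (t1 i) v *t t2 j (v + (s + bet r))).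
have [B hL] : exists B, geom B L (lcoef V1 V2 S).
  suff [B hB] : exists B, geom B (fun s => - L s) (fun p => - lcoef V1 V2 S p).
    have [B' hB'] := geomZ (-1) hB; exists B'.
    by apply: geom_coef (geom_ext _ hB') => [p|u _]; rewrite scaleN1r opprK.
  suff [B hB] : exists B, geom B (fun s => \sum_(i in S) \sum_(j in S)
      \sum_(r <- qsupp g S i j) (qcoef g S i j r)%:R *:
        mCi rho (fun v => derive1 (t1 i) v *t t2 j (v + (s + bet r))))
      (fun p => \sum_(i in S) \sum_(j in S) \sum_(r <- qsupp g S i j)
        (qcoef g S i j r)%:R *:
        mshift (bet r) (jcoef (mderiv (tcoef V1 i)) (tcoef V2 j)) p).
    by exists B; apply: geom_coef (geom_ext _ hB) => [p|u _]; rewrite opprK.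
  apply: geom_sum => i _; apply: geom_sum => j _; apply: geom_sum => r _.
  have d1 : geom (16 * (B1 + 1)) (derive1 (t1 i)) (mderiv (tcoef V1 i)).
    apply: geom_derive (h1 i).1 => u uB; apply: (h1 i).2; apply: le_trans uB; lra.
  have [B3 hB3] := geom_contour d1 (h2 j).1 rhoB.
  have := geom_shift (lexx (cmod (bet r))) hB3.
  exact: geomZ.
have [M hM] := rat_extE rA.
have B0 := normr_ge0 M; have MM := ler_norm M; have [B1' _ _] := hL.
exists (B + `|M| + 1), L; split; first by apply: geom_mono hL; lra.
move=> u uB; rewrite hM; last by lra.
rewrite /abelian_A_germ /L; apply: (congr1 (@mexp R (k1 * k2))); apply: (congr1 -%R).
apply: eq_bigr => i _; apply: eq_bigr => j _; rewrite qcoef_sum.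
apply: eq_bigr => r _; rewrite circle_integralE; apply: (congr1 ( *:%R _)).
apply: (congr1 (mCi rho)); apply/funext => v.
apply: (congr1 (fun z => _ *t t2 j z)); rewrite /bet -[v + u + _]addrA.
by congr (_ + (_ + _)); rewrite [LHS]mulrAC.
Qed.

End AbelianLog.

(** * Asymptotics of the infinite products *)

Section Products.
Variables (R : realType) (k : nat).
Local Notation C := (Cplx R).
Implicit Types (H : set C) (F : C -> 'M[C]_k).

Lemma asymp_subset H H' F a : H `<=` H' -> asymp H' F a -> asymp H F a.
Proof.
move=> HH h N; have [K [M [K0 hK]]] := h N; exists K, M; split=> // s Hs.
by apply: hK; exact: HH.
Qed.

Lemma asymp_prod I (r : seq I) (Q : pred I) H (F : I -> C -> 'M[C]_k) (a : I -> nat -> 'M[C]_k) :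
  (forall i, Q i -> asymp H (F i) (a i)) ->
  asymp H (fun s => \prod_(i <- r | Q i) F i s)
    (\big[@fps_mul _/@fps_one _]_(i <- r | Q i) a i).
Proof.
move=> h; elim: r => [|i r IH].
  rewrite big_nil; apply: (@asymp_ext _ _ H (fun=> 1)); last exact: asymp_cst.
  by exists 0 => s _ _; rewrite big_nil.
rewrite big_cons; case: ifPn => Qi; last first.
  by apply: (asymp_ext _ IH); exists 0 => s _ _; rewrite big_cons (negPf Qi).
apply: (asymp_ext _ (asympM (h i Qi) IH)).
by exists 0 => s _ _; rewrite big_cons Qi.
Qed.

Lemma mshiftK (c : C) (a : nat -> 'M[C]_k) p : mshift (- c) (mshift c a) p = a p.
Proof.
have e d (u : nat -> 'M[C]_k) q i j :
    mshift d u q i j = fps_shift d (fun q => u q i j) q.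
  by rewrite /mshift summxE fps_shiftE; apply: eq_bigr => m _; rewrite mxE.
apply/matrixP => i j; rewrite e.
have -> : (fun q => mshift c a q i j) = fps_shift c (fun q => a q i j).
  by apply/funext => q; exact: e.
by rewrite fps_shiftD addNr fps_shift0.
Qed.

(** The values of [L] commute, so that the partial products are the exponentials of
the partial sums. *)
Lemma shifted_product_asymp (tau : C) (m B : R) (L : C -> 'M[C]_k) l phi :
  tau != 0 -> geom B L l -> (forall p q, l p * l q = l q * l p) ->
  phi 0%N = 0 -> (forall p, mshift tau phi p - phi p = l p) ->
  asymp [set s : C | m < complex.Re (s / tau : C)]
    (fun s => limn (fun N => \prod_(0 <= p < N) mexp (- L (s + p%:R * tau))))
    (fpsexp phi).
Proof.
move=> tau0 hL lC phi0 dif; have [B1 _ _] := hL.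
have hL' : geom (2 * B) L l by apply: geom_mono hL; lra.
apply: (asymp_ext _ (asymp_mexp phi0 (shifted_sum_asymp m tau0 hL phi0 dif))).
exists (Num.max (2 * (2 * B)) (Num.max (2 * cmod tau) (2 * `|m| * cmod tau))) => s /= ms Ms.
have far p : 2 * B <= cmod (s + p%:R * tau).
  by have [_ h _] := shifted_far tau0 p ms Ms.
have LC p q : - L (s + p%:R * tau) * - L (s + q%:R * tau) =
    - L (s + q%:R * tau) * - L (s + p%:R * tau).
  by rewrite !mulrNN (geom_comm hL lC (far p) (far q)).
have cv := shifted_sum_cvg tau0 hL' phi0 dif ms Ms.
have sE N : shifted_sum tau L s N = \sum_(0 <= p < N) - L (s + p%:R * tau).
  by rewrite /shifted_sum sumrN.
apply/esym/mcvg_limn; apply: (mcvg_ext _ (mexp_continuous _ cv)) => [N|p].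
  by rewrite (@mexp_sum _ _ (fun p => - L (s + p%:R * tau)) 0 N LC) sE.
apply/esym; apply: (mcvg_comm _ cv) => q; rewrite !sE mulr_suml.
under eq_bigr => i _ do rewrite mulr_sumr.
rewrite exchange_big mulr_suml; apply: eq_bigr => i _; rewrite mulr_sumr.
by apply: eq_bigr => j _; exact: LC.
Qed.

End Products.

Section Factor.
Variables (R : realType) (n : nat) (g : semisimple n) (hbar : Cplx R).
Hypothesis hbar0 : hbar != 0.
Local Notation C := (Cplx R).
Local Notation Y := (yangian g hbar).
Variables (k1 k2 : nat).
Variables (V1 : {lrmorphism Y -> 'M[C]_k1}) (V2 : {lrmorphism Y -> 'M[C]_k2}).
Variables (S : {set 'I_n}) (A : C -> 'M[C]_(k1 * k2)).
Hypothesis hA : is_abelian_A V1 V2 S A.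

Let e : R := (ell g S)%:~R.
Let ellE : ellC R g S = real_to_C e.
Proof. by rewrite /ellC /e /real_to_C rmorph_int. Qed.

Let ellC_neq0 : e != 0 -> ellC R g S != 0.
Proof.
by rewrite ellE -real_to_C0; apply: contra_neq; exact: real_to_C_inj.
Qed.

Lemma Re_div_ell (s : C) : e != 0 ->
  complex.Re (s / (ellC R g S * hbar) : C) = complex.Re (s / hbar : C) / e.
Proof.
move=> e0; have -> : s / (ellC R g S * hbar) = real_to_C e^-1 * (s / hbar).
  by rewrite ellE real_to_CV invfM mulrCA.
by case: (s / hbar) => x y /=; rewrite mul0r subr0 mulrC.
Qed.

Let e_ge0 : 0 <= e. Proof. by rewrite /e ler0z ell_ge0. Qed.

(** When [ell] vanishes, so do all the [c_ij^(r)], and both sides are trivial. *)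
Lemma factor_trivial : e = 0 -> [/\ forall p, log_formal V1 V2 S p = 0 &
  exists B, forall u, B <= cmod u -> A u = 1].
Proof.
move=> e0; have l0 : ell g S = 0 by apply/eqP; rewrite -(intr_eq0 R); apply/eqP.
have q0 i j r : qcoef g S i j r = 0%N by exact: qcoef_eq0.
split.
  move=> p; rewrite (log_formalE V1 V2 S (leqnn p)) big1 ?scaler0// => i _.
  by rewrite big1// => j _; rewrite big1// => r _; rewrite q0 scale0r.
have [B [L [hL hAL]]] := abelian_A_log hbar0 hA; have [B1 _ _] := hL.
have lc0 p : lcoef V1 V2 S p = 0.
  rewrite /lcoef big1 ?oppr0// => i _.
  by rewrite big1// => j _; rewrite big1// => r _; rewrite q0 scale0r.
exists (2 * B) => u uB; rewrite hAL; last by lra.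
rewrite (_ : L u = 0) ?mexp0//; apply: (mcvg_unique (geom_cvg hL uB)).
apply: (mcvg_ext _ (mcvg_cst 0)) => N; rewrite /psum big1// => i _.
by rewrite lc0 scaler0.
Qed.

Lemma asymp_one (H : set C) (F : C -> 'M[C]_(k1 * k2)) B :
  (forall p, log_formal V1 V2 S p = 0) -> (forall s, B <= cmod s -> F s = 1) ->
  asymp H F (fpsexp (log_formal V1 V2 S)).
Proof.
move=> phi0 F1; have [B' h0] := geom_trunc (log_formal V1 V2 S) 0.
have h : asymp H (fun=> 0) (log_formal V1 V2 S).
  apply: geom_asymp (geom_coef _ (geom_ext _ h0)) => [p|u _]; first by rewrite phi0.
  by rewrite /psum big_ord0.
apply: (asymp_ext _ (asymp_mexp (phi0 0%N) h)); exists B => s _ /ltW Bs.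
by rewrite mexp0 F1.
Qed.

Lemma factor_up_asymp m : asymp (halfplane_gt hbar m)
  (fun s => limn (fun N => \prod_(0 <= p < N) invmx (A (s + p%:R * ellC R g S * hbar))))
  (fpsexp (log_formal V1 V2 S)).
Proof.
have [e0|en0] := eqVneq e 0.
  have [phi0 [B A1]] := factor_trivial e0; apply: (@asymp_one _ _ B) => // s Bs.
  apply/mcvg_limn; apply: (mcvg_ext _ (mcvg_cst 1)) => N; apply/esym/big1 => p _.
  by rewrite ellE e0 real_to_C0 mulr0 mul0r addr0 A1// -[RHS](invmx1 C).
have e1 : 0 < e by rewrite lt_def en0 e_ge0.
have ell0 := ellC_neq0 en0.
have tau0 : ellC R g S * hbar != 0 by rewrite mulf_neq0.
have [B [L [hL hAL]]] := abelian_A_log hbar0 hA.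
have := shifted_product_asymp (m / e) tau0 hL (lcoef_comm _ _ S)
  (log_formal0 V1 V2 S) (fun p => log_formal_difference hbar0 V1 V2 p ell0).
move=> h; apply: (asymp_subset _ (asymp_ext _ h)).
  by move=> s /= ms; rewrite Re_div_ell// ltr_pM2r ?invr_gt0.
have [B1 _ _] := hL.
exists (2 * B + 2 * `|m / e| * cmod (ellC R g S * hbar)) => s /= ms Ms.
apply: (congr1 (fun u : nat -> 'M[C]_(k1 * k2) => limn u)); apply/funext => N.
apply: eq_bigr => p _.
have n0 : 0 <= 2 * `|m / e| * cmod (ellC R g S * hbar) by rewrite !mulr_ge0 ?cmod_ge0 ?normr_ge0.
have far : B <= cmod (s + p%:R * (ellC R g S * hbar)).
  have sb : 2 * `|m / e| * cmod (ellC R g S * hbar) <= cmod s by lra.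
  have := halfplane_far p tau0 ms sb.
  have : 0 <= p%:R * cmod (ellC R g S * hbar) by rewrite mulr_ge0 ?cmod_ge0.
  lra.
by rewrite -[X in invmx (A (_ + X))]mulrA hAL// invmx_mexp.
Qed.

(** The product runs in the direction [- tau], with [- L (s - tau)] in place of
[L (s)].  The same formal series solves this equation, because translation by
[- tau] inverts translation by [tau]. *)
Lemma factor_down_asymp m : asymp (halfplane_lt hbar m)
  (fun s => limn (fun N => \prod_(1 <= p < N.+1) A (s - p%:R * ellC R g S * hbar)))
  (fpsexp (log_formal V1 V2 S)).
Proof.
have [e0|en0] := eqVneq e 0.
  have [phi0 [B A1]] := factor_trivial e0; apply: (@asymp_one _ _ B) => // s Bs.
  apply/mcvg_limn; apply: (mcvg_ext _ (mcvg_cst 1)) => N; apply/esym/big1 => p _.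
  by rewrite ellE e0 real_to_C0 mulr0 mul0r subr0 A1.
have e1 : 0 < e by rewrite lt_def en0 e_ge0.
have ell0 := ellC_neq0 en0.
set tau := ellC R g S * hbar.
have tau0 : tau != 0 by rewrite mulf_neq0.
have ntau0 : - tau != 0 by rewrite oppr_eq0.
have [B [L [hL hAL]]] := abelian_A_log hbar0 hA.
have hT := geom_shift (lexx (cmod (- tau))) hL.
have [B' hL'] := geomZ (-1) hT.
have phi0 := log_formal0 V1 V2 S.
have dif p : mshift (- tau) (log_formal V1 V2 S) p - log_formal V1 V2 S p =
    -1 *: mshift (- tau) (lcoef V1 V2 S) p.
  have -> : lcoef V1 V2 S = fun p => mshift tau (log_formal V1 V2 S) p - log_formal V1 V2 S p.
    by apply/funext => q; rewrite (log_formal_difference hbar0 V1 V2 q ell0).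
  have -> : mshift (- tau) (fun p => mshift tau (log_formal V1 V2 S) p - log_formal V1 V2 S p) p =
      log_formal V1 V2 S p - mshift (- tau) (log_formal V1 V2 S) p.
    rewrite -[X in _ = X - _](mshiftK tau) /mshift -sumrB.
    by apply: eq_bigr => j _; rewrite scalerBr.
  by rewrite scaleN1r opprB.
have lC p q : (-1 *: mshift (- tau) (lcoef V1 V2 S) p) * (-1 *: mshift (- tau) (lcoef V1 V2 S) q) =
    (-1 *: mshift (- tau) (lcoef V1 V2 S) q) * (-1 *: mshift (- tau) (lcoef V1 V2 S) p).
  apply: commr_scalemx; apply: commr_sum => i _; apply: commr_scalemx.
  apply: commr_sym; apply: commr_scalemx; apply: commr_sum => j _; apply: commr_scalemx.
  exact: lcoef_comm.
have := shifted_product_asymp (- (m / e)) ntau0 hL' lC phi0 dif.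
move=> h; apply: (asymp_subset _ (asymp_ext _ h)).
  move=> s /= ms; rewrite invrN mulrN.
  have -> : complex.Re (- (s / tau)) = - complex.Re (s / tau : C) by case: (s / tau).
  by rewrite Re_div_ell// ltrN2 ltr_pM2r ?invr_gt0.
have [B1 _ _] := hL.
exists (2 * (B + cmod tau) + 2 * `|- (m / e)| * cmod (- tau)) => s /= ms Ms.
apply: (congr1 (fun u : nat -> 'M[C]_(k1 * k2) => limn u)); apply/funext => N.
rewrite [RHS]big_add1 /=; apply: eq_bigr => p _.
have n0 : 0 <= 2 * `|- (m / e)| * cmod (- tau) by rewrite !mulr_ge0 ?cmod_ge0 ?normr_ge0.
have far : B <= cmod (s + p%:R * (- tau) + - tau).
  have t0 := cmod_ge0 tau.
  have sb : 2 * `|- (m / e)| * cmod (- tau) <= cmod s by lra.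
  have := halfplane_far p ntau0 ms sb.
  have : 0 <= p%:R * cmod (- tau) by rewrite mulr_ge0 ?cmod_ge0.
  have := cmod_subl (s + p%:R * (- tau)) (- tau).
  rewrite cmodN; lra.
have -> : s - p.+1%:R * ellC R g S * hbar = s + p%:R * (- tau) + - tau.
  rewrite -[p.+1%:R * _ * _]mulrA -/tau -[p.+1]addn1 natrD mulrDl mul1r.
  by rewrite mulrN opprD addrA.
by rewrite scaleN1r opprK hAL.
Qed.

End Factor.

Theorem proposition6p6 (R : realType) (n : nat) (g : semisimple n)
    (hbar : Cplx R) (hbar_neq0 : hbar != 0) (k1 k2 : nat)
    (V1 : {lrmorphism yangian g hbar -> 'M[Cplx R]_k1})
    (V2 : {lrmorphism yangian g hbar -> 'M[Cplx R]_k2})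
    (A : {set 'I_n} -> Cplx R -> 'M[Cplx R]_(k1 * k2))
    (A_abelian : forall S, S \in simple_factors g -> is_abelian_A V1 V2 S (A S))
    (m : R) :
  asymptotic_expansion (halfplane_gt hbar m)
    (R0_up g hbar A) (R0_formal V1 V2) /\
  asymptotic_expansion (halfplane_lt hbar m)
    (R0_down g hbar A) (R0_formal V1 V2).
Proof.
have hR : R0_formal V1 V2 = \big[@fps_mul _/@fps_one _]_(S in simple_factors g)
    fpsexp (log_formal V1 V2 S) by apply/funext => p; exact: R0_formalE.
split; apply: asympP; rewrite hR; apply: asymp_prod => S hS.
  exact: factor_up_asymp (A_abelian S hS) m.
exact: factor_down_asymp (A_abelian S hS) m.
Qed.
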